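(* Let $f$ be a function satisfying the following conditions. (1) $f(-x)\neq f(x)$, i.e. $f$ is not an even function. (2) $f$ is regular (analytic) at the point $x=0$, and its Taylor series has the form $$f(x)=\sum_{k=0}^{\infty}\frac{g^{(k)}(0)}{k!}\,(-x)^k ,$$ where $(-1)^k g^{(k)}(x)$ is the $k$-th derivative of $f(x)$ (so $g^{(k)}(0)=(-1)^k f^{(k)}(0)$ for $k=0,1,2,\dots$). (3) $x^{1/2}f(x)\to 0$ as $x\to\infty$. (4) $g^{(s)}(0)$ is a regular (analytic, single-valued) function of $s$ defined on the half-plane $H(\delta)=\{s\in\mathbb{C}:\operatorname{Re}(s)\geq-\delta\}$ for some $3/4<\delta<1$, and it satisfies the growth condition $$|g^{(s)}(0)|<C\,a^{\operatorname{Re}(s)}$$ for some constants $C$ and $a>0$ and all $s\in H(\delta)$. Then, for $q>a>0$, the Hankel transform of order zero $$\mathcal{H}_0[f(x)](q)=\int_0^{\infty}x f(x)J_0(qx)\,dx$$ can be presented by the absolutely and uniformly convergent series $$\begin{aligned}\mathcal{H}_0[f(x)](q)&=\frac{1}{q^3}\sum_{m=0}^{\infty}(-1)^{m+1}\frac{\Gamma(2m+2)}{\Gamma^2(m+1)}\,f^{(2m+1)}(0)\,(2q)^{-2m}\\&=\frac{4}{\pi q^3}\sum_{m=0}^{\infty}(-1)^{m+1}\frac{[\Gamma(m+3/2)]^2}{\Gamma(2m+2)}\,f^{(2m+1)}(0)\left(\frac{q}{2}\right)^{-2m}\\&=\frac{2}{q^2}\sum_{k=0}^{\infty}\frac{\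Gamma(k/2+1)}{\Gamma(-k/2)\,\Gamma(k+1)}\,f^{(k)}(0)\left(\frac{q}{2}\right)^{-k}.\end{aligned}$$
   Context: $J_\nu$ is the Bessel function of the first kind of order $\nu$, $\Gamma$ is the Gamma function, and $1/\Gamma(z)$ is taken to be $0$ when $z$ is a non-positive integer. The parameter $q$ is positive and is not assumed to be large. The notation $g^{(s)}(0)$ for complex $s$ denotes a function of the complex variable $s$ whose value at each integer $s=k\geq 0$ is $g^{(k)}(0)=(-1)^k f^{(k)}(0)$. The number $a$ in ''$q>a>0$'' is the constant $a$ of the growth condition. The integral over $[0,\infty)$ is an improper integral.
   Formalization: Uniform convergence is on q ≥ q0 for each q0 > a, since on all q > a it fails for f(x) = exp(-ax); the Taylor identity is taken for every real x, since a local one would not determine f on the half-line. *)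

(* Defs.v *)
From Stdlib Require Import Reals Factorial.
From Coquelicot Require Import Coquelicot.
Open Scope R_scope.

(** Euler's limit
    [1/Gamma(x) = lim_n x (x+1) ... (x+n) / (n! n^x)],
    an entire function that vanishes exactly at the non-positive integers.
    The term [n = 0] has a meaningless [Rpower 0 x]; it does not affect the
    limit. *)
Definition rGamma (x : R) : R :=
  real (Lim_seq (fun n : nat =>
    prod_f_R0 (fun j : nat => x + INR j) n / (INR (fact n) * Rpower (INR n) x))).

(** Meaningful away from the poles [0, -1, -2, ...] only; a quotient by
    [Gamma] at a possible pole has to be written with [rGamma]. *)
Definition Gamma (x : R) : R := / rGamma x.

Definition BesselJ (n : nat) (x : R) : R :=
  (x / 2) ^ n *
  PSeries (fun k : nat => (-1) ^ k / (INR (fact k) * INR (fact (n + k)))) ((x / 2) ^ 2).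

(** The integral is the limit of the Riemann integrals over [[0, b]] as [b]
    tends to infinity; absolute convergence is not required. *)
Definition is_Hankel (n : nat) (f : R -> C) (q : R) (l : C) : Prop :=
  is_RInt_gen (V := C_R_NormedModule)
    (fun x : R => (RtoC (x * BesselJ n (q * x)) * f x)%C)
    (at_point 0) (Rbar_locally p_infty) l.

Definition Cderiv_n (f : R -> C) (k : nat) (x : R) : C :=
  (Derive_n (fun t => fst (f t)) k x, Derive_n (fun t => snd (f t)) k x).

Definition regular_at_R (f : R -> C) (x0 : R) : Prop :=
  exists (c : nat -> C) (r : R), 0 < r /\
    forall x : R, Rabs (x - x0) < r ->
      is_series (V := C_R_NormedModule)
        (fun k : nat => (c k * RtoC ((x - x0) ^ k))%C) (f x).

(** Complex differentiability on a whole neighbourhood of [s0]. *)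
Definition regular_at_C (G : C -> C) (s0 : C) : Prop :=
  exists r : R, 0 < r /\
    forall s : C, Cmod (s - s0)%C < r ->
      ex_derive (K := C_AbsRing) (V := C_NormedModule) G s.

Definition half_plane (delta : R) (s : C) : Prop := - delta <= Re s.

(** [sum_m u m q = S q] absolutely for every [q > a], and uniformly on
    [[q0, +oo)] for every [q0 > a].  For [f x = exp (- a x)] the series
    considered here do not converge uniformly on all of [(a, +oo)]. *)
Definition abs_unif_sum (a : R) (u : nat -> R -> C) (S : R -> C) : Prop :=
  (forall q : R, a < q -> ex_series (fun m : nat => Cmod (u m q))) /\
  (forall q : R, a < q ->
     is_series (V := C_R_NormedModule) (fun m : nat => u m q) (S q)) /\
  (forall q0 : R, a < q0 ->
     forall eps : R, 0 < eps ->
       exists N : nat, forall n : nat, (N <= n)%nat -> forall q : R, q0 <= q ->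
         Cmod (sum_n (G := C_R_NormedModule) (fun m : nat => u m q) n - S q)%C < eps).

Definition term1 (f : R -> C) (m : nat) (q : R) : C :=
  (RtoC ((-1) ^ (m + 1) * (Gamma (2 * INR m + 2) / Gamma (INR m + 1) ^ 2))
   * Cderiv_n f (2 * m + 1) 0 * RtoC (/ (2 * q) ^ (2 * m)))%C.

Definition term2 (f : R -> C) (m : nat) (q : R) : C :=
  (RtoC ((-1) ^ (m + 1) * (Gamma (INR m + 3 / 2) ^ 2 / Gamma (2 * INR m + 2)))
   * Cderiv_n f (2 * m + 1) 0 * RtoC (/ (q / 2) ^ (2 * m)))%C.

Definition term3 (f : R -> C) (k : nat) (q : R) : C :=
  (RtoC (Gamma (INR k / 2 + 1) * rGamma (- (INR k / 2)) / Gamma (INR k + 1))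
   * Cderiv_n f k 0 * RtoC (/ (q / 2) ^ k))%C.

(* Main.v *)
Require Import Defs.
From Stdlib Require Import Reals Factorial Lra Lia.
From Coquelicot Require Import Coquelicot.
Open Scope R_scope.

(** Let [u] be the real or the imaginary part of [f] and [g_k] its Taylor
    derivatives at [0]. The growth condition at [s = k] gives [|g_k| <= c a^k],
    so [u] is an entire function of exponential type [a]; moreover
    [sqrt x * u x] tends to [0]. Everything below is real analysis of such a [u].

    Write [L_j(p)] for the integral of [x^j J0(q x) exp(-p x)] over the half-line.
    For [p > a] the Taylor series of [u] may be integrated term by term:

      [int_0^oo x u(x) J0(q x) exp(-p x) dx = sum_k g_k/k! L_{k+1}(p).]   (E)

    At [p = 0] the right-hand side is the third series of the theorem:
    [L_j(0+)] vanishes for odd [j], and its values at even [j] are given by a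
    two-term recurrence (Bessel's equation), which the Gamma function also
    satisfies ([weight_term1], [weight_term2], [weight_term3]). The theorem
    therefore says that (E) survives the passage from [p > a] to [p = 0].

    From [p > a] to [p > 0] ([moment_series_continued]). One has
    [L_j(p) = j! r^(-j-1) P_j(p/r)] with [r^2 = p^2 + q^2] and [P_j] the Legendre
    polynomial, whence [|L_j(p)| <= j!/q^(j+1)] ([bessel_moment_bound]). As
    [a < q], the right-hand side of (E) converges absolutely for every [p > 0] and
    can be re-expanded around [p] with a radius that does not depend on [p]; the
    left-hand side can be re-expanded because [u] is bounded on the half-line. So (E) propagates
    to the left in steps of constant length.

    From [p > 0] to [p = 0] ([improper_of_moments], of Fatou-Riesz type). The
    integrand [phi(x) = x u(x) J0(q x)] tends to [0], since [sqrt x * J0(q x)] is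
    bounded, and its exponential moments grow so slowly that their limits [mu_n]
    at [p = 0+] define a function analytic around [0]. Take a function [Th] whose
    derivatives satisfy [|Th^(n)| <= B R0^n] for a small [R0], and which
    approximates a step from [0] to [k > 0] with an integrable error. Expanding
    [Th(T - x)] in powers of [x] and integrating gives exactly

      [int_0^oo phi(x) Th(T - x) dx = sum_n (-1)^n Th^(n)(T)/n! mu_n]

    in the sense of Abel. When [T] grows, only [n = 0] survives on the right, so
    the right-hand side tends to [k mu_0]; the left-hand side differs from [k]
    times the integral of [phi] over [[0, T]] by the convolution of a null function
    with an integrable one, which tends to [0]. *)

(** * Interchange of limits and series *)

(* The carrier of an equation between real numbers may be hidden behind a
   structure projection, where [ring] does not see it. *)
Ltac at_type_R := match goal with |- ?y = ?z => change (y = z :> R) end.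

Lemma inv_fact_ge_0 (n : nat) : 0 <= / INR (fact n).
Proof. apply Rlt_le, Rinv_0_lt_compat, INR_fact_lt_0. Qed.

Lemma le_div_of_mult_le (a b c : R) : 0 < c -> a * c <= b -> a <= b / c.
Proof. intros Hc H; apply (proj1 (Rle_div_r a b c Hc)), H. Qed.

Lemma div_le_of_le_mult (a b c : R) : 0 < c -> a <= b * c -> a / c <= b.
Proof. intros Hc H; apply (proj2 (Rle_div_l a b c Hc)), H. Qed.

Lemma filterlim_sum_f_R0 {T : Type} (F : (T -> Prop) -> Prop) {FF : Filter F}
  (a : T -> nat -> R) (l : nat -> R) (N : nat) :
  (forall n, filterlim (fun t => a t n) F (locally (l n))) ->
  filterlim (fun t => sum_f_R0 (a t) N) F (locally (sum_f_R0 l N)).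
Proof.
  intros H; induction N as [|N IH]; simpl; [apply H|].
  exact (filterlim_comp_2 _ _ Rplus IH (H (S N))
           (filterlim_plus (K := R_AbsRing) (V := R_NormedModule) _ _)).
Qed.

Lemma ex_series_dominated (a M : nat -> R) :
  (forall n, Rabs (a n) <= M n) -> ex_series M -> ex_series a.
Proof. intros H HM; exact (ex_series_le a M H HM). Qed.

Lemma Series_abs_le (a M : nat -> R) :
  (forall n, Rabs (a n) <= M n) -> ex_series M -> Rabs (Series a) <= Series M.
Proof.
  intros H HM.
  assert (Ha : ex_series (fun n => Rabs (a n))).
  { apply (ex_series_dominated _ M); [|exact HM].
    intros n; rewrite Rabs_Rabsolu; apply H. }
  eapply Rle_trans; [apply Series_Rabs, Ha|].
  apply Series_le; [|exact HM].
  intros n; split; [apply Rabs_pos|apply H].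
Qed.

(** Tails of a convergent majorant are uniformly small, so only finitely many
    terms have to be compared. *)
Lemma tannery {T : Type} (F : (T -> Prop) -> Prop) {FF : Filter F}
  (a : T -> nat -> R) (l M : nat -> R) :
  (forall n, filterlim (fun t => a t n) F (locally (l n))) ->
  F (fun t => forall n, Rabs (a t n) <= M n) ->
  (forall n, Rabs (l n) <= M n) ->
  ex_series M ->
  filterlim (fun t => Series (a t)) F (locally (Series l)).
Proof.
  intros Hl Ha HlM HM.
  apply filterlim_locally; intros eps.
  assert (HMlim : is_lim_seq (sum_n M) (Series M)) by exact (Series_correct _ HM).
  assert (He : 0 < eps / 4) by (pose proof (cond_pos eps); lra).
  apply is_lim_seq_spec in HMlim.
  destruct (HMlim (mkposreal _ He)) as [N HN]; simpl in HN.
  assert (Htail : forall b, (forall n, Rabs (b n) <= M n) ->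
            Rabs (Series b - sum_f_R0 b N) <= eps / 4).
  { intros b Hb.
    assert (Hbs : ex_series b) by (apply (ex_series_dominated _ M); assumption).
    rewrite (Series_incr_n b (S N)) by (trivial; lia).
    replace (_ - _) with (Series (fun k => b (S N + k)%nat)) by (simpl; ring).
    assert (HMt : ex_series (fun k => M (S N + k)%nat)).
    { apply (ex_series_incr_n M (S N)); exact HM. }
    eapply Rle_trans; [apply (Series_abs_le _ (fun k => M (S N + k)%nat)); auto|].
    specialize (HN N (Nat.le_refl _)).
    rewrite (Series_incr_n M (S N)) in HN by (trivial; lia).
    rewrite sum_n_Reals in HN. simpl pred in HN.
    apply Rlt_le. eapply Rle_lt_trans; [|exact HN].
    rewrite Rabs_minus_sym. eapply Rle_trans; [|apply Rle_abs].
    apply Req_le; ring. }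
  pose proof (filterlim_sum_f_R0 F a l N Hl) as Hf.
  rewrite filterlim_locally in Hf.
  specialize (Hf (mkposreal _ He)).
  generalize (filter_and _ _ Ha Hf); apply filter_imp.
  intros t [H1 H2].
  change (Rabs (sum_f_R0 (a t) N - sum_f_R0 l N) < eps / 4) in H2.
  change (Rabs (Series (a t) - Series l) < eps).
  pose proof (Htail _ H1) as T1. pose proof (Htail _ HlM) as T2.
  apply Rabs_le_between in T1. apply Rabs_le_between in T2.
  apply Rabs_lt_between in H2. apply Rabs_lt_between.
  pose proof (cond_pos eps). lra.
Qed.

(** Apply Tannery's theorem to the partial sums of the rows. *)
Lemma is_series_swap (a b : nat -> nat -> R) (B : nat -> R) :
  (forall m k, Rabs (a m k) <= b m k) ->
  (forall m, is_series (b m) (B m)) -> ex_series B ->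
  is_series (fun k => Series (fun m => a m k)) (Series (fun m => Series (a m))).
Proof.
  intros Hab Hb HB.
  assert (Hb0 : forall m k, 0 <= b m k).
  { intros m k; eapply Rle_trans; [apply Rabs_pos|apply Hab]. }
  assert (HS : forall m, ex_series (a m)).
  { intros m; apply (ex_series_dominated _ (b m)); [apply Hab|exists (B m); apply Hb]. }
  assert (Hpart : forall m K, sum_n (b m) K <= B m).
  { intros m K. rewrite <- (is_series_unique _ _ (Hb m)), sum_n_Reals.
    apply sum_incr; [|apply Hb0].
    apply is_lim_seq_Reals. eapply is_lim_seq_ext; [apply sum_n_Reals|].
    rewrite (is_series_unique _ _ (Hb m)). exact (Hb m). }
  assert (HsumB : forall m K, Rabs (sum_n (a m) K) <= B m).
  { intros m K. eapply Rle_trans; [|apply (Hpart m K)].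
    eapply Rle_trans; [apply (norm_sum_n_m (V := R_NormedModule) (a m) 0 K)|].
    apply sum_n_m_le. intros k; apply Hab. }
  assert (Hcol : forall k, ex_series (fun m => a m k)).
  { intros k; apply (ex_series_dominated _ B); [|exact HB].
    intros m. eapply Rle_trans; [apply Hab|].
    eapply Rle_trans; [|apply (Hpart m k)].
    rewrite sum_n_Reals. destruct k; simpl; [lra|].
    pose proof (cond_pos_sum (b m) k (Hb0 m)); lra. }
  assert (Hsum : forall K, is_series (fun m => sum_n (a m) K)
                    (sum_n (fun k => Series (fun m => a m k)) K)).
  { induction K as [|K IH].
    - rewrite sum_O. apply (is_series_ext (fun m => a m 0%nat));
        [intros n; rewrite sum_O; reflexivity|].
      apply Series_correct, Hcol.
    - rewrite sum_Sn. apply (is_series_ext (fun m => plus (sum_n (a m) K) (a m (S K))));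
        [intros n; rewrite sum_Sn; reflexivity|].
      apply (is_series_plus (V := R_NormedModule)); [exact IH|apply Series_correct, Hcol]. }
  apply (filterlim_ext (fun K => Series (fun m => sum_n (a m) K)));
    [intros K; apply is_series_unique, Hsum|].
  apply (tannery eventually (fun K m => sum_n (a m) K) (fun m => Series (a m)) B).
  - intros m. exact (Series_correct (a m) (HS m)).
  - apply filter_forall; intros K m; apply HsumB.
  - intros m. rewrite <- (is_series_unique _ _ (Hb m)).
    apply Series_abs_le; [apply Hab|exists (B m); apply Hb].
  - exact HB.
Qed.

(** * Improper integrals *)

(** The integrand is always continuous on the whole line, so the total [RInt]
    is meaningful. *)
Definition improper (f : R -> R) (l : R) : Prop :=
  is_lim (fun X => RInt f 0 X) p_infty l.

Lemma ex_RInt_cont (f : R -> R) (a b : R) :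
  (forall x, continuous f x) -> ex_RInt f a b.
Proof. intros H; apply (ex_RInt_continuous (V := R_CompleteNormedModule)); auto. Qed.

Lemma improper_unique (f : R -> R) (l1 l2 : R) :
  improper f l1 -> improper f l2 -> l1 = l2.
Proof.
  intros H1 H2. apply is_lim_unique in H1. apply is_lim_unique in H2.
  rewrite H1 in H2. congruence.
Qed.

Lemma improper_abs_le (f : R -> R) (l B : R) :
  improper f l -> (forall X, 0 <= X -> Rabs (RInt f 0 X) <= B) -> Rabs l <= B.
Proof.
  intros Hl HB.
  apply Rabs_le; split.
  - apply (is_lim_le_loc (fun _ => - B) (fun X => RInt f 0 X) p_infty (- B) l);
      [|apply is_lim_const|exact Hl].
    exists 0; intros X HX. specialize (HB X (Rlt_le _ _ HX)).
    apply Rabs_le_between in HB; lra.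
  - apply (is_lim_le_loc (fun X => RInt f 0 X) (fun _ => B) p_infty l B);
      [|exact Hl|apply is_lim_const].
    exists 0; intros X HX. specialize (HB X (Rlt_le _ _ HX)).
    apply Rabs_le_between in HB; lra.
Qed.

Lemma is_lim_nondecreasing (F : R -> R) (B : R) :
  (forall x y, 0 <= x <= y -> F x <= F y) -> (forall x, 0 <= x -> F x <= B) ->
  exists l : R, is_lim F p_infty l.
Proof.
  intros Hm HB.
  destruct (completeness (fun y => exists x, 0 <= x /\ y = F x)) as [l [Hub Hlub]].
  - exists B; intros y [x [Hx ->]]; auto.
  - exists (F 0), 0; split; [lra|trivial].
  - exists l. apply is_lim_spec. intros eps; simpl.
    destruct (Classical_Prop.classic (exists x, 0 <= x /\ l - eps < F x)) as [[x [Hx Hl]]|Hn].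
    + exists x; intros y Hy.
      assert (F x <= F y) by (apply Hm; lra).
      assert (F y <= l) by (apply Hub; exists y; split; [lra|trivial]).
      apply Rabs_lt_between; lra.
    + exfalso. assert (Hle : l <= l - eps).
      { apply Hlub. intros y [x [Hx ->]].
        apply Rnot_lt_le; intros Hlt; apply Hn; exists x; auto. }
      pose proof (cond_pos eps); lra.
Qed.

Lemma RInt_nondecreasing (f : R -> R) (x y : R) :
  (forall x, continuous f x) -> (forall x, 0 <= x -> 0 <= f x) ->
  0 <= x <= y -> RInt f 0 x <= RInt f 0 y.
Proof.
  intros Hc Hf Hxy.
  rewrite <- (RInt_Chasles f 0 x y) by (apply ex_RInt_cont; exact Hc).
  assert (0 <= RInt f x y).
  { apply RInt_ge_0; [lra|apply ex_RInt_cont; exact Hc|intros; apply Hf; lra]. }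
  change (RInt f 0 x <= RInt f 0 x + RInt f x y). lra.
Qed.

Lemma RInt_abs_le_dom (f h : R -> R) (X : R) :
  (forall x, continuous f x) -> (forall x, continuous h x) ->
  (forall x, 0 <= x -> Rabs (f x) <= h x) -> 0 <= X ->
  Rabs (RInt f 0 X) <= RInt h 0 X.
Proof.
  intros Hf Hh Hfh HX.
  apply (norm_RInt_le (V := R_NormedModule) f h 0 X); trivial.
  - intros x Hx; apply Hfh; lra.
  - apply (RInt_correct (V := R_CompleteNormedModule)), ex_RInt_cont, Hf.
  - apply (RInt_correct (V := R_CompleteNormedModule)), ex_RInt_cont, Hh.
Qed.

(** Both [h] and [f + h] are nonnegative and have bounded integrals. *)
Lemma improper_dominated (f h : R -> R) (B : R) :
  (forall x, continuous f x) -> (forall x, continuous h x) ->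
  (forall x, 0 <= x -> Rabs (f x) <= h x) ->
  (forall X, 0 <= X -> RInt h 0 X <= B) ->
  exists l, improper f l /\ Rabs l <= B.
Proof.
  intros Hf Hh Hfh HB.
  assert (Hh0 : forall x, 0 <= x -> 0 <= h x).
  { intros x Hx; eapply Rle_trans; [apply Rabs_pos|apply Hfh, Hx]. }
  assert (Hs : forall x, continuous (fun x => f x + h x) x).
  { intros x; apply (continuous_plus (V := R_NormedModule)); auto. }
  assert (Hpl : forall X, RInt (fun x => f x + h x) 0 X = RInt f 0 X + RInt h 0 X).
  { intros X; apply (RInt_plus (V := R_CompleteNormedModule)); apply ex_RInt_cont; auto. }
  destruct (is_lim_nondecreasing (fun X => RInt h 0 X) B) as [l1 Hl1]; auto.
  { intros x y Hxy; apply RInt_nondecreasing; auto. }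
  destruct (is_lim_nondecreasing (fun X => RInt (fun x => f x + h x) 0 X) (B + B))
    as [l2 Hl2].
  { intros x y Hxy; apply RInt_nondecreasing; auto.
    intros z Hz; specialize (Hfh z Hz); apply Rabs_le_between in Hfh; lra. }
  { intros X HX. rewrite Hpl. specialize (HB X HX).
    pose proof (RInt_abs_le_dom f h X Hf Hh Hfh HX) as H.
    apply Rabs_le_between in H; lra. }
  exists (l2 - l1).
  assert (Him : improper f (l2 - l1)).
  { unfold improper. eapply is_lim_ext; [|apply (is_lim_minus' _ _ _ _ _ Hl2 Hl1)].
    intros X; simpl. rewrite Hpl; ring. }
  split; [exact Him|].
  apply (improper_abs_le f); [exact Him|].
  intros X HX. eapply Rle_trans; [apply (RInt_abs_le_dom f h X); auto|auto].
Qed.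

Definition kernel (n : nat) (p x : R) : R := x ^ n * exp (- (p * x)).

Lemma continuous_kernel n p x : continuous (kernel n p) x.
Proof.
  apply (ex_derive_continuous (V := R_NormedModule)).
  unfold kernel. auto_derive; trivial.
Qed.

Lemma kernel_ge_0 n p x : 0 <= x -> 0 <= kernel n p x.
Proof.
  intros Hx; apply Rmult_le_pos; [apply pow_le, Hx|apply Rlt_le, exp_pos].
Qed.

Lemma exp_ge_pow (n : nat) (x : R) : 0 <= x -> x ^ n / INR (fact n) <= exp x.
Proof.
  intros Hx.
  assert (H : is_series (fun k => x ^ k / INR (fact k)) (exp x)).
  { eapply is_series_ext; [|apply (is_exp_Reals x)].
    intros k; simpl; unfold scal; simpl; unfold mult; simpl.
    rewrite pow_n_pow. field. apply INR_fact_neq_0. }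
  assert (H0 : forall k, 0 <= x ^ k / INR (fact k)).
  { intros k; apply Rmult_le_pos; [apply pow_le, Hx|].
    apply inv_fact_ge_0. }
  rewrite <- (is_series_unique _ _ H).
  apply Rle_trans with (sum_f_R0 (fun k => x ^ k / INR (fact k)) n).
  - destruct n; simpl; [lra|].
    pose proof (cond_pos_sum (fun k => x ^ k / INR (fact k)) n H0); simpl in *; lra.
  - apply sum_incr; [|exact H0].
    apply is_lim_seq_Reals. eapply is_lim_seq_ext; [apply sum_n_Reals|].
    rewrite (is_series_unique _ _ H); exact H.
Qed.

Lemma kernel_bound n p x : 0 < p -> 0 <= x ->
  kernel n p x <= INR (fact n) / p ^ n.
Proof.
  intros Hp Hx. unfold kernel.
  pose proof (exp_ge_pow n (p * x)) as H.
  assert (Hpx : 0 <= p * x) by (apply Rmult_le_pos; lra).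
  specialize (H Hpx). rewrite Rpow_mult_distr in H.
  pose proof (INR_fact_lt_0 n). pose proof (pow_lt p n Hp).
  rewrite exp_Ropp. pose proof (exp_pos (p * x)).
  apply Rmult_le_reg_r with (exp (p * x)); [assumption|].
  rewrite Rmult_assoc, Rinv_l, Rmult_1_r by lra.
  apply Rmult_le_reg_l with (p ^ n / INR (fact n)).
  { apply Rdiv_lt_0_compat; assumption. }
  replace (p ^ n / INR (fact n) * x ^ n) with (p ^ n * x ^ n / INR (fact n)) by (field; lra).
  eapply Rle_trans; [exact H|]. apply Req_le. field. split; lra.
Qed.

Lemma kernel_lim_0 n p : 0 < p -> is_lim (kernel n p) p_infty 0.
Proof.
  intros Hp.
  (* trade half of the exponential for the power *)
  apply (is_lim_le_le_loc (fun _ => 0)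
    (fun x => INR (fact n) / (p / 2) ^ n * exp (- (p / 2 * x)))).
  - exists 0; intros x Hx; split; [apply kernel_ge_0; lra|].
    replace (kernel n p x) with (kernel n (p / 2) x * exp (- (p / 2 * x))).
    + apply Rmult_le_compat_r; [apply Rlt_le, exp_pos|apply kernel_bound; lra].
    + unfold kernel. rewrite Rmult_assoc, <- exp_plus. do 2 f_equal. field.
  - apply is_lim_const.
  - replace 0 with (INR (fact n) / (p / 2) ^ n * 0) by ring.
    apply (is_lim_scal_l (fun x => exp (- (p / 2 * x))) (INR (fact n) / (p / 2) ^ n) p_infty 0).
    apply (is_lim_comp exp (fun x => - (p / 2 * x)) p_infty 0 m_infty).
    + apply is_lim_exp_m.
    + replace m_infty with (Rbar_opp (Rbar_mult (p / 2) p_infty)).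
      * apply is_lim_opp, is_lim_scal_l, is_lim_id.
      * simpl. destruct (Rle_dec 0 (p / 2)) as [H|H]; [|lra].
        destruct (Rle_lt_or_eq_dec 0 (p / 2) H); [reflexivity|lra].
    + exists 0; intros; discriminate.
Qed.

Lemma improper_kernel n p : 0 < p ->
  improper (kernel n p) (INR (fact n) / p ^ S n).
Proof.
  intros Hp. induction n as [|n IH].
  - unfold improper.
    apply (is_lim_ext (fun X => 1 / p - kernel 0 p X / p)).
    + intros X. symmetry. apply is_RInt_unique.
      replace (1 / p - kernel 0 p X / p)
        with (minus (- kernel 0 p X / p) (- kernel 0 p 0 / p)).
      * apply (is_RInt_derive (fun x => - kernel 0 p x / p)).
        -- intros x _. unfold kernel. auto_derive; trivial. simpl. field; lra.
        -- intros; apply continuous_kernel.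
      * unfold minus, plus, opp, kernel; simpl. rewrite Rmult_0_r, Ropp_0, exp_0. field; lra.
    + replace (INR (fact 0) / p ^ 1) with (1 / p - 0 / p) by (simpl; field; lra).
      apply (is_lim_minus' (fun _ => 1 / p) (fun X => kernel 0 p X / p)).
      * apply is_lim_const.
      * apply (is_lim_scal_r _ (/ p) p_infty 0), kernel_lim_0, Hp.
  - unfold improper.
    apply (is_lim_ext (fun X => INR (S n) / p * RInt (kernel n p) 0 X - kernel (S n) p X / p)).
    + intros X. symmetry.
      assert (E : is_RInt (fun x => kernel (S n) p x - INR (S n) / p * kernel n p x)
                    0 X (minus (- kernel (S n) p X / p) (- kernel (S n) p 0 / p))).
      { apply (is_RInt_derive (fun x => - kernel (S n) p x / p)).
        - intros x _. unfold kernel. auto_derive; trivial.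
          change (match n with 0%nat => 1 | S _ => INR n + 1 end) with (INR (S n)).
          simpl pow. field; lra.
        - intros x _. apply (continuous_minus (V := R_NormedModule)).
          + apply continuous_kernel.
          + apply (continuous_scal_r (K := R_AbsRing) (V := R_NormedModule)), continuous_kernel. }
      apply (is_RInt_unique (V := R_CompleteNormedModule)) in E.
      rewrite (RInt_minus (V := R_CompleteNormedModule) (kernel (S n) p)
                 (fun x => INR (S n) / p * kernel n p x)) in E.
      * assert (E2 : RInt (fun x => INR (S n) / p * kernel n p x) 0 X
                      = INR (S n) / p * RInt (kernel n p) 0 X).
        { apply (RInt_scal (V := R_CompleteNormedModule)), ex_RInt_cont.
          intros; apply continuous_kernel. }
        rewrite E2 in E.
        change (RInt (kernel (S n) p) 0 X - INR (S n) / p * RInt (kernel n p) 0 X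
                = - kernel (S n) p X / p - - kernel (S n) p 0 / p) in E.
        assert (E3 : kernel (S n) p 0 = 0) by (unfold kernel; simpl; ring).
        rewrite E3 in E. lra.
      * apply ex_RInt_cont; intros; apply continuous_kernel.
      * apply ex_RInt_cont; intros x.
        apply (continuous_scal_r (K := R_AbsRing) (V := R_NormedModule)), continuous_kernel.
    + replace (INR (fact (S n)) / p ^ S (S n))
        with (INR (S n) / p * (INR (fact n) / p ^ S n) - 0 / p).
      2: { rewrite fact_simpl, mult_INR. simpl pow. field. split; [|lra].
           apply pow_nonzero; lra. }
      apply (is_lim_minus' (fun X => INR (S n) / p * RInt (kernel n p) 0 X)).
      * apply (is_lim_scal_l _ (INR (S n) / p) p_infty (INR (fact n) / p ^ S n)), IH.
      * apply (is_lim_scal_r _ (/ p) p_infty 0), kernel_lim_0, Hp.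
Qed.

Lemma RInt_kernel_le n p X : 0 < p -> 0 <= X ->
  RInt (kernel n p) 0 X <= INR (fact n) / p ^ S n.
Proof.
  intros Hp HX.
  apply (is_lim_le_loc (fun _ => RInt (kernel n p) 0 X)
           (fun Y => RInt (kernel n p) 0 Y) p_infty
           (RInt (kernel n p) 0 X) (INR (fact n) / p ^ S n)).
  - exists X; intros Y HY. apply RInt_nondecreasing; [intros; apply continuous_kernel| |lra].
    intros; apply kernel_ge_0; assumption.
  - apply is_lim_const.
  - apply improper_kernel, Hp.
Qed.

(** * Exponential moments and functions of exponential type *)

Lemma ex_series_Rscal (c : R) (a : nat -> R) :
  ex_series a -> ex_series (fun n => c * a n).
Proof. exact (ex_series_scal_l (K := R_AbsRing) (V := R_NormedModule) c a). Qed.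

(** Boundedness is asked on the half-line only: the functions of interest are
    entire, and may grow exponentially to the left. *)
Definition bounded_cont (psi : R -> R) (K : R) : Prop :=
  (forall x, continuous psi x) /\ (forall x, 0 <= x -> Rabs (psi x) <= K).

Definition moment (psi : R -> R) (n : nat) (p : R) : R :=
  real (Lim (fun X => RInt (fun x => psi x * kernel n p x) 0 X) p_infty).

Lemma moment_unique psi n p l :
  improper (fun x => psi x * kernel n p x) l -> moment psi n p = l.
Proof. intros H; unfold moment; rewrite (is_lim_unique _ _ _ H); reflexivity. Qed.

Lemma continuous_Rmult (f g : R -> R) x :
  continuous f x -> continuous g x -> continuous (fun x => f x * g x) x.
Proof. apply (continuous_mult (K := R_AbsRing)). Qed.

Lemma improper_ext (f g : R -> R) l :
  (forall x, f x = g x) -> improper f l -> improper g l.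
Proof.
  intros H; apply is_lim_ext; intros X. apply RInt_ext; auto.
Qed.

Lemma improper_scal (f : R -> R) (c l : R) :
  (forall x, continuous f x) -> improper f l -> improper (fun x => c * f x) (c * l).
Proof.
  intros Hf Hl.
  apply (is_lim_ext (fun X => c * RInt f 0 X)).
  - intros X; symmetry.
    apply (RInt_scal (V := R_CompleteNormedModule)), ex_RInt_cont, Hf.
  - apply (is_lim_scal_l _ c p_infty l), Hl.
Qed.

Lemma improper_plus (f g : R -> R) (l m : R) :
  (forall x, continuous f x) -> (forall x, continuous g x) ->
  improper f l -> improper g m -> improper (fun x => f x + g x) (l + m).
Proof.
  intros Hf Hg Hl Hm.
  apply (is_lim_ext (fun X => RInt f 0 X + RInt g 0 X)).
  - intros X; symmetry.
    apply (RInt_plus (V := R_CompleteNormedModule)); apply ex_RInt_cont; assumption.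
  - apply is_lim_plus'; assumption.
Qed.

Lemma improper_sum (f : nat -> R -> R) (l : nat -> R) (N : nat) :
  (forall k x, continuous (f k) x) -> (forall k, improper (f k) (l k)) ->
  (forall x, continuous (fun x => sum_n (fun k => f k x) N) x) /\
  improper (fun x => sum_n (fun k => f k x) N) (sum_n l N).
Proof.
  intros Hf Hl; induction N as [|N [IHc IHl]].
  - rewrite sum_O; split.
    + intros x. apply (continuous_ext (f 0%nat)); [intros; rewrite sum_O; reflexivity|apply Hf].
    + apply (improper_ext (f 0%nat)); [intros; rewrite sum_O; reflexivity|apply Hl].
  - rewrite sum_Sn; split.
    + intros x. apply (continuous_ext (fun x => plus (sum_n (fun k => f k x) N) (f (S N) x)));
        [intros; rewrite sum_Sn; reflexivity|].
      apply (continuous_plus (V := R_NormedModule)); [apply IHc|apply Hf].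
    + apply (improper_ext (fun x => sum_n (fun k => f k x) N + f (S N) x));
        [intros; rewrite sum_Sn; reflexivity|].
      apply improper_plus; auto.
Qed.

Lemma improper_bound (f h : R -> R) (l L : R) :
  (forall x, continuous f x) -> (forall x, continuous h x) ->
  (forall x, 0 <= x -> Rabs (f x) <= h x) ->
  improper f l -> improper h L -> Rabs l <= L.
Proof.
  intros Hf Hh Hfh Hl HL.
  assert (Hh0 : forall x, 0 <= x -> 0 <= h x).
  { intros x Hx; eapply Rle_trans; [apply Rabs_pos|apply Hfh, Hx]. }
  apply (improper_abs_le f); [exact Hl|].
  intros X HX. eapply Rle_trans; [apply (RInt_abs_le_dom f h X); auto|].
  apply (is_lim_le_loc (fun _ => RInt h 0 X) (fun Y => RInt h 0 Y) p_infty (RInt h 0 X) L).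
  - exists X; intros Y HY. apply RInt_nondecreasing; auto; lra.
  - apply is_lim_const.
  - exact HL.
Qed.

Lemma moment_correct psi K n p : bounded_cont psi K -> 0 < p ->
  improper (fun x => psi x * kernel n p x) (moment psi n p).
Proof.
  intros [Hc Hb] Hp.
  destruct (improper_dominated (fun x => psi x * kernel n p x) (fun x => K * kernel n p x)
              (K * (INR (fact n) / p ^ S n))) as [l [Hl _]].
  - intros x; apply continuous_Rmult; [apply Hc|apply continuous_kernel].
  - intros x; apply continuous_Rmult; [apply continuous_const|apply continuous_kernel].
  - intros x Hx. rewrite Rabs_mult, (Rabs_pos_eq (kernel n p x)) by (apply kernel_ge_0, Hx).
    apply Rmult_le_compat_r; [apply kernel_ge_0, Hx|apply Hb, Hx].
  - intros X HX.
    rewrite (RInt_scal (V := R_CompleteNormedModule))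
      by (apply ex_RInt_cont; intros; apply continuous_kernel).
    apply Rmult_le_compat_l.
    + eapply Rle_trans; [apply Rabs_pos|apply (Hb 0); lra].
    + apply RInt_kernel_le; assumption.
  - rewrite (moment_unique _ _ _ _ Hl); exact Hl.
Qed.

Lemma moment_bound psi K n p : bounded_cont psi K -> 0 < p ->
  Rabs (moment psi n p) <= K * (INR (fact n) / p ^ S n).
Proof.
  intros H Hp.
  apply (improper_bound (fun x => psi x * kernel n p x) (fun x => K * kernel n p x)).
  - intros x; apply continuous_Rmult; [apply H|apply continuous_kernel].
  - intros x; apply continuous_Rmult; [apply continuous_const|apply continuous_kernel].
  - intros x Hx. rewrite Rabs_mult, (Rabs_pos_eq (kernel n p x)) by (apply kernel_ge_0, Hx).
    apply Rmult_le_compat_r; [apply kernel_ge_0, Hx|apply H, Hx].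
  - apply (moment_correct _ K); assumption.
  - apply improper_scal; [intros; apply continuous_kernel|apply improper_kernel, Hp].
Qed.


(** Entire functions of exponential type [b], with the coefficients as data. *)
Definition exp_type (c : nat -> R) (C b : R) (v : R -> R) : Prop :=
  0 <= b /\ (forall k, Rabs (c k) <= C * b ^ k) /\
  (forall x, is_series (fun k => c k / INR (fact k) * x ^ k) (v x)).

Lemma is_series_exp x : is_series (fun k => x ^ k / INR (fact k)) (exp x).
Proof.
  eapply is_series_ext; [|apply (is_exp_Reals x)].
  intros k; simpl; unfold scal; simpl; unfold mult; simpl.
  rewrite pow_n_pow. field. apply INR_fact_neq_0.
Qed.

Lemma exp_type_const_ge_0 c C b v : exp_type c C b v -> 0 <= C.
Proof.
  intros [_ [H _]]. specialize (H 0%nat). simpl in H.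
  pose proof (Rabs_pos (c 0%nat)). lra.
Qed.

(** Compare with the exponential series at the larger exponent [b']: the [k]-th
    term of [exp (b x)] is [(b/b')^k] times that of [exp (b' x)]. The bound decays
    geometrically in [N] with a loss in [x] that a weight [exp (- p x)] with
    [p > b'] absorbs. *)
Lemma exp_type_tail c C b v b' x N : exp_type c C b v -> 0 < b' -> b <= b' -> 0 <= x ->
  Rabs (v x - sum_n (fun k => c k / INR (fact k) * x ^ k) N)
    <= C * (b / b') ^ S N * exp (b' * x).
Proof.
  intros H Hb' Hbb' Hx. pose proof (exp_type_const_ge_0 _ _ _ _ H) as HC.
  destruct H as [Hb [Hc Hs]].
  set (a := fun k => c k / INR (fact k) * x ^ k) in *.
  assert (Ea : Series a = v x) by (apply is_series_unique, Hs).
  rewrite <- Ea, (Series_incr_n a (S N)) by (lia || (exists (v x); apply Hs)).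
  rewrite sum_n_Reals. simpl pred.
  replace (_ + _ - _) with (Series (fun k => a (S N + k)%nat)) by ring.
  set (r := b / b').
  assert (Hr : 0 <= r <= 1).
  { unfold r; split; [apply Rmult_le_pos; [lra|apply Rlt_le, Rinv_0_lt_compat, Hb']|].
    apply Rle_div_l; lra. }
  pose proof (is_series_exp (b' * x)) as He.
  set (e := fun k => (b' * x) ^ k / INR (fact k)) in *.
  assert (Hex : ex_series e) by (exists (exp (b' * x)); exact He).
  assert (He0 : forall k, 0 <= e k).
  { intros k; unfold e; apply Rmult_le_pos.
    - apply pow_le, Rmult_le_pos; lra.
    - apply inv_fact_ge_0. }
  assert (Hle : Series (fun k => e (S N + k)%nat) <= exp (b' * x)).
  { rewrite <- (is_series_unique _ _ He), (Series_incr_n e (S N)) by (trivial; lia).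
    pose proof (cond_pos_sum e (pred (S N)) He0). lra. }
  apply Rle_trans with (Series (fun k => (C * r ^ S N) * e (S N + k)%nat)).
  - apply Series_abs_le.
    + intros k. unfold a, e.
      rewrite Rabs_mult. unfold Rdiv at 1. rewrite Rabs_mult.
      rewrite (Rabs_pos_eq (/ _)) by apply inv_fact_ge_0.
      rewrite (Rabs_pos_eq (x ^ _)) by apply pow_le, Hx.
      apply Rle_trans with ((C * b ^ (S N + k)) * / INR (fact (S N + k)) * x ^ (S N + k)).
      * apply Rmult_le_compat_r; [apply pow_le, Hx|].
        apply Rmult_le_compat_r; [apply inv_fact_ge_0|apply Hc].
      * replace b with (r * b') at 1 by (unfold r; field; lra).
        rewrite !Rpow_mult_distr. rewrite (pow_add r).
        assert (Hrk : r ^ k <= 1) by (rewrite <- (pow1 k); apply pow_incr; lra).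
        pose proof (INR_fact_neq_0 (S N + k)) as Hf.
        replace (C * (r ^ S N * r ^ k * b' ^ (S N + k)) * / INR (fact (S N + k)) * x ^ (S N + k))
          with (r ^ k * (C * r ^ S N * e (S N + k)%nat)).
        2: { unfold e. rewrite Rpow_mult_distr. field; exact Hf. }
        rewrite <- (Rmult_1_l (C * r ^ S N * (_ / _))).
        replace (b' ^ (S N + k) * x ^ (S N + k) / INR (fact (S N + k)))
          with (e (S N + k)%nat) by (unfold e; rewrite Rpow_mult_distr; reflexivity).
        apply Rmult_le_compat_r; [|exact Hrk].
        apply Rmult_le_pos; [apply Rmult_le_pos; [exact HC|apply pow_le, Hr]|apply He0].
    + apply (ex_series_Rscal (C * r ^ S N) (fun k => e (S N + k)%nat)).
      apply (ex_series_incr_n e (S N)), Hex.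
  - rewrite Series_scal_l. apply Rmult_le_compat_l; [|exact Hle].
    apply Rmult_le_pos; [exact HC|apply pow_le, Hr].
Qed.

Lemma exp_type_bound c C b v x : exp_type c C b v -> 0 <= x -> Rabs (v x) <= C * exp (b * x).
Proof.
  intros H Hx. pose proof (exp_type_const_ge_0 _ _ _ _ H) as HC.
  destruct H as [Hb [Hc Hs]].
  rewrite <- (is_series_unique _ _ (Hs x)), <- (is_series_unique _ _ (is_series_exp (b * x))),
    <- Series_scal_l.
  apply Series_abs_le.
  - intros k. unfold Rdiv. rewrite Rabs_mult, Rabs_mult.
    rewrite (Rabs_pos_eq (/ _)) by apply inv_fact_ge_0.
    rewrite (Rabs_pos_eq (x ^ _)) by apply pow_le, Hx.
    replace (C * ((b * x) ^ k * / INR (fact k))) with (C * b ^ k * / INR (fact k) * x ^ k)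
      by (rewrite Rpow_mult_distr; ring).
    apply Rmult_le_compat_r; [apply pow_le, Hx|].
    apply Rmult_le_compat_r; [apply inv_fact_ge_0|apply Hc].
  - apply ex_series_Rscal. exists (exp (b * x)); apply is_series_exp.
Qed.

Lemma CV_radius_infinite (a : nat -> R) :
  (forall x, ex_series (fun k => a k * x ^ k)) -> CV_radius a = p_infty.
Proof.
  intros H.
  destruct (CV_radius a) as [r| |] eqn:E; [exfalso|reflexivity|exfalso].
  - assert (Hr : 0 <= r) by (pose proof (CV_radius_ge_0 a) as H0; rewrite E in H0; exact H0).
    apply (CV_disk_outside a (r + 1)).
    + rewrite E, Rabs_pos_eq by lra. simpl; lra.
    + apply ex_series_lim_0, H.
  - pose proof (CV_radius_ge_0 a) as H0; rewrite E in H0; exact H0.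
Qed.

Lemma exp_type_CV_radius c C b v : exp_type c C b v ->
  CV_radius (fun k => c k / INR (fact k)) = p_infty.
Proof.
  intros [_ [_ Hs]]. apply CV_radius_infinite.
  intros x; exists (v x); apply Hs.
Qed.

Lemma exp_type_PSeries c C b v x : exp_type c C b v ->
  v x = PSeries (fun k => c k / INR (fact k)) x.
Proof. intros [_ [_ Hs]]. symmetry. apply is_series_unique, Hs. Qed.

Lemma exp_type_continuous c C b v x : exp_type c C b v -> continuous v x.
Proof.
  intros H.
  apply (continuous_ext (PSeries (fun k => c k / INR (fact k)))).
  - intros y; symmetry; apply (exp_type_PSeries c C b), H.
  - apply continuity_pt_filterlim, PSeries_continuity.
    rewrite (exp_type_CV_radius c C b v H). exact I.
Qed.

(** Term by term integration. The remainder is controlled by [exp_type_tail] at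
    the midpoint [b'] of [b] and [p], which leaves the weight [exp (- (p - b') x)]. *)
Lemma moment_series psi K c C b v n p :
  bounded_cont psi K -> exp_type c C b v -> b < p ->
  is_series (fun k => c k / INR (fact k) * moment psi (n + k) p)
    (moment (fun x => psi x * v x) n p) /\
  improper (fun x => psi x * v x * kernel n p x)
    (moment (fun x => psi x * v x) n p).
Proof.
  intros Hpsi Hv Hbp.
  pose proof (exp_type_const_ge_0 _ _ _ _ Hv) as HC.
  assert (Hb : 0 <= b) by apply Hv.
  assert (HK : 0 <= K).
  { eapply Rle_trans; [apply Rabs_pos|apply (proj2 Hpsi 0); lra]. }
  assert (Hvc : forall x, continuous v x) by (intros; apply (exp_type_continuous c C b), Hv).
  assert (Hfc : forall x, continuous (fun x => psi x * v x * kernel n p x) x).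
  { intros x. apply (continuous_Rmult (fun x => psi x * v x) (kernel n p)).
    - apply continuous_Rmult; [apply Hpsi|apply Hvc].
    - apply continuous_kernel. }
  destruct (improper_dominated (fun x => psi x * v x * kernel n p x)
    (fun x => (K * C) * kernel n (p - b) x)
    ((K * C) * (INR (fact n) / (p - b) ^ S n))) as [l [Hl _]].
  - exact Hfc.
  - intros x; apply continuous_Rmult; [apply continuous_const|apply continuous_kernel].
  - intros x Hx. rewrite !Rabs_mult, (Rabs_pos_eq (kernel n p x)) by (apply kernel_ge_0, Hx).
    replace (K * C * kernel n (p - b) x) with (K * (C * exp (b * x)) * kernel n p x).
    2: { unfold kernel. replace (- ((p - b) * x)) with (b * x + - (p * x)) by ring.
         rewrite exp_plus. ring. }
    apply Rmult_le_compat_r; [apply kernel_ge_0, Hx|].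
    apply Rmult_le_compat; [apply Rabs_pos|apply Rabs_pos|apply Hpsi, Hx|].
    apply (exp_type_bound c), Hx; exact Hv.
  - intros X HX.
    rewrite (RInt_scal (V := R_CompleteNormedModule))
      by (apply ex_RInt_cont; intros; apply continuous_kernel).
    apply Rmult_le_compat_l; [apply Rmult_le_pos; assumption|].
    apply RInt_kernel_le; lra.
  - rewrite (moment_unique (fun x => psi x * v x) n p l Hl). split; [|exact Hl].
    set (b' := (b + p) / 2). set (r := b / b').
    assert (Hb' : 0 < b' /\ b < b' /\ b' < p) by (unfold b'; lra).
    assert (Hr : 0 <= r < 1).
    { unfold r; split; [apply Rmult_le_pos; [lra|apply Rlt_le, Rinv_0_lt_compat; lra]|].
      apply Rlt_div_l; lra. }
    set (A := K * C * (INR (fact n) / (p - b') ^ S n)).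
    set (t := fun k x => c k / INR (fact k) * (psi x * kernel (n + k) p x)).
    assert (Htc : forall k x, continuous (t k) x).
    { intros k x. apply continuous_Rmult; [apply continuous_const|].
      apply continuous_Rmult; [apply Hpsi|apply continuous_kernel]. }
    assert (Hrem : forall N,
      Rabs (l - sum_n (fun k => c k / INR (fact k) * moment psi (n + k) p) N)
        <= A * r ^ S N).
    { intros N.
      destruct (improper_sum t (fun k => c k / INR (fact k) * moment psi (n + k) p) N)
        as [Hsc Hsl].
      - exact Htc.
      - intros k. unfold t.
        apply (improper_scal (fun x => psi x * kernel (n + k) p x)).
        + intros x; apply continuous_Rmult; [apply Hpsi|apply continuous_kernel].
        + apply (moment_correct psi K); [exact Hpsi|lra].
      - set (s := sum_n (fun k => c k / INR (fact k) * moment psi (n + k) p) N) in *.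
        replace (l - s) with (l + (-1) * s) by ring.
        apply (improper_bound
          (fun x => psi x * v x * kernel n p x + (-1) * sum_n (fun k => t k x) N)
          (fun x => (K * C * r ^ S N) * kernel n (p - b') x)).
        + intros x. apply (continuous_plus (V := R_NormedModule)); [apply Hfc|].
          apply continuous_Rmult; [apply continuous_const|apply Hsc].
        + intros x. apply continuous_Rmult; [apply continuous_const|apply continuous_kernel].
        + intros x Hx.
          replace (psi x * v x * kernel n p x + -1 * sum_n (fun k => t k x) N)
            with (psi x * (v x - sum_n (fun k => c k / INR (fact k) * x ^ k) N) * kernel n p x).
          2: { replace (sum_n (fun k => t k x) N)
                 with (psi x * kernel n p x * sum_n (fun k => c k / INR (fact k) * x ^ k) N).
               - ring.
               - rewrite <- (sum_n_mult_l (K := R_Ring)).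
                 apply sum_n_ext; intros k. unfold t, kernel.
                 rewrite pow_add.
                 at_type_R.
                 change mult with Rmult. ring. }
          rewrite !Rabs_mult, (Rabs_pos_eq (kernel n p x)) by (apply kernel_ge_0, Hx).
          replace (K * C * r ^ S N * kernel n (p - b') x)
            with (K * (C * r ^ S N * exp (b' * x)) * kernel n p x).
          2: { unfold kernel. replace (- ((p - b') * x)) with (b' * x + - (p * x)) by ring.
               rewrite exp_plus. ring. }
          apply Rmult_le_compat_r; [apply kernel_ge_0, Hx|].
          apply Rmult_le_compat; [apply Rabs_pos|apply Rabs_pos|apply Hpsi, Hx|].
          apply (exp_type_tail c C b v); try assumption; lra.
        + apply improper_plus; [exact Hfc| |exact Hl|].
          * intros x; apply continuous_Rmult; [apply continuous_const|apply Hsc].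
          * apply improper_scal; assumption.
        + replace (A * r ^ S N) with (K * C * r ^ S N * (INR (fact n) / (p - b') ^ S n))
            by (unfold A; ring).
          apply improper_scal; [intros; apply continuous_kernel|].
          apply improper_kernel; lra. }
    assert (Hlim : is_lim_seq (sum_n (fun k => c k / INR (fact k) * moment psi (n + k) p)) l);
      [|exact Hlim].
    apply (is_lim_seq_ext (fun N => l - (l - sum_n (fun k => c k / INR (fact k) * moment psi (n + k) p) N))).
    { intros N; ring. }
    replace (Finite l) with (Finite (l - 0)) by (f_equal; ring).
    apply is_lim_seq_minus'; [apply is_lim_seq_const|].
    apply is_lim_seq_abs_0.
    apply (is_lim_seq_le_le (fun _ => 0) _ (fun N => A * r ^ S N)).
    + intros N; split; [apply Rabs_pos|apply Hrem].
    + apply is_lim_seq_const.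
    + replace 0 with (A * 0) by ring.
      apply (is_lim_seq_scal_l _ A 0).
      apply (is_lim_seq_incr_1 (fun N => r ^ N)).
      apply is_lim_seq_geom. rewrite Rabs_pos_eq; lra.
Qed.

(** * Continuation of the moment expansion *)

Lemma is_series_Rscal (c : R) (a : nat -> R) (l : R) :
  is_series a l -> is_series (fun n => c * a n) (c * l).
Proof. exact (is_series_scal_l (K := R_AbsRing) (V := R_NormedModule) c a l). Qed.

Lemma bounded_cont_1 : bounded_cont (fun _ => 1) 1.
Proof.
  split; [intros; apply continuous_const|intros; rewrite Rabs_R1; lra].
Qed.

Lemma moment_1 n p : 0 < p -> moment (fun _ => 1) n p = INR (fact n) / p ^ S n.
Proof.
  intros Hp. apply moment_unique.
  apply (improper_ext (kernel n p)); [intros; ring|apply improper_kernel, Hp].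
Qed.

Lemma exp_type_exp h : exp_type (fun k => h ^ k) 1 (Rabs h) (fun x => exp (h * x)).
Proof.
  split; [apply Rabs_pos|split].
  - intros k; rewrite RPow_abs; lra.
  - intros x. eapply is_series_ext; [|apply is_series_exp].
    intros k; cbv beta; rewrite Rpow_mult_distr; simpl. field; apply INR_fact_neq_0.
Qed.

Lemma moment_exp psi h n p :
  moment (fun x => psi x * exp (h * x)) n p = moment psi n (p - h).
Proof.
  unfold moment. f_equal. apply Lim_ext; intros X. apply RInt_ext; intros x _.
  unfold kernel. replace (- ((p - h) * x)) with (h * x + - (p * x)) by ring.
  rewrite exp_plus. at_type_R. ring.
Qed.

(** Taylor expansion of the moments in [p], with the factor [exp (h x)] taken as
    a function of exponential type [|h|]. *)
Lemma is_series_moment_shift psi K h n p : bounded_cont psi K -> Rabs h < p ->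
  is_series (fun k => h ^ k / INR (fact k) * moment psi (n + k) p) (moment psi n (p - h)).
Proof.
  intros Hpsi Hh. rewrite <- moment_exp.
  apply (moment_series psi K _ 1 (Rabs h)); [exact Hpsi|apply exp_type_exp|exact Hh].
Qed.

(** The negative binomial series, read as the expansion of the moments of [1]. *)
Lemma is_series_negative_binomial b q n : 0 <= b < q ->
  is_series (fun k => b ^ k / INR (fact k) * (INR (fact (n + k)) / q ^ S (n + k)))
    (INR (fact n) / (q - b) ^ S n).
Proof.
  intros H. rewrite <- moment_1 by lra.
  assert (Hb : Rabs b < q) by (rewrite Rabs_pos_eq; lra).
  eapply is_series_ext; [|apply (is_series_moment_shift _ 1 b n q bounded_cont_1 Hb)].
  intros k; simpl. rewrite moment_1 by lra. reflexivity.
Qed.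

(** Analytic continuation in [p] from [p > b], where [moment_series] applies, to
    [p > 0]. Both sides are expanded at [p + h] in powers of [h]; the moments of
    [psi * v] allow this because that function is bounded, the right-hand side
    because its double series converges absolutely for [h < q - b]. As the step
    [h] does not depend on [p], finitely many steps reach any [p > 0]. *)
Lemma moment_series_continued psi K K' c C b v K0 s q :
  bounded_cont psi K -> bounded_cont (fun x => psi x * v x) K' ->
  exp_type c C b v -> b < q ->
  (forall p j, 0 < p ->
     Rabs (moment psi j p) <= K0 * (INR (fact (j + s)) / q ^ S (j + s))) ->
  forall p n, 0 < p ->
    is_series (fun k => c k / INR (fact k) * moment psi (n + k) p)
      (moment (fun x => psi x * v x) n p).
Proof.
  intros Hpsi Hpv Hv Hbq Hmom.
  pose proof (exp_type_const_ge_0 _ _ _ _ Hv) as HC.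
  assert (Hb : 0 <= b) by apply Hv.
  set (P := fun p => forall n, is_series (fun k => c k / INR (fact k) * moment psi (n + k) p)
      (moment (fun x => psi x * v x) n p)).
  set (h := (q - b) / 2).
  assert (Hh : 0 < h /\ h < q - b) by (unfold h; lra).
  assert (Hstep : forall p, 0 < p -> P (p + h) -> P p).
  { intros p Hp HP n.
    (* summing over [k] first gives the moments of [psi * v] at [p + h], summing
       over [m] first those of [psi] at [p] *)
    set (a := fun m k => h ^ m / INR (fact m) * (c k / INR (fact k) * moment psi (n + m + k) (p + h))).
    set (B0 := fun m => h ^ m / INR (fact m) * ((C * K0) * (INR (fact (n + m + s)) / (q - b) ^ S (n + m + s)))).
    assert (Hdom : is_series (fun k => Series (fun m => a m k)) (Series (fun m => Series (a m)))).
    { apply (is_series_swap a (fun m k => h ^ m / INR (fact m) * ((C * K0) *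
        (b ^ k / INR (fact k) * (INR (fact (n + m + s + k)) / q ^ S (n + m + s + k))))) B0).
      - intros m k. unfold a. rewrite !Rabs_mult.
        rewrite (Rabs_pos_eq (h ^ m / _)).
        2: { apply Rmult_le_pos; [apply pow_le; lra|apply inv_fact_ge_0]. }
        apply Rmult_le_compat_l.
        { apply Rmult_le_pos; [apply pow_le; lra|apply inv_fact_ge_0]. }
        replace (C * K0 * (b ^ k / INR (fact k) * (INR (fact (n + m + s + k)) / q ^ S (n + m + s + k))))
          with ((C * b ^ k * / INR (fact k)) * (K0 * (INR (fact (n + m + k + s)) / q ^ S (n + m + k + s)))).
        2: { replace (n + m + k + s)%nat with (n + m + s + k)%nat by lia. unfold Rdiv; ring. }
        apply Rmult_le_compat; [apply Rabs_pos|apply Rabs_pos| |apply Hmom; lra].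
        unfold Rdiv; rewrite Rabs_mult, (Rabs_pos_eq (/ _))
          by apply inv_fact_ge_0.
        apply Rmult_le_compat_r; [apply inv_fact_ge_0|apply Hv].
      - intros m. unfold B0. do 2 apply is_series_Rscal.
        apply (is_series_negative_binomial b q (n + m + s)); lra.
      - unfold B0.
        apply (ex_series_ext (fun m => (C * K0) * (h ^ m / INR (fact m) *
                 (INR (fact (n + s + m)) / (q - b) ^ S (n + s + m))))).
        + intros m. replace (n + m + s)%nat with (n + s + m)%nat by lia.
          at_type_R. ring.
        + apply ex_series_Rscal. eexists.
          apply (is_series_negative_binomial h (q - b) (n + s)); lra. }
    replace (Series (fun m => Series (a m))) with (moment (fun x => psi x * v x) n p) in Hdom.
    - eapply is_series_ext; [|exact Hdom].
      intros k; simpl. unfold a.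
      rewrite (Series_ext _ (fun m => (c k / INR (fact k)) *
                (h ^ m / INR (fact m) * moment psi (n + k + m) (p + h)))).
      + rewrite Series_scal_l. f_equal. 
        pose proof (is_series_moment_shift psi K h (n + k) (p + h) Hpsi) as H.
        apply is_series_unique in H; [|rewrite Rabs_pos_eq; lra]. rewrite H. replace (p + h - h) with p by ring. reflexivity.
      + intros m. replace (n + m + k)%nat with (n + k + m)%nat by lia.
        at_type_R. ring.
    - symmetry.
      rewrite (Series_ext _ (fun m => h ^ m / INR (fact m) * moment (fun x => psi x * v x) (n + m) (p + h))).
      + pose proof (is_series_moment_shift _ K' h n (p + h) Hpv) as H.
        apply is_series_unique in H; [|rewrite Rabs_pos_eq; lra]. rewrite H. replace (p + h - h) with p by ring. reflexivity.
      + intros m. unfold a. rewrite Series_scal_l. f_equal.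
        apply is_series_unique, HP. }
  assert (Hind : forall N p, 0 < p -> P (p + INR N * h) -> P p).
  { induction N as [|N IH]; intros p Hp HP.
    - simpl in HP. replace (p + 0 * h) with p in HP by ring. exact HP.
    - apply IH; [exact Hp|]. apply Hstep.
      + pose proof (Rmult_le_pos _ _ (pos_INR N) (Rlt_le _ _ (proj1 Hh))); lra.
      + rewrite S_INR in HP. replace (p + INR N * h + h) with (p + (INR N + 1) * h) by ring.
        exact HP. }
  intros p n Hp.
  destruct (INR_unbounded (b / h)) as [N HN].
  apply (Hind N p Hp). intros j.
  apply (moment_series psi K c C b v j); [exact Hpsi|exact Hv|].
  apply (Rmult_lt_compat_r h) in HN; [|lra].
  replace (b / h * h) with b in HN by (field; lra). lra.
Qed.

(** * A band-limited approximate step function *)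

(** A function together with all its derivatives, as explicit functions; this
    keeps uniform bounds on the derivatives within reach of induction. *)
Definition derivative_tower (f : nat -> R -> R) : Prop :=
  forall n x, is_derive (f n) x (f (S n) x).

Lemma tower_Derive_n f n x : derivative_tower f -> Derive_n (f 0%nat) n x = f n x.
Proof.
  intros Hf; revert x; induction n as [|n IH]; intros x; simpl; [reflexivity|].
  rewrite (Derive_ext _ (f n)) by exact IH.
  apply is_derive_unique, Hf.
Qed.

Lemma tower_ex_derive_n f n x : derivative_tower f -> ex_derive_n (f 0%nat) n x.
Proof.
  intros Hf. destruct n as [|n]; simpl; [exact I|].
  apply (ex_derive_ext (f n)).
  - intros t; symmetry; apply tower_Derive_n, Hf.
  - exists (f (S n) x); apply Hf.
Qed.

Lemma tower_reflect f T : derivative_tower f -> derivative_tower (fun n x => (-1) ^ n * f n (T - x)).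
Proof.
  intros Hf n x.
  replace ((-1) ^ S n * f (S n) (T - x)) with ((-1) ^ n * ((-1) * f (S n) (T - x)))
    by (simpl; ring).
  apply is_derive_scal.
  apply (is_derive_comp (f n) (fun x => T - x) x (f (S n) (T - x)) (-1)).
  - apply Hf.
  - auto_derive; trivial; ring.
Qed.

Lemma tower_taylor_pos f B R0 x : derivative_tower f -> 0 <= R0 ->
  (forall n y, Rabs (f n y) <= B * R0 ^ n) -> 0 < x ->
  is_series (fun n => f n 0 / INR (fact n) * x ^ n) (f 0%nat x).
Proof.
  intros Hf HR Hb Hx.
  assert (Hrem : forall N, Rabs (f 0%nat x - sum_n (fun n => f n 0 / INR (fact n) * x ^ n) N)
             <= B * ((R0 * x) ^ S N / INR (fact (S N)))).
  { intros N.
    destruct (Taylor_Lagrange (f 0%nat) N 0 x Hx) as [z [_ Hz]].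
    - intros; apply tower_ex_derive_n, Hf.
    - rewrite Hz, sum_n_Reals.
      rewrite (sum_eq _ (fun n => f n 0 / INR (fact n) * x ^ n)).
      2: { intros i _. rewrite tower_Derive_n, Rminus_0_r by exact Hf. unfold Rdiv; ring. }
      rewrite tower_Derive_n, Rminus_0_r by exact Hf.
      replace (_ + _ - _) with (x ^ S N / INR (fact (S N)) * f (S N) z) by ring.
      rewrite Rabs_mult, Rabs_pos_eq.
      2: { apply Rmult_le_pos; [apply pow_le; lra|apply inv_fact_ge_0]. }
      rewrite Rpow_mult_distr.
      replace (B * (R0 ^ S N * x ^ S N / INR (fact (S N))))
        with (x ^ S N / INR (fact (S N)) * (B * R0 ^ S N)) by (unfold Rdiv; ring).
      apply Rmult_le_compat_l; [|apply Hb].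
      apply Rmult_le_pos; [apply pow_le; lra|apply inv_fact_ge_0]. }
  assert (Hlim : is_lim_seq (sum_n (fun n => f n 0 / INR (fact n) * x ^ n)) (f 0%nat x));
    [|exact Hlim].
  apply (is_lim_seq_ext (fun N => f 0%nat x - (f 0%nat x - sum_n (fun n => f n 0 / INR (fact n) * x ^ n) N))).
  { intros N; ring. }
  replace (Finite (f 0%nat x)) with (Finite (f 0%nat x - 0)) by (f_equal; ring).
  apply is_lim_seq_minus'; [apply is_lim_seq_const|].
  apply is_lim_seq_abs_0.
  apply (is_lim_seq_le_le (fun _ => 0) _ (fun N => B * ((R0 * x) ^ S N / INR (fact (S N))))).
  - intros N; split; [apply Rabs_pos|apply Hrem].
  - apply is_lim_seq_const.
  - replace 0 with (B * 0) by ring.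
    apply (is_lim_seq_scal_l _ B 0).
    apply (is_lim_seq_incr_1 (fun N => (R0 * x) ^ N / INR (fact N))).
    apply ex_series_lim_0. eexists; apply is_series_exp.
Qed.

Lemma tower_exp_type f B R0 : derivative_tower f -> 0 <= R0 ->
  (forall n y, Rabs (f n y) <= B * R0 ^ n) ->
  exp_type (fun n => f n 0) B R0 (f 0%nat).
Proof.
  intros Hf HR Hb; split; [exact HR|split; [intros; apply Hb|]].
  intros x. destruct (Rtotal_order x 0) as [Hx|[->|Hx]].
  - pose proof (tower_taylor_pos _ B R0 (- x) (tower_reflect f 0 Hf) HR) as H.
    assert (H' : is_series (fun n => (-1) ^ n * f n (0 - 0) / INR (fact n) * (- x) ^ n)
                   ((-1) ^ 0 * f 0%nat (0 - - x))).
    { apply H; [|lra]. intros n y. rewrite Rabs_mult, pow_1_abs, Rmult_1_l. apply Hb. }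
    replace (f 0%nat x) with ((-1) ^ 0 * f 0%nat (0 - - x)).
    + eapply is_series_ext; [|exact H']. intros n; cbv beta.
      replace (- x) with (-1 * x) by ring.
      rewrite Rpow_mult_distr, Rminus_0_r.
      assert (E : (-1) ^ n * (-1) ^ n = 1)
        by (rewrite <- Rpow_mult_distr; replace (-1 * -1) with 1 by ring; apply pow1).
      at_type_R.
      transitivity (((-1) ^ n * (-1) ^ n) * (f n 0 / INR (fact n) * x ^ n));
        [unfold Rdiv; ring|rewrite E; ring].
    + simpl. rewrite Rmult_1_l. f_equal; ring.
  - assert (H0 : is_lim_seq (sum_n (fun k => f k 0 / INR (fact k) * 0 ^ k)) (f 0%nat 0));
      [|exact H0].
    apply (is_lim_seq_ext (fun _ => f 0%nat 0)); [|apply is_lim_seq_const].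
    induction n as [|n IH].
    + rewrite sum_O. simpl. at_type_R. field.
    + rewrite sum_Sn, <- IH. change plus with Rplus. simpl pow. ring.
  - apply (tower_taylor_pos f B R0); assumption.
Qed.

(** If [f] converges and [f''] is bounded, then [f'] tends to [0]: over a step of
    length [h], the increment of [f] is [h f'] up to an error of order [h^2]. *)
Lemma tower_lim_0 f n l B : derivative_tower f -> is_lim (f n) p_infty (Finite l) ->
  (forall y, Rabs (f (S (S n)) y) <= B) -> is_lim (f (S n)) p_infty 0.
Proof.
  intros Hf Hl HB.
  assert (HB0 : 0 <= B) by (eapply Rle_trans; [apply Rabs_pos|apply (HB 0)]).
  assert (Hc : forall k x, continuity_pt (f k) x).
  { intros k x. apply continuity_pt_filterlim.
    apply (ex_derive_continuous (V := R_NormedModule)). eexists; apply Hf. }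
  apply is_lim_spec. intros eps. simpl.
  set (h := eps / (2 * (B + 1))).
  pose proof (cond_pos eps) as He.
  assert (Hh : 0 < h) by (apply Rdiv_lt_0_compat; lra).
  assert (Hd : 0 < eps * h / 8) by (apply Rdiv_lt_0_compat; [apply Rmult_lt_0_compat|]; lra).
  apply is_lim_spec in Hl. destruct (Hl (mkposreal _ Hd)) as [M HM]; simpl in HM.
  exists M; intros y Hy. rewrite Rminus_0_r.
  destruct (MVT_gen (f n) y (y + h) (f (S n))) as [x [Hx Ex]]; [intros; apply Hf|intros; apply Hc|].
  rewrite Rmin_left, Rmax_right in Hx by lra.
  destruct (MVT_gen (f (S n)) y x (f (S (S n)))) as [z [Hz Ez]]; [intros; apply Hf|intros; apply Hc|].
  assert (H1 : Rabs (f n (y + h) - f n y) < eps * h / 4).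
  { pose proof (HM y Hy) as A1. pose proof (HM (y + h) ltac:(lra)) as A2.
    apply Rabs_lt_between in A1. apply Rabs_lt_between in A2. apply Rabs_lt_between. lra. }
  rewrite Ex in H1. replace (y + h - y) with h in H1 by ring.
  rewrite Rabs_mult, (Rabs_pos_eq h) in H1 by lra.
  assert (H2 : Rabs (f (S n) x) < eps / 4) by (apply (Rmult_lt_reg_r h); lra).
  assert (H3 : Rabs (f (S n) x - f (S n) y) <= eps / 2).
  { rewrite Ez, Rabs_mult. apply Rle_trans with (B * h).
    - apply Rmult_le_compat; [apply Rabs_pos|apply Rabs_pos|apply HB|].
      rewrite Rabs_pos_eq; lra.
    - unfold h. replace (B * (eps / (2 * (B + 1)))) with (eps / 2 * (B / (B + 1))) by (field; lra).
      rewrite <- (Rmult_1_r (eps / 2)) at 2. apply Rmult_le_compat_l; [lra|].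
      apply Rle_div_l; lra. }
  apply Rabs_lt_between in H2. apply Rabs_le_between in H3. apply Rabs_lt_between. lra.
Qed.

Definition dcos (n : nat) (x : R) : R := cos (x + INR n * (PI / 2)).

Lemma tower_dcos : derivative_tower dcos.
Proof.
  intros n x. unfold dcos. auto_derive; trivial.
  rewrite S_INR. replace (x + (INR n + 1) * (PI / 2)) with (PI / 2 + (x + INR n * (PI / 2))) by ring.
  rewrite cos_plus, cos_PI2, sin_PI2. ring.
Qed.

(** The [n]-th derivative of the cosine transform of [(1 - s)^3 / 6]. Integrating
    by parts (Taylor's formula for the cosine) makes it explicit for [n = 0], see
    [spline_eq], while the integral shows that all derivatives are at most [1]. *)
Definition spline (n : nat) (y : R) : R :=
  RInt (fun s => (1 - s) ^ 3 / 6 * s ^ n * dcos n (s * y)) 0 1.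

Lemma continuous_spline_integrand n y s :
  continuous (fun s => (1 - s) ^ 3 / 6 * s ^ n * dcos n (s * y)) s.
Proof.
  apply (ex_derive_continuous (V := R_NormedModule)). unfold dcos. auto_derive; trivial.
Qed.

Lemma tower_spline : derivative_tower spline.
Proof.
  intros n y. unfold spline.
  assert (HD : forall s z, is_derive (fun u => (1 - s) ^ 3 / 6 * s ^ n * dcos n (s * u)) z
                 ((1 - s) ^ 3 / 6 * s ^ S n * dcos (S n) (s * z))).
  { intros s z.
    replace ((1 - s) ^ 3 / 6 * s ^ S n * dcos (S n) (s * z))
      with ((1 - s) ^ 3 / 6 * s ^ n * (s * dcos (S n) (s * z))) by (simpl; field).
    apply is_derive_scal.
    apply (is_derive_comp (dcos n) (fun u => s * u) z (dcos (S n) (s * z)) s).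
    - apply tower_dcos.
    - auto_derive; trivial; ring. }
  rewrite (RInt_ext _ (fun s => Derive (fun u => (1 - s) ^ 3 / 6 * s ^ n * dcos n (s * u)) y)).
  2: { intros s _. symmetry. apply is_derive_unique, HD. }
  apply (is_derive_RInt_param (fun u s => (1 - s) ^ 3 / 6 * s ^ n * dcos n (s * u)) 0 1 y).
  - apply filter_forall. intros z s _. eexists; apply HD.
  - intros s _.
    apply (continuity_2d_pt_ext (fun u v => (1 - v) ^ 3 / 6 * v ^ S n * dcos (S n) (v * u))).
    { intros u v. symmetry. apply is_derive_unique, HD. }
    apply (continuity_2d_pt_mult (fun u v => (1 - v) ^ 3 / 6 * v ^ S n)
             (fun u v => dcos (S n) (v * u))).
    + refine (continuity_1d_2d_pt_comp (fun v => (1 - v) ^ 3 / 6 * v ^ S n) (fun u v => v) y s _ _).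
      * apply continuity_pt_filterlim,
          (ex_derive_continuous (V := R_NormedModule) (fun v => (1 - v) ^ 3 / 6 * v ^ S n)).
        auto_derive; trivial.
      * apply continuity_2d_pt_id2.
    + refine (continuity_1d_2d_pt_comp (dcos (S n)) (fun u v => v * u) y s _ _).
      * apply continuity_pt_filterlim,
          (ex_derive_continuous (V := R_NormedModule) (dcos (S n))).
        eexists; apply tower_dcos.
      * apply (continuity_2d_pt_mult (fun u v => v) (fun u v => u));
          [apply continuity_2d_pt_id2|apply continuity_2d_pt_id1].
  - apply filter_forall. intros z. apply ex_RInt_cont. intros; apply continuous_spline_integrand.
Qed.

Lemma spline_bound n y : Rabs (spline n y) <= 1.
Proof.
  unfold spline. replace 1 with ((1 - 0) * 1) at 2 by ring.
  apply abs_RInt_le_const; [lra|apply ex_RInt_cont; intros; apply continuous_spline_integrand|].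
  intros s Hs. rewrite !Rabs_mult.
  assert (A1 : Rabs ((1 - s) ^ 3 / 6) <= 1).
  { assert (0 <= (1 - s) ^ 3 <= 1).
    { split; [apply pow_le; lra|]. rewrite <- (pow1 3). apply pow_incr; lra. }
    rewrite Rabs_pos_eq; lra. }
  assert (A2 : Rabs (s ^ n) <= 1).
  { rewrite Rabs_pos_eq by (apply pow_le; lra). rewrite <- (pow1 n). apply pow_incr; lra. }
  assert (A3 : Rabs (dcos n (s * y)) <= 1).
  { apply Rabs_le. apply COS_bound. }
  apply Rle_trans with (1 * 1 * 1); [|lra].
  apply Rmult_le_compat; [apply Rmult_le_pos; apply Rabs_pos|apply Rabs_pos| |exact A3].
  apply Rmult_le_compat; [apply Rabs_pos|apply Rabs_pos|exact A1|exact A2].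
Qed.

Lemma spline_eq y : y ^ 4 * spline 0 y = cos y - 1 + y ^ 2 / 2.
Proof.
  unfold spline.
  rewrite <- (RInt_scal (V := R_CompleteNormedModule))
    by (apply ex_RInt_cont; intros; apply continuous_spline_integrand).
  apply is_RInt_unique.
  set (A := fun s => (1 - s) ^ 3 / 6 * y ^ 3 * sin (s * y) - (1 - s) ^ 2 / 2 * y ^ 2 * cos (s * y)
               - (1 - s) * y * sin (s * y) + cos (s * y)).
  replace (cos y - 1 + y ^ 2 / 2) with (minus (A 1) (A 0)).
  - apply (is_RInt_derive A).
    + intros s _. unfold A, dcos. auto_derive; trivial.
      simpl INR. rewrite Rmult_0_l, Rplus_0_r.
      change scal with Rmult. simpl. field.
    + intros s _. apply continuous_Rmult; [apply continuous_const|apply continuous_spline_integrand].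
  - unfold A. change minus with Rminus. rewrite Rmult_0_l, Rmult_1_l, sin_0, cos_0. simpl. field.
Qed.

(** Derivatives of the Jackson kernel [(1 - cos y)^2 / y^4]: since
    [(1 - cos y)^2 = (3 - 4 cos y + cos (2 y)) / 2], the terms of order less than
    [4] in [spline_eq] at [y] and [2 y] cancel. The kernel is nonnegative and
    decays like [y^(-4)], so its primitive is a step with integrable error. *)
Definition jackson (n : nat) (y : R) : R := 8 * 2 ^ n * spline n (2 * y) - 2 * spline n y.

Lemma tower_jackson : derivative_tower jackson.
Proof.
  intros n y. unfold jackson.
  apply (is_derive_minus (V := R_NormedModule)).
  - replace (8 * 2 ^ S n * spline (S n) (2 * y)) with (8 * 2 ^ n * (2 * spline (S n) (2 * y)))
      by (simpl; ring).
    apply is_derive_scal.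
    apply (is_derive_comp (spline n) (fun y => 2 * y) y (spline (S n) (2 * y)) 2).
    + apply tower_spline.
    + auto_derive; trivial; ring.
  - apply is_derive_scal, tower_spline.
Qed.

Lemma jackson_bound n y : Rabs (jackson n y) <= 10 * 2 ^ n.
Proof.
  unfold jackson.
  pose proof (spline_bound n (2 * y)) as H1. pose proof (spline_bound n y) as H2.
  assert (H3 : 1 <= 2 ^ n) by (apply pow_R1_Rle; lra).
  apply Rabs_le_between in H1. apply Rabs_le_between in H2. apply Rabs_le. nra.
Qed.

Lemma jackson_eq y : y ^ 4 * jackson 0 y = (1 - cos y) ^ 2.
Proof.
  unfold jackson.
  pose proof (spline_eq y) as H1. pose proof (spline_eq (2 * y)) as H2.
  rewrite cos_2a_cos in H2. simpl in *. lra.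
Qed.

Lemma jackson_even y : jackson 0 (- y) = jackson 0 y.
Proof.
  assert (H : forall z, spline 0 (- z) = spline 0 z).
  { intros z. unfold spline. apply RInt_ext; intros s _.
    unfold dcos. cbv beta. change (INR 0) with 0. rewrite Rmult_0_l, !Rplus_0_r.
    replace (s * - z) with (- (s * z)) by ring. rewrite cos_neg. reflexivity. }
  unfold jackson. replace (2 * - y) with (- (2 * y)) by ring. rewrite !H. reflexivity.
Qed.

Lemma jackson_pos y : 0 < y -> 0 <= jackson 0 y <= 80 / (1 + y) ^ 3.
Proof.
  intros Hy. pose proof (jackson_eq y) as H.
  assert (Hy4 : 0 < y ^ 4) by (apply pow_lt, Hy).
  pose proof (COS_bound y) as Hc.
  assert (H13 : 0 < (1 + y) ^ 3) by (apply pow_lt; lra).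
  split.
  - apply (Rmult_le_reg_l (y ^ 4)); [exact Hy4|]. rewrite H, Rmult_0_r. apply pow2_ge_0.
  - (* [10] and [4 / y^4] bound the kernel on the two sides of [1] *)
    destruct (Rle_dec y 1) as [H1|H1].
    + pose proof (jackson_bound 0 y) as Hb. simpl in Hb. apply Rabs_le_between in Hb.
      apply Rle_trans with 10; [lra|]. apply le_div_of_mult_le; [exact H13|].
      assert ((1 + y) ^ 3 <= 2 ^ 3) by (apply pow_incr; lra). lra.
    + apply Rle_trans with (10 / y ^ 4).
      * apply le_div_of_mult_le; [exact Hy4|]. rewrite Rmult_comm, H. nra.
      * apply le_div_of_mult_le; [exact H13|].
        replace (10 / y ^ 4 * (1 + y) ^ 3) with (10 * (1 + y) ^ 3 / y ^ 4) by (field; lra).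
        apply div_le_of_le_mult; [exact Hy4|].
        assert (H2 : (1 + y) ^ 3 <= (2 * y) ^ 3) by (apply pow_incr; lra).
        rewrite Rpow_mult_distr in H2. 
        assert (H3 : y ^ 3 <= y ^ 4).
        { simpl. pose proof (pow_lt y 3 Hy) as H4. simpl in H4. nra. }
        lra.
Qed.

Lemma continuous_jackson y : continuous (jackson 0) y.
Proof.
  apply (ex_derive_continuous (V := R_NormedModule)). eexists; apply tower_jackson.
Qed.

Definition jackson_int (y : R) : R := RInt (jackson 0) 0 y.

(** [40 / (1 + x)^2] is the integral over [[x, +oo)] of the majorant in
    [jackson_pos]. *)
Lemma jackson_int_incr x y : 0 <= x <= y ->
  jackson_int x <= jackson_int y <= jackson_int x + 40 / (1 + x) ^ 2.
Proof.
  intros H. unfold jackson_int.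
  rewrite <- (RInt_Chasles (jackson 0) 0 x y) by (apply ex_RInt_cont; exact continuous_jackson).
  change plus with Rplus.
  assert (H0 : 0 <= RInt (jackson 0) x y).
  { apply RInt_ge_0; [lra|apply ex_RInt_cont, continuous_jackson|].
    intros z Hz; apply jackson_pos; lra. }
  assert (Hi : is_RInt (fun s => 80 / (1 + s) ^ 3) x y
                 (minus (- 40 / (1 + y) ^ 2) (- 40 / (1 + x) ^ 2))).
  { apply (is_RInt_derive (fun s => - 40 / (1 + s) ^ 2)).
    - rewrite Rmin_left, Rmax_right by lra. intros s Hs.
      auto_derive; [apply Rgt_not_eq, Rmult_lt_0_compat; lra|]. field. lra.
    - rewrite Rmin_left, Rmax_right by lra. intros s Hs.
      apply (ex_derive_continuous (V := R_NormedModule)). auto_derive.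
      apply Rgt_not_eq; repeat apply Rmult_lt_0_compat; lra. }
  assert (H1 : RInt (jackson 0) x y <= minus (- 40 / (1 + y) ^ 2) (- 40 / (1 + x) ^ 2)).
  { apply (is_RInt_le (jackson 0) (fun s => 80 / (1 + s) ^ 3) x y); [lra| |exact Hi|].
    - apply (RInt_correct (V := R_CompleteNormedModule)), ex_RInt_cont, continuous_jackson.
    - intros z Hz; apply jackson_pos; lra. }
  change minus with Rminus in H1.
  assert (0 < 40 / (1 + y) ^ 2) by (apply Rdiv_lt_0_compat; [lra|apply pow_lt; lra]).
  replace (- 40 / (1 + y) ^ 2) with (- (40 / (1 + y) ^ 2)) in H1 by (field; lra).
  replace (- 40 / (1 + x) ^ 2) with (- (40 / (1 + x) ^ 2)) in H1 by (field; lra).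
  lra.
Qed.

Lemma jackson_int_odd y : jackson_int (- y) = - jackson_int y.
Proof.
  unfold jackson_int.
  pose proof (RInt_comp_lin (V := R_CompleteNormedModule) (jackson 0) (-1) 0 0 y) as H.
  replace (-1 * 0 + 0) with 0 in H by ring. replace (-1 * y + 0) with (- y) in H by ring.
  rewrite <- H by (apply ex_RInt_cont, continuous_jackson).
  rewrite (RInt_ext _ (fun x => opp (jackson 0 x))).
  - apply (RInt_opp (V := R_CompleteNormedModule)), ex_RInt_cont, continuous_jackson.
  - intros x _. replace (-1 * x + 0) with (- x) by ring. rewrite jackson_even.
    change (-1 * jackson 0 x = - jackson 0 x). ring.
Qed.

Lemma jackson_int_lim : exists k, 0 < k /\ forall y, 0 <= y ->
  Rabs (jackson_int y - k) <= 40 / (1 + y) ^ 2.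
Proof.
  destruct (is_lim_nondecreasing jackson_int (jackson_int 0 + 40 / (1 + 0) ^ 2)) as [k Hk].
  - intros x y H; apply jackson_int_incr, H.
  - intros x H; apply jackson_int_incr; lra.
  - exists k.
    assert (Hle : forall y, 0 <= y -> jackson_int y <= k <= jackson_int y + 40 / (1 + y) ^ 2).
    { intros y Hy; split.
      - apply (is_lim_le_loc (fun _ => jackson_int y) jackson_int p_infty (jackson_int y) k);
          [|apply is_lim_const|exact Hk].
        exists y; intros z Hz; apply jackson_int_incr; lra.
      - apply (is_lim_le_loc jackson_int (fun _ => jackson_int y + 40 / (1 + y) ^ 2) p_infty
                 k (jackson_int y + 40 / (1 + y) ^ 2)); [|exact Hk|apply is_lim_const].
        exists y; intros z Hz; apply jackson_int_incr; lra. }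
    split.
    + apply Rlt_le_trans with (jackson_int 1); [|apply Hle; lra].
      apply RInt_gt_0; [lra| |intros; apply continuous_jackson].
      intros x Hx. apply (Rmult_lt_reg_l (x ^ 4)); [apply pow_lt; lra|].
      rewrite jackson_eq, Rmult_0_r.
      assert (cos x < 1).
      { rewrite <- cos_0. pose proof PI2_1. apply cos_decreasing_1; lra. }
      apply pow_lt; lra.
    + intros y Hy. specialize (Hle y Hy). apply Rabs_le. lra.
Qed.

(** The primitive of the Jackson kernel, shifted to vanish at [-oo]. The kernel
    has exponential type [2], hence the dilation by [R0 / 2]. The height [k] of
    the step is the integral of the kernel. *)
Lemma band_limited_step R0 : 0 < R0 ->
  exists th B k D, derivative_tower th /\ (forall n y, Rabs (th n y) <= B * R0 ^ n) /\ 0 < k /\ 0 <= D /\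
    (forall y, 0 <= y -> Rabs (th 0%nat y - k) <= D / (1 + y ^ 2)) /\
    (forall y, y <= 0 -> Rabs (th 0%nat y) <= D / (1 + y ^ 2)).
Proof.
  intros HR. destruct jackson_int_lim as [k [Hk Hlim]].
  set (r := R0 / 2). assert (Hr : 0 < r) by (unfold r; lra).
  set (st := fun n y => match n with 0%nat => k + jackson_int y | S m => jackson m y end).
  assert (Hst : derivative_tower st).
  { intros [|n] y; unfold st.
    - replace (jackson 0 y) with (0 + jackson 0 y) by ring.
      apply (is_derive_plus (V := R_NormedModule) (fun _ => k) jackson_int);
        [apply (is_derive_const (V := R_NormedModule))|].
      apply (is_derive_RInt (jackson 0) jackson_int 0).
      + apply filter_forall. intros z.
        apply (RInt_correct (V := R_CompleteNormedModule)), ex_RInt_cont, continuous_jackson.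
      + apply continuous_jackson.
    - apply tower_jackson. }
  assert (H40 : forall y, 0 <= y -> 0 <= 40 / (1 + y) ^ 2 <= 40).
  { intros y Hy. split.
    - apply Rlt_le, Rdiv_lt_0_compat; [lra|apply pow_lt; lra].
    - apply div_le_of_le_mult; [apply pow_lt; lra|]. nra. }
  assert (Hst0 : forall y, Rabs (st 0%nat y) <= 2 * k + 40).
  { intros y. unfold st. destruct (Rle_dec 0 y) as [Hy|Hy].
    - pose proof (Hlim y Hy) as H. pose proof (H40 y Hy).
      apply Rabs_le_between in H. apply Rabs_le. lra.
    - pose proof (Hlim (- y) ltac:(lra)) as H. rewrite jackson_int_odd in H.
      pose proof (H40 (- y) ltac:(lra)).
      apply Rabs_le_between in H. apply Rabs_le. lra. }
  exists (fun n y => r ^ n * st n (r * y)), (2 * k + 40), (2 * k), (40 * (1 + / r ^ 2)).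
  assert (Hr2 : 0 < / r ^ 2) by (apply Rinv_0_lt_compat, pow_lt, Hr).
  assert (Hcmp : forall y, 0 <= y -> 40 / (1 + r * y) ^ 2 <= 40 * (1 + / r ^ 2) / (1 + y ^ 2)).
  { intros y Hy.
    assert (0 <= r * y) by (apply Rmult_le_pos; lra).
    apply div_le_of_le_mult; [apply pow_lt; lra|].
    replace (40 * (1 + / r ^ 2) / (1 + y ^ 2) * (1 + r * y) ^ 2)
      with (40 * ((1 + / r ^ 2) * (1 + r * y) ^ 2) / (1 + y ^ 2)) by (field; split; nra).
    apply le_div_of_mult_le; [nra|]. apply Rmult_le_compat_l; [lra|].
    assert (E : / r ^ 2 * (r * y) ^ 2 = y ^ 2) by (field; lra).
    set (z := r * y) in *. set (w := / r ^ 2) in *. nra. }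
  split; [|split; [|split; [|split; [|split]]]].
  - intros n y. cbv beta.
    replace (r ^ S n * st (S n) (r * y)) with (r ^ n * (r * st (S n) (r * y))) by (simpl; ring).
    apply is_derive_scal.
    apply (is_derive_comp (st n) (fun y => r * y) y (st (S n) (r * y)) r).
    + apply Hst.
    + auto_derive; trivial; ring.
  - intros n y. rewrite Rabs_mult, (Rabs_pos_eq (r ^ n)) by (apply pow_le; lra).
    replace R0 with (r * 2) by (unfold r; field).
    rewrite Rpow_mult_distr.
    replace ((2 * k + 40) * (r ^ n * 2 ^ n)) with (r ^ n * ((2 * k + 40) * 2 ^ n)) by ring.
    apply Rmult_le_compat_l; [apply pow_le; lra|].
    assert (H2 : 1 <= 2 ^ n) by (apply pow_R1_Rle; lra).
    destruct n as [|n]; [rewrite Rmult_1_r; apply Hst0|].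
    unfold st. eapply Rle_trans; [apply jackson_bound|]. simpl in *. nra.
  - lra.
  - nra.
  - intros y Hy. simpl pow at 1. unfold st.
    replace (1 * (k + jackson_int (r * y)) - 2 * k) with (jackson_int (r * y) - k) by ring.
    eapply Rle_trans; [apply Hlim, Rmult_le_pos; lra|apply Hcmp, Hy].
  - intros y Hy. simpl pow at 1. unfold st.
    replace (1 * (k + jackson_int (r * y))) with (- (jackson_int (r * - y) - k)).
    2: { replace (r * - y) with (- (r * y)) by ring. rewrite jackson_int_odd. ring. }
    rewrite Rabs_Ropp. replace (y ^ 2) with ((- y) ^ 2) by ring.
    eapply Rle_trans; [apply Hlim, Rmult_le_pos; lra|apply Hcmp; lra].
Qed.

(** * A Fatou-Riesz theorem *)

Lemma continuous_bounded (phi : R -> R) (a b : R) : (forall x, continuous phi x) ->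
  exists K, forall x, a <= x <= b -> Rabs (phi x) <= K.
Proof.
  intros Hc. destruct (Rle_dec a b) as [Hab|Hab].
  - destruct (continuity_ab_maj (fun x => Rabs (phi x)) a b Hab) as [m [Hm _]].
    + intros x _. apply continuity_pt_filterlim.
      apply (continuous_comp phi Rabs); [apply Hc|apply continuous_Rabs].
    + exists (Rabs (phi m)); exact Hm.
  - exists 0; intros; lra.
Qed.

Lemma bounded_cont_of_lim (phi : R -> R) l : (forall x, continuous phi x) ->
  is_lim phi p_infty (Finite l) -> exists K, bounded_cont phi K.
Proof.
  intros Hc Hl. apply is_lim_spec in Hl.
  destruct (Hl (mkposreal 1 Rlt_0_1)) as [M HM]; simpl in HM.
  destruct (continuous_bounded phi 0 M Hc) as [K HK].
  exists (Rmax K (Rabs l + 1)); split; [exact Hc|].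
  intros x Hx. destruct (Rle_dec x M) as [H|H].
  - eapply Rle_trans; [apply HK; lra|apply Rmax_l].
  - eapply Rle_trans; [|apply Rmax_r].
    specialize (HM x ltac:(lra)).
    replace (phi x) with (l + (phi x - l)) by ring.
    eapply Rle_trans; [apply Rabs_triang|lra].
Qed.

(** Against a null function, the integrable profile [1 / (1 + y^2)] centred far
    away is negligible. *)
Lemma null_convolution_small (phi : R -> R) D : (forall x, continuous phi x) ->
  is_lim phi p_infty 0 -> 0 <= D -> forall eps, 0 < eps -> exists T0, 0 <= T0 /\
    forall T X, T0 <= T -> T <= X ->
      RInt (fun x => Rabs (phi x) * (D / (1 + (T - x) ^ 2))) 0 X <= eps.
Proof.
  intros Hc Hl HD eps Heps.
  destruct (bounded_cont_of_lim phi 0 Hc Hl) as [K [_ HK]].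
  assert (HK0 : 0 <= K) by (eapply Rle_trans; [apply Rabs_pos|apply (HK 0); lra]).
  (* the profile has mass at most [pi D], less than [4 D]; half of [eps] goes to
     each side of the point [A] where [phi] becomes small *)
  set (e := eps / (8 * (D + 1))).
  assert (He : 0 < e) by (apply Rdiv_lt_0_compat; lra).
  apply is_lim_spec in Hl. destruct (Hl (mkposreal e He)) as [A0 HA0]; simpl in HA0.
  set (A := Rmax A0 1).
  assert (HA : 1 <= A /\ A0 <= A) by (unfold A; split; [apply Rmax_r|apply Rmax_l]).
  set (m := A * K * D * 2 / eps).
  assert (Hm : 0 <= m).
  { unfold m. apply Rmult_le_pos; [|apply Rlt_le, Rinv_0_lt_compat, Heps].
    repeat apply Rmult_le_pos; lra. }
  exists (A + m + 1). split; [lra|]. intros T X HT HX.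
  assert (Hgc : forall x, continuous (fun x => D / (1 + (T - x) ^ 2)) x).
  { intros x. apply (ex_derive_continuous (V := R_NormedModule)). auto_derive.
    apply Rgt_not_eq. pose proof (pow2_ge_0 (T + - x)). simpl in *. lra. }
  assert (Hpos : forall x, 0 < 1 + (T - x) ^ 2) by (intros x; pose proof (pow2_ge_0 (T - x)); lra).
  assert (Hg0 : forall x, 0 <= D / (1 + (T - x) ^ 2)).
  { intros x; apply Rmult_le_pos; [exact HD|apply Rlt_le, Rinv_0_lt_compat, Hpos]. }
  assert (Hfc : forall x, continuous (fun x => Rabs (phi x) * (D / (1 + (T - x) ^ 2))) x).
  { intros x. apply continuous_Rmult; [|apply Hgc].
    apply (continuous_comp phi Rabs); [apply Hc|apply continuous_Rabs]. }
  rewrite <- (RInt_Chasles _ 0 A X) by (apply ex_RInt_cont; exact Hfc).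
  change plus with Rplus.
  assert (H1 : RInt (fun x => Rabs (phi x) * (D / (1 + (T - x) ^ 2))) 0 A <= eps / 2).
  { eapply Rle_trans; [apply Rle_abs|].
    eapply Rle_trans; [apply (abs_RInt_le_const _ 0 A (K * D / (m + 1)))|].
    - lra.
    - apply ex_RInt_cont, Hfc.
    - intros x Hx. rewrite Rabs_mult, Rabs_Rabsolu, (Rabs_pos_eq (D / _)) by apply Hg0.
      replace (K * D / (m + 1)) with (K * (D / (m + 1))) by (unfold Rdiv; ring).
      apply Rmult_le_compat; [apply Rabs_pos|apply Hg0|apply HK; lra|].
      apply Rmult_le_compat_l; [exact HD|]. apply Rinv_le_contravar; [lra|].
      assert (m + 1 <= T - x) by lra. nra.
    - assert (Em : A * (K * D) = m * eps / 2) by (unfold m; field; lra).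
      replace ((A - 0) * (K * D / (m + 1))) with (A * (K * D) / (m + 1)) by (unfold Rdiv; ring).
      rewrite Em.
      apply div_le_of_le_mult; [lra|]. nra. }
  assert (H2 : RInt (fun x => Rabs (phi x) * (D / (1 + (T - x) ^ 2))) A X <= eps / 2).
  { assert (Hi : is_RInt (fun x => e * (D / (1 + (T - x) ^ 2))) A X
                   (minus (e * D * - atan (T - X)) (e * D * - atan (T - A)))).
    { apply (is_RInt_derive (fun x => e * D * - atan (T - x))).
      - intros x _. auto_derive; trivial. unfold Rsqr.
        specialize (Hpos x). field. simpl in Hpos. lra.
      - intros x _. apply continuous_Rmult; [apply continuous_const|apply Hgc]. }
    apply Rle_trans with (minus (e * D * - atan (T - X)) (e * D * - atan (T - A)));
      [apply (is_RInt_le (fun x => Rabs (phi x) * (D / (1 + (T - x) ^ 2)))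
                (fun x => e * (D / (1 + (T - x) ^ 2))) A X); [lra| |exact Hi|]|].
    - apply (RInt_correct (V := R_CompleteNormedModule)), ex_RInt_cont, Hfc.
    - intros x Hx. apply Rmult_le_compat_r; [apply Hg0|].
      specialize (HA0 x ltac:(lra)). rewrite Rminus_0_r in HA0. lra.
    - change minus with Rminus.
      pose proof (atan_bound (T - X)). pose proof (atan_bound (T - A)). pose proof PI_4.
      assert (HeD : e * D <= eps / 8).
      { unfold e. replace (eps / (8 * (D + 1)) * D) with (eps / 8 * (D / (D + 1))) by (field; lra).
        rewrite <- (Rmult_1_r (eps / 8)) at 2. apply Rmult_le_compat_l; [lra|].
        apply div_le_of_le_mult; lra. }
      assert (0 <= e * D) by (apply Rmult_le_pos; lra).
      assert (atan (T - A) - atan (T - X) <= 4) by lra.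
      nra. }
  lra.
Qed.

Lemma filterlim_abs_le {T : Type} (F : (T -> Prop) -> Prop) {FF : ProperFilter F}
  (f : T -> R) (l B : R) :
  filterlim f F (locally l) -> F (fun t => Rabs (f t) <= B) -> Rabs l <= B.
Proof.
  intros Hl HB. apply Rnot_lt_le; intros Hlt.
  rewrite filterlim_locally in Hl.
  assert (He : 0 < Rabs l - B) by lra.
  destruct (filter_ex _ (filter_and _ _ HB (Hl (mkposreal _ He)))) as [t [H1 H2]].
  change (Rabs (f t - l) < Rabs l - B) in H2.
  pose proof (Rabs_triang_inv l (f t)) as H3. rewrite Rabs_minus_sym in H3. lra.
Qed.

Lemma moment_0_RInt_at_right (phi : R -> R) T : (forall x, continuous phi x) -> 0 <= T ->
  filterlim (fun p => RInt (fun x => phi x * kernel 0 p x) 0 T) (at_right 0)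
    (locally (RInt phi 0 T)).
Proof.
  intros Hc HT.
  destruct (continuous_bounded phi 0 T Hc) as [K HK].
  assert (HK0 : 0 <= K) by (eapply Rle_trans; [apply Rabs_pos|apply (HK 0); lra]).
  apply filterlim_locally. intros eps.
  assert (He : 0 < eps / (K * T * T + 1)).
  { apply Rdiv_lt_0_compat; [apply cond_pos|]. 
    assert (0 <= K * T * T) by (repeat apply Rmult_le_pos; lra). lra. }
  exists (mkposreal _ He). intros p Hp Hp0.
  change (Rabs (p - 0) < eps / (K * T * T + 1)) in Hp.
  rewrite Rminus_0_r, Rabs_pos_eq in Hp by lra.
  assert (Hkc : forall x, continuous (fun x => phi x * kernel 0 p x) x).
  { intros x; apply continuous_Rmult; [apply Hc|apply continuous_kernel]. }
  change (Rabs (RInt (fun x => phi x * kernel 0 p x) 0 T - RInt phi 0 T) < eps).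
  assert (E : RInt (fun x => minus (phi x * kernel 0 p x) (phi x)) 0 T
              = RInt (fun x => phi x * kernel 0 p x) 0 T - RInt phi 0 T).
  { apply (RInt_minus (V := R_CompleteNormedModule)); apply ex_RInt_cont; assumption. }
  rewrite <- E.
  eapply Rle_lt_trans; [apply (abs_RInt_le_const _ 0 T (K * (p * T)))|].
  - exact HT.
  - apply ex_RInt_cont. intros x. apply (continuous_minus (V := R_NormedModule)); [apply Hkc|apply Hc].
  - intros x Hx. change minus with Rminus.
    replace (phi x * kernel 0 p x - phi x) with (phi x * (kernel 0 p x - 1)) by ring.
    rewrite Rabs_mult. apply Rmult_le_compat; [apply Rabs_pos|apply Rabs_pos|apply HK, Hx|].
    unfold kernel. rewrite pow_O, Rmult_1_l.
    assert (Hpx : 0 <= p * x) by (apply Rmult_le_pos; lra).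
    assert (H1 : 1 + - (p * x) <= exp (- (p * x))) by apply exp_ineq1_le.
    assert (H2 : exp (- (p * x)) <= 1).
    { rewrite <- exp_0. destruct Hpx as [Hpx|<-]; [left; apply exp_increasing; lra|right; f_equal; ring]. }
    assert (H3 : p * x <= p * T) by (apply Rmult_le_compat_l; lra).
    apply Rabs_le. lra.
  - assert (0 <= K * T * T) by (repeat apply Rmult_le_pos; lra).
    apply (Rmult_lt_compat_r (K * T * T + 1)) in Hp; [|lra].
    replace (eps / (K * T * T + 1) * (K * T * T + 1)) with (pos eps) in Hp by (field; lra).
    nra.
Qed.

Lemma kernel_0_le_1 p x : 0 < p -> 0 <= x -> 0 <= kernel 0 p x <= 1.
Proof.
  intros Hp Hx. split; [apply kernel_ge_0, Hx|].
  pose proof (kernel_bound 0 p x Hp Hx) as H. simpl in H. lra.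
Qed.

(** The bound is uniform in [p], so that [p] may tend to [0] before [T] tends to
    infinity. *)
Lemma smooth_cutoff_error (phi v : R -> R) k D p T X :
  (forall x, continuous phi x) -> (forall x, continuous v x) -> 0 < p -> 0 <= T <= X -> 0 <= D ->
  (forall x, x <= T -> Rabs (v x - k) <= D / (1 + (T - x) ^ 2)) ->
  (forall x, T <= x -> Rabs (v x) <= D / (1 + (T - x) ^ 2)) ->
  Rabs (k * RInt (fun x => phi x * kernel 0 p x) 0 T
        - RInt (fun x => phi x * v x * kernel 0 p x) 0 X)
    <= RInt (fun x => Rabs (phi x) * (D / (1 + (T - x) ^ 2))) 0 X.
Proof.
  intros Hc Hv Hp HT HD Hl Hr.
  assert (Hpos : forall x, 0 < 1 + (T - x) ^ 2) by (intros x; pose proof (pow2_ge_0 (T - x)); lra).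
  assert (Hgc : forall x, continuous (fun x => Rabs (phi x) * (D / (1 + (T - x) ^ 2))) x).
  { intros x. apply continuous_Rmult.
    - apply (continuous_comp phi Rabs); [apply Hc|apply continuous_Rabs].
    - apply (ex_derive_continuous (V := R_NormedModule)). auto_derive.
      specialize (Hpos x). simpl in *. lra. }
  assert (Hkc : forall x, continuous (fun x => phi x * kernel 0 p x) x).
  { intros x; apply continuous_Rmult; [apply Hc|apply continuous_kernel]. }
  assert (Hvc : forall x, continuous (fun x => phi x * v x * kernel 0 p x) x).
  { intros x. apply (continuous_Rmult (fun x => phi x * v x)); [|apply continuous_kernel].
    apply continuous_Rmult; [apply Hc|apply Hv]. }
  set (d1 := fun x => minus (k * (phi x * kernel 0 p x)) (phi x * v x * kernel 0 p x)).
  assert (Hdc : forall x, continuous d1 x).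
  { intros x; apply (continuous_minus (V := R_NormedModule)); [|apply Hvc].
    apply (continuous_Rmult (fun _ => k)); [apply continuous_const|apply Hkc]. }
  assert (E1 : RInt d1 0 T = k * RInt (fun x => phi x * kernel 0 p x) 0 T
                - RInt (fun x => phi x * v x * kernel 0 p x) 0 T).
  { unfold d1.
    rewrite (RInt_minus (V := R_CompleteNormedModule)); [| |apply ex_RInt_cont, Hvc].
    - rewrite (RInt_scal (V := R_CompleteNormedModule)) by apply ex_RInt_cont, Hkc. reflexivity.
    - apply ex_RInt_cont; intros x.
      apply (continuous_Rmult (fun _ => k)); [apply continuous_const|apply Hkc]. }
  rewrite <- (RInt_Chasles (fun x => phi x * v x * kernel 0 p x) 0 T X)
    by (apply ex_RInt_cont; exact Hvc).
  rewrite <- (RInt_Chasles (fun x => Rabs (phi x) * _) 0 T X)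
    by (apply ex_RInt_cont; exact Hgc).
  change plus with Rplus.
  replace (_ - (_ + _)) with (RInt d1 0 T - RInt (fun x => phi x * v x * kernel 0 p x) T X)
    by (rewrite E1; ring).
  eapply Rle_trans; [apply Rabs_triang|]. rewrite Rabs_Ropp.
  apply Rplus_le_compat.
  - apply (norm_RInt_le (V := R_NormedModule) d1
             (fun x => Rabs (phi x) * (D / (1 + (T - x) ^ 2))) 0 T); [lra| | |].
    + intros x Hx. change (Rabs (d1 x) <= Rabs (phi x) * (D / (1 + (T - x) ^ 2))).
      unfold d1. change minus with Rminus.
      replace (k * (phi x * kernel 0 p x) - phi x * v x * kernel 0 p x)
        with (phi x * (- (v x - k) * kernel 0 p x)) by ring.
      rewrite !Rabs_mult, Rabs_Ropp. apply Rmult_le_compat_l; [apply Rabs_pos|].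
      pose proof (kernel_0_le_1 p x Hp ltac:(lra)).
      rewrite (Rabs_pos_eq (kernel 0 p x)) by lra.
      specialize (Hl x ltac:(lra)). pose proof (Rabs_pos (v x - k)). nra.
    + apply (RInt_correct (V := R_CompleteNormedModule)), ex_RInt_cont, Hdc.
    + apply (RInt_correct (V := R_CompleteNormedModule)), ex_RInt_cont, Hgc.
  - apply (norm_RInt_le (V := R_NormedModule) (fun x => phi x * v x * kernel 0 p x)
             (fun x => Rabs (phi x) * (D / (1 + (T - x) ^ 2))) T X); [lra| | |].
    + intros x Hx.
      change (Rabs (phi x * v x * kernel 0 p x) <= Rabs (phi x) * (D / (1 + (T - x) ^ 2))).
      rewrite Rmult_assoc, !Rabs_mult. apply Rmult_le_compat_l; [apply Rabs_pos|].
      pose proof (kernel_0_le_1 p x Hp ltac:(lra)).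
      rewrite (Rabs_pos_eq (kernel 0 p x)) by lra.
      specialize (Hr x ltac:(lra)). pose proof (Rabs_pos (v x)). nra.
    + apply (RInt_correct (V := R_CompleteNormedModule)), ex_RInt_cont, Hvc.
    + apply (RInt_correct (V := R_CompleteNormedModule)), ex_RInt_cont, Hgc.
Qed.

Lemma filterlim_scal_minus {T : Type} (F : (T -> Prop) -> Prop) {FF : Filter F}
  (f g : T -> R) (k lf lg : R) :
  filterlim f F (locally lf) -> filterlim g F (locally lg) ->
  filterlim (fun t => k * f t - g t) F (locally (k * lf - lg)).
Proof.
  intros Hf Hg.
  refine (filterlim_comp_2 (G := locally (k * lf)) (H := locally (- lg))
            (fun t => k * f t) (fun t => - g t) Rplus _ _
            (filterlim_plus (K := R_AbsRing) (V := R_NormedModule) _ _)).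
  - exact (filterlim_comp _ _ _ f (fun m => k * m) _ _ _ Hf
             (filterlim_scal_r (K := R_AbsRing) (V := R_NormedModule) k lf)).
  - exact (filterlim_comp _ _ _ g Ropp _ _ _ Hg
             (filterlim_opp (K := R_AbsRing) (V := R_NormedModule) lg)).
Qed.

Lemma is_series_only_0 (l : nat -> R) : (forall n, l (S n) = 0) -> is_series l (l 0%nat).
Proof.
  intros H.
  assert (H0 : is_lim_seq (sum_n l) (l 0%nat)); [|exact H0].
  apply (is_lim_seq_ext (fun _ => l 0%nat)); [|apply is_lim_seq_const].
  induction n as [|n IH]; [rewrite sum_O; reflexivity|].
  rewrite sum_Sn, <- IH, H. change plus with Rplus. ring.
Qed.

(** The moments are, up to sign, the derivatives of the Laplace transform of
    [phi]; their bound expresses its analytic continuation to a neighbourhood of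
    [p = 0]. The type [eta / 2] of the step lies below the radius [eta], so that
    [moment_series_continued] evaluates the smooth truncation of [phi] for all
    [p > 0]. Then let [p] tend to [0], and the cutoff [T] to infinity. *)
Lemma improper_of_moments (phi : R -> R) (Cm : R) (s : nat) (eta : R) (mu : nat -> R) :
  (forall x, continuous phi x) -> is_lim phi p_infty 0 -> 0 < eta ->
  (forall n p, 0 < p ->
     Rabs (moment phi n p) <= Cm * (INR (fact (n + s)) / eta ^ S (n + s))) ->
  (forall n, filterlim (moment phi n) (at_right 0) (locally (mu n))) ->
  improper phi (mu 0%nat).
Proof.
  intros Hc Hl Heta Hmom Hmu.
  destruct (bounded_cont_of_lim phi 0 Hc Hl) as [K HK].
  destruct (band_limited_step (eta / 2)) as [th [B [k [D [Hth [HB [Hk [HD [Hright Hleft]]]]]]]]].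
  { lra. }
  set (c := fun T n => (-1) ^ n * th n T).
  assert (Hcb : forall T n, Rabs (c T n) <= B * (eta / 2) ^ n).
  { intros T n. unfold c. rewrite Rabs_mult, pow_1_abs, Rmult_1_l. apply HB. }
  set (v := fun T x => th 0%nat (T - x)).
  assert (Hv : forall T, exp_type (c T) B (eta / 2) (v T)).
  { intros T.
    pose proof (tower_exp_type _ B (eta / 2) (tower_reflect th T Hth) ltac:(lra)) as [_ [_ H]].
    - intros n y. rewrite Rabs_mult, pow_1_abs, Rmult_1_l. apply HB.
    - split; [lra|split; [apply Hcb|]].
      intros x. specialize (H x). cbv beta in H. rewrite pow_O, Rmult_1_l in H.
      eapply is_series_ext; [|exact H]. intros n; unfold c. rewrite Rminus_0_r. reflexivity. }
  assert (Hvc : forall T x, continuous (v T) x).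
  { intros T x. apply (exp_type_continuous (c T) B (eta / 2)), Hv. }
  set (M := fun n => B * (eta / 2) ^ n / INR (fact n) * (Cm * (INR (fact (n + s)) / eta ^ S (n + s)))).
  assert (HM : ex_series M).
  { apply (ex_series_ext (fun n => (B * Cm) * ((eta / 2) ^ n / INR (fact n)
             * (INR (fact (s + n)) / eta ^ S (s + n))))).
    - intros n. unfold M. rewrite (Nat.add_comm n s).
      at_type_R. unfold Rdiv; ring.
    - apply ex_series_Rscal. eexists. apply is_series_negative_binomial; lra. }
  assert (Hterm : forall T n m, Rabs m <= Cm * (INR (fact (n + s)) / eta ^ S (n + s)) ->
            Rabs (c T n / INR (fact n) * m) <= M n).
  { intros T n m Hm. unfold M. rewrite Rabs_mult.
    apply Rmult_le_compat; [apply Rabs_pos|apply Rabs_pos| |exact Hm].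
    unfold Rdiv; rewrite Rabs_mult, (Rabs_pos_eq (/ _))
      by apply inv_fact_ge_0.
    apply Rmult_le_compat_r; [apply inv_fact_ge_0|apply Hcb]. }
  assert (Hmub : forall n, Rabs (mu n) <= Cm * (INR (fact (n + s)) / eta ^ S (n + s))).
  { intros n. apply (filterlim_abs_le (at_right 0) (moment phi n)); [apply Hmu|].
    exists (mkposreal 1 Rlt_0_1). intros p _ Hp. apply Hmom, Hp. }
  set (W0 := fun T => Series (fun n => c T n / INR (fact n) * mu n)).
  (* the smooth truncation of [phi], computed from the moments *)
  assert (HW : forall T p, 0 < p -> moment (fun x => phi x * v T x) 0 p
                 = Series (fun n => c T n / INR (fact n) * moment phi n p)).
  { intros T p Hp. symmetry. apply is_series_unique.
    refine (moment_series_continued phi K (K * B) (c T) B (eta / 2) (v T) Cm s eta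
              HK _ (Hv T) _ (fun p j => Hmom j p) p 0 Hp); [|lra].
    split.
    - intros x; apply continuous_Rmult; [apply Hc|apply Hvc].
    - intros x Hx. rewrite Rabs_mult. apply Rmult_le_compat; [apply Rabs_pos|apply Rabs_pos|apply HK, Hx|].
      unfold v. specialize (HB 0%nat (T - x)). rewrite pow_O, Rmult_1_r in HB. exact HB. }
  assert (HWlim : forall T, filterlim (fun p => moment (fun x => phi x * v T x) 0 p) (at_right 0)
                    (locally (W0 T))).
  { intros T.
    apply (filterlim_ext_loc (fun p => Series (fun n => c T n / INR (fact n) * moment phi n p))).
    { exists (mkposreal 1 Rlt_0_1). intros p _ Hp. symmetry. apply HW, Hp. }
    apply (tannery (at_right 0) (fun p n => c T n / INR (fact n) * moment phi n p)
             (fun n => c T n / INR (fact n) * mu n) M).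
    - intros n. apply (filterlim_comp _ _ _ (moment phi n) (fun m => c T n / INR (fact n) * m)
        _ (locally (mu n))); [apply Hmu|].
      apply (filterlim_scal_r (K := R_AbsRing) (V := R_NormedModule)).
    - exists (mkposreal 1 Rlt_0_1). intros p _ Hp n. apply Hterm, Hmom, Hp.
    - intros n. apply Hterm, Hmub.
    - exact HM. }
  (* every derivative of the step dies out far to the right of its jump *)
  assert (Hth0 : is_lim (th 0%nat) p_infty k).
  { apply is_lim_spec. intros eps; simpl. exists (Rmax 1 (D / eps)). intros y Hy.
    pose proof (cond_pos eps) as He.
    assert (Hy1 : 1 < y) by (eapply Rle_lt_trans; [apply Rmax_l|exact Hy]).
    assert (Hy2 : D / eps < y) by (eapply Rle_lt_trans; [apply Rmax_r|exact Hy]).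
    eapply Rle_lt_trans; [apply Hright; lra|].
    apply (Rmult_lt_reg_r (1 + y ^ 2)); [nra|].
    replace (D / (1 + y ^ 2) * (1 + y ^ 2)) with D by (field; nra).
    apply (Rmult_lt_compat_r eps) in Hy2; [|lra].
    replace (D / eps * eps) with D in Hy2 by (field; lra). nra. }
  assert (HthS : forall n, is_lim (th (S n)) p_infty 0).
  { induction n as [|n IH].
    - apply (tower_lim_0 th 0 k (B * (eta / 2) ^ 2)); [exact Hth|exact Hth0|apply HB].
    - apply (tower_lim_0 th (S n) 0 (B * (eta / 2) ^ S (S (S n)))); [exact Hth|exact IH|apply HB]. }
  assert (HW0lim : is_lim W0 p_infty (k * mu 0%nat)).
  { set (l := fun n => match n with 0%nat => k * mu 0%nat | S _ => 0 end).
    replace (k * mu 0%nat) with (Series l).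
    2: { apply is_series_unique, (is_series_only_0 l). reflexivity. }
    assert (Hpt : forall n, filterlim (fun T => c T n / INR (fact n) * mu n)
                    (Rbar_locally' p_infty) (locally (l n))).
    { intros n. unfold c.
      assert (E : is_lim (fun T => ((-1) ^ n / INR (fact n) * mu n) * th n T) p_infty (l n)).
      { destruct n as [|n].
        - replace (Finite (l 0%nat)) with (Rbar_mult ((-1) ^ 0 / INR (fact 0) * mu 0%nat) k).
          + apply is_lim_scal_l, Hth0.
          + simpl. f_equal. field.
        - replace (Finite (l (S n))) with (Rbar_mult ((-1) ^ S n / INR (fact (S n)) * mu (S n)) 0).
          + apply is_lim_scal_l, HthS.
          + unfold Rbar_mult; simpl. f_equal. ring. }
      refine (is_lim_ext (fun T => ((-1) ^ n / INR (fact n) * mu n) * th n T) _ _ (l n) _ E).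
      intros T. unfold Rdiv; ring. }
    apply (tannery (Rbar_locally' p_infty) (fun T n => c T n / INR (fact n) * mu n) l M).
    - exact Hpt.
    - exists 0. intros T _ n. apply Hterm, Hmub.
    - intros n. apply (filterlim_abs_le (Rbar_locally' p_infty) _ _ _ (Hpt n)).
      exists 0. intros T _. apply Hterm, Hmub.
    - exact HM. }
  assert (Herr : forall eps, 0 < eps -> exists T0, 0 <= T0 /\ forall T, T0 <= T ->
            Rabs (k * RInt phi 0 T - W0 T) <= eps).
  { intros eps Heps.
    destruct (null_convolution_small phi D Hc Hl HD eps Heps) as [T0 [HT0 Hsmall]].
    exists T0. split; [exact HT0|]. intros T HT.
    apply (filterlim_abs_le (at_right 0)
      (fun p => k * RInt (fun x => phi x * kernel 0 p x) 0 T
                - moment (fun x => phi x * v T x) 0 p)).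
    - refine (filterlim_scal_minus (at_right 0) _ _ k _ _ _ (HWlim T)).
      apply moment_0_RInt_at_right; [exact Hc|lra].
    - exists (mkposreal 1 Rlt_0_1). intros p _ Hp.
      assert (Him : improper (fun x => phi x * v T x * kernel 0 p x)
                      (moment (fun x => phi x * v T x) 0 p)).
      { apply (moment_correct _ (K * B)); [|exact Hp]. split.
        - intros x; apply continuous_Rmult; [apply Hc|apply Hvc].
        - intros x Hx. rewrite Rabs_mult.
          apply Rmult_le_compat; [apply Rabs_pos|apply Rabs_pos|apply HK, Hx|].
          unfold v. specialize (HB 0%nat (T - x)). rewrite pow_O, Rmult_1_r in HB. exact HB. }
      set (a := k * RInt (fun x => phi x * kernel 0 p x) 0 T).
      apply (filterlim_abs_le (Rbar_locally' p_infty)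
        (fun X => a - RInt (fun x => phi x * v T x * kernel 0 p x) 0 X)).
      + apply (is_lim_minus' (fun _ => a) (fun X => RInt (fun x => phi x * v T x * kernel 0 p x) 0 X));
          [apply is_lim_const|exact Him].
      + exists T. intros X HX.
        eapply Rle_trans; [apply (smooth_cutoff_error phi (v T) k D p T X)|apply Hsmall; lra]; auto; try lra.
        * intros x Hx. apply Hright; lra.
        * intros x Hx. apply Hleft; lra. }
  assert (Hkl : is_lim (fun T => k * RInt phi 0 T) p_infty (k * mu 0%nat)).
  { apply is_lim_spec. intros eps; simpl. pose proof (cond_pos eps) as He.
    destruct (Herr (eps / 2) ltac:(lra)) as [T0 [HT0 H1]].
    apply is_lim_spec in HW0lim.
    assert (He2 : 0 < eps / 2) by lra.
    destruct (HW0lim (mkposreal _ He2)) as [T1 H2]; simpl in H2.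
    exists (Rmax T0 T1). intros T HT.
    assert (T0 < T) by (eapply Rle_lt_trans; [apply Rmax_l|exact HT]).
    assert (T1 < T) by (eapply Rle_lt_trans; [apply Rmax_r|exact HT]).
    specialize (H1 T ltac:(lra)). specialize (H2 T ltac:(lra)).
    apply Rabs_le_between in H1. apply Rabs_lt_between in H2. apply Rabs_lt_between. lra. }
  unfold improper.
  apply (is_lim_ext (fun T => / k * (k * RInt phi 0 T))).
  { intros T. field; lra. }
  replace (Finite (mu 0%nat)) with (Rbar_mult (/ k) (k * mu 0%nat)).
  - apply is_lim_scal_l, Hkl.
  - simpl. f_equal. field; lra.
Qed.

(** * The Bessel function of order zero *)

Definition bessel_coef (k : nat) : R := (-1) ^ k / (INR (fact k) * INR (fact (0 + k))).

Lemma bessel_coef_CV : CV_radius bessel_coef = p_infty.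
Proof.
  apply CV_radius_infinite. intros x.
  apply (ex_series_dominated _ (fun k => Rabs x ^ k / INR (fact k))).
  - intros k. unfold bessel_coef. simpl Nat.add. pose proof (INR_fact_lt_0 k) as Hf.
    assert (H1 : 1 <= INR (fact k)) by (apply (le_INR 1), Nat.le_succ_l, lt_O_fact).
    unfold Rdiv. rewrite !Rabs_mult, pow_1_abs, Rmult_1_l, RPow_abs.
    rewrite Rinv_mult, Rabs_mult, !Rabs_pos_eq by (apply Rlt_le, Rinv_0_lt_compat, Hf).
    rewrite Rmult_comm. apply Rmult_le_compat_l; [apply Rabs_pos|].
    rewrite <- (Rmult_1_r (/ INR (fact k))) at 3.
    apply Rmult_le_compat_l; [apply Rlt_le, Rinv_0_lt_compat, Hf|].
    rewrite <- Rinv_1. apply Rinv_le_contravar; lra.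
  - eexists; apply is_series_exp.
Qed.

(** The [i]-th derivative of [sum_k (-t)^k / k!^2], whose value at [(x/2)^2] is
    [J0 x] when [i = 0]. *)
Definition bessel_series (i : nat) : R -> R := PSeries (Nat.iter i PS_derive bessel_coef).

Lemma bessel_series_CV i : CV_radius (Nat.iter i PS_derive bessel_coef) = p_infty.
Proof.
  induction i as [|i IH]; [exact bessel_coef_CV|]. simpl. rewrite CV_radius_derive; exact IH.
Qed.

Lemma is_derive_bessel_series i t : is_derive (bessel_series i) t (bessel_series (S i) t).
Proof. apply is_derive_PSeries. rewrite bessel_series_CV; exact I. Qed.

(** [t y'' + y' + y = 0] amounts to [(k+1)^2 b_(k+1) + b_k = 0]. *)
Lemma bessel_series_ode t : t * bessel_series 2 t + bessel_series 1 t + bessel_series 0 t = 0.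
Proof.
  unfold bessel_series. rewrite <- PSeries_incr_1.
  assert (H : forall i, ex_pseries (Nat.iter i PS_derive bessel_coef) t).
  { intros i. apply CV_radius_inside. rewrite bessel_series_CV; exact I. }
  assert (H2 : ex_pseries (PS_incr_1 (Nat.iter 2 PS_derive bessel_coef)) t)
    by apply ex_pseries_incr_1, H.
  rewrite <- PSeries_plus; [|exact H2|apply H].
  rewrite <- PSeries_plus; [|apply (ex_pseries_plus (V := R_NormedModule)); [exact H2|apply H]|apply H].
  rewrite (PSeries_ext _ (fun _ => 0)); [apply PSeries_const_0|].
  intros n. unfold PS_plus. change plus with Rplus.
  unfold PS_incr_1. simpl Nat.iter.
  assert (E : INR (S n) * bessel_coef (S n) * INR (S n) + bessel_coef n = 0).
  { unfold bessel_coef. simpl Nat.add. rewrite fact_simpl, mult_INR. simpl pow. field.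
    split; [apply INR_fact_neq_0|apply not_0_INR; lia]. }
  destruct n as [|n]; unfold PS_derive.
  - change zero with 0. etransitivity; [|exact E]. simpl INR. ring.
  - etransitivity; [|exact E]. rewrite (S_INR (S n)). ring.
Qed.

Lemma BesselJ_0_eq x : BesselJ 0 x = bessel_series 0 ((x / 2) ^ 2).
Proof. unfold BesselJ. simpl pow at 1. rewrite Rmult_1_l. reflexivity. Qed.

Definition dJ0 (x : R) : R := x / 2 * bessel_series 1 ((x / 2) ^ 2).
Definition d2J0 (x : R) : R := bessel_series 1 ((x / 2) ^ 2) / 2 + (x / 2) ^ 2 * bessel_series 2 ((x / 2) ^ 2).

Lemma is_derive_bessel_series_sq i x :
  is_derive (fun x => bessel_series i ((x / 2) ^ 2)) x (x / 2 * bessel_series (S i) ((x / 2) ^ 2)).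
Proof.
  apply (is_derive_comp (bessel_series i) (fun x => (x / 2) ^ 2) x (bessel_series (S i) ((x / 2) ^ 2)) (x / 2)).
  - apply is_derive_bessel_series.
  - auto_derive; trivial. field.
Qed.

Lemma is_derive_J0 x : is_derive (BesselJ 0) x (dJ0 x).
Proof.
  apply (is_derive_ext (fun x => bessel_series 0 ((x / 2) ^ 2))).
  - intros t; symmetry; apply BesselJ_0_eq.
  - apply is_derive_bessel_series_sq.
Qed.

Lemma is_derive_dJ0 x : is_derive dJ0 x (d2J0 x).
Proof.
  unfold dJ0, d2J0.
  replace (bessel_series 1 ((x / 2) ^ 2) / 2 + (x / 2) ^ 2 * bessel_series 2 ((x / 2) ^ 2))
    with (/ 2 * bessel_series 1 ((x / 2) ^ 2) + x / 2 * (x / 2 * bessel_series 2 ((x / 2) ^ 2))) by field.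
  apply (is_derive_mult (fun x => x / 2) (fun x => bessel_series 1 ((x / 2) ^ 2))).
  - auto_derive; trivial. field.
  - apply is_derive_bessel_series_sq.
  - intros; apply Rmult_comm.
Qed.


Lemma bessel_ode x : x * d2J0 x + dJ0 x + x * BesselJ 0 x = 0.
Proof.
  rewrite BesselJ_0_eq. unfold d2J0, dJ0. pose proof (bessel_series_ode ((x / 2) ^ 2)) as H.
  set (t := (x / 2) ^ 2) in *.
  transitivity (x * (t * bessel_series 2 t + bessel_series 1 t + bessel_series 0 t)); [field|rewrite H; ring].
Qed.

Lemma BesselJ_0_0 : BesselJ 0 0 = 1.
Proof.
  rewrite BesselJ_0_eq. replace ((0 / 2) ^ 2) with 0 by field.
  unfold bessel_series. rewrite PSeries_0. unfold bessel_coef. simpl. field.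
Qed.

Lemma continuity_of_derive (f : R -> R) (df : R -> R) x :
  is_derive f x (df x) -> continuity_pt f x.
Proof.
  intros H. apply continuity_pt_filterlim, (ex_derive_continuous (V := R_NormedModule)).
  eexists; exact H.
Qed.

(** The derivative of the energy [J0^2 + J0'^2] is [- 2 J0'^2 / x]. *)
Lemma bessel_energy x : 0 <= x -> BesselJ 0 x ^ 2 + dJ0 x ^ 2 <= 1.
Proof.
  intros Hx.
  assert (HE : forall y, is_derive (fun x => BesselJ 0 x ^ 2 + dJ0 x ^ 2) y
                 (2 * dJ0 y * (BesselJ 0 y + d2J0 y))).
  { intros y. pose proof (is_derive_J0 y) as H1. pose proof (is_derive_dJ0 y) as H2.
    apply is_derive_unique in H1 as E1. apply is_derive_unique in H2 as E2.
    auto_derive.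
    - split; [eexists; exact H1|split; [eexists; exact H2|exact I]].
    - change (Derive (fun x => BesselJ 0 x) y) with (Derive (BesselJ 0) y).
      change (Derive (fun x => dJ0 x) y) with (Derive dJ0 y). rewrite E1, E2. ring. }
  destruct (MVT_gen (fun x => BesselJ 0 x ^ 2 + dJ0 x ^ 2) 0 x
              (fun y => 2 * dJ0 y * (BesselJ 0 y + d2J0 y))) as [z [Hz Ez]].
  - intros; apply HE.
  - intros y _.
    apply (continuity_of_derive _ (fun y => 2 * dJ0 y * (BesselJ 0 y + d2J0 y)) y (HE y)).
  - rewrite Rmin_left, Rmax_right in Hz by lra.
    assert (Hneg : 2 * dJ0 z * (BesselJ 0 z + d2J0 z) <= 0).
    { destruct (proj1 Hz) as [Hz0|<-].
      - pose proof (bessel_ode z) as Ho.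
        replace (BesselJ 0 z + d2J0 z) with (- dJ0 z / z).
        + replace (2 * dJ0 z * (- dJ0 z / z)) with (- (2 * dJ0 z ^ 2 / z)) by (field; lra).
          assert (0 <= 2 * dJ0 z ^ 2 / z); [|lra].
          apply Rmult_le_pos; [nra|apply Rlt_le, Rinv_0_lt_compat, Hz0].
        + apply (Rmult_eq_reg_l z); [|lra]. field_simplify; lra.
      - unfold dJ0. replace (0 / 2) with 0 by field. lra. }
    rewrite BesselJ_0_0 in Ez. replace (dJ0 0) with 0 in Ez by (unfold dJ0; field).
    nra.
Qed.

(** The energy of [sqrt x * J0 x], which solves [w'' + (1 + 1/(4x^2)) w = 0],
    decreases too. *)
Lemma bessel_decay : exists M, 0 <= M /\ forall x, 1 <= x -> x * BesselJ 0 x ^ 2 <= M.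
Proof.
  set (G := fun x => x * (BesselJ 0 x ^ 2 + dJ0 x ^ 2) + BesselJ 0 x * dJ0 x
                + BesselJ 0 x ^ 2 / (2 * x)).
  assert (HG : forall y, 0 < y -> is_derive G y (- BesselJ 0 y ^ 2 / (2 * y ^ 2))).
  { intros y Hy. pose proof (is_derive_J0 y) as H1. pose proof (is_derive_dJ0 y) as H2.
    apply is_derive_unique in H1 as E1. apply is_derive_unique in H2 as E2.
    unfold G. auto_derive.
    - repeat split; try (eexists; eassumption). apply Rgt_not_eq; lra.
    - change (Derive (fun x => BesselJ 0 x) y) with (Derive (BesselJ 0) y).
      change (Derive (fun x => dJ0 x) y) with (Derive dJ0 y). rewrite E1, E2.
      pose proof (bessel_ode y) as Ho.
      assert (Ho2 : d2J0 y = - BesselJ 0 y - dJ0 y / y).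
      { apply (Rmult_eq_reg_l y); [|lra]. field_simplify; lra. }
      rewrite Ho2. field. lra. }
  assert (HG0 : forall x, 0 < x -> x * BesselJ 0 x ^ 2 <= G x).
  { intros x Hx. unfold G.
    assert (E : x * (BesselJ 0 x ^ 2 + dJ0 x ^ 2) + BesselJ 0 x * dJ0 x + BesselJ 0 x ^ 2 / (2 * x)
      = x * BesselJ 0 x ^ 2 + x * (dJ0 x + BesselJ 0 x / (2 * x)) ^ 2 + BesselJ 0 x ^ 2 / (4 * x))
      by (field; lra).
    rewrite E.
    assert (0 <= x * (dJ0 x + BesselJ 0 x / (2 * x)) ^ 2) by (apply Rmult_le_pos; [lra|apply pow2_ge_0]).
    assert (0 <= BesselJ 0 x ^ 2 / (4 * x)).
    { apply Rmult_le_pos; [apply pow2_ge_0|apply Rlt_le, Rinv_0_lt_compat; lra]. }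
    lra. }
  exists (G 1). split.
  - pose proof (HG0 1 ltac:(lra)). pose proof (pow2_ge_0 (BesselJ 0 1)). lra.
  - intros x Hx. eapply Rle_trans; [apply HG0; lra|].
    destruct (MVT_gen G 1 x (fun y => - BesselJ 0 y ^ 2 / (2 * y ^ 2))) as [z [Hz Ez]].
    + rewrite Rmin_left, Rmax_right by lra. intros y Hy; apply HG; lra.
    + rewrite Rmin_left, Rmax_right by lra. intros y Hy.
      apply (continuity_of_derive _ (fun y => - BesselJ 0 y ^ 2 / (2 * y ^ 2))), HG; lra.
    + rewrite Rmin_left, Rmax_right in Hz by lra.
      assert (0 <= BesselJ 0 z ^ 2 / (2 * z ^ 2)).
      { apply Rmult_le_pos; [apply pow2_ge_0|apply Rlt_le, Rinv_0_lt_compat; nra]. }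
      replace (- BesselJ 0 z ^ 2 / (2 * z ^ 2)) with (- (BesselJ 0 z ^ 2 / (2 * z ^ 2))) in Ez
        by (field; lra).
      nra.
Qed.

Lemma bessel_bounds x : 0 <= x -> Rabs (BesselJ 0 x) <= 1 /\ Rabs (dJ0 x) <= 1.
Proof.
  intros Hx. pose proof (bessel_energy x Hx) as H.
  pose proof (pow2_ge_0 (BesselJ 0 x)). pose proof (pow2_ge_0 (dJ0 x)).
  split; apply Rabs_le; nra.
Qed.

(** * Exponential moments of the Bessel function *)

Definition J0q (q x : R) : R := BesselJ 0 (q * x).
Definition dJ0q (q x : R) : R := q * dJ0 (q * x).
Definition d2J0q (q x : R) : R := q * (q * d2J0 (q * x)).

Lemma is_derive_J0q q x : is_derive (J0q q) x (dJ0q q x).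
Proof.
  apply (is_derive_comp (BesselJ 0) (fun x => q * x) x (dJ0 (q * x)) q).
  - apply is_derive_J0.
  - auto_derive; trivial; ring.
Qed.

Lemma is_derive_dJ0q q x : is_derive (dJ0q q) x (d2J0q q x).
Proof.
  unfold dJ0q, d2J0q. apply is_derive_scal.
  apply (is_derive_comp dJ0 (fun x => q * x) x (d2J0 (q * x)) q).
  - apply is_derive_dJ0.
  - auto_derive; trivial; ring.
Qed.

Lemma J0q_ode q x : x * d2J0q q x + dJ0q q x = - (q ^ 2 * x) * J0q q x.
Proof.
  unfold J0q, dJ0q, d2J0q. pose proof (bessel_ode (q * x)) as H.
  transitivity (q * (q * x * d2J0 (q * x) + dJ0 (q * x) + q * x * BesselJ 0 (q * x))
                 - q ^ 2 * x * BesselJ 0 (q * x)); [ring|rewrite H; ring].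
Qed.

Lemma bounded_cont_J0q q : 0 < q -> bounded_cont (J0q q) 1.
Proof.
  intros Hq; split.
  - intros x. apply (ex_derive_continuous (V := R_NormedModule)). eexists; apply is_derive_J0q.
  - intros x Hx. apply bessel_bounds, Rmult_le_pos; lra.
Qed.

Lemma bounded_cont_dJ0q q : 0 < q -> bounded_cont (dJ0q q) q.
Proof.
  intros Hq; split.
  - intros x. apply (ex_derive_continuous (V := R_NormedModule)). eexists; apply is_derive_dJ0q.
  - intros x Hx. unfold dJ0q. rewrite Rabs_mult, (Rabs_pos_eq q) by lra.
    apply Rle_trans with (q * 1); [|lra]. apply Rmult_le_compat_l; [lra|].
    apply bessel_bounds, Rmult_le_pos; lra.
Qed.

Lemma improper_primitive (F f : R -> R) :
  (forall x, is_derive F x (f x)) -> (forall x, continuous f x) ->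
  is_lim F p_infty 0 -> improper f (- F 0).
Proof.
  intros HF Hf Hl. unfold improper.
  apply (is_lim_ext (fun X => F X - F 0)).
  - intros X. symmetry. apply is_RInt_unique.
    apply (is_RInt_derive (V := R_CompleteNormedModule) F f); auto.
  - replace (Finite (- F 0)) with (Finite (0 - F 0)) by (f_equal; ring).
    apply is_lim_minus'; [exact Hl|apply is_lim_const].
Qed.

Lemma is_lim_bounded_kernel psi K n p : bounded_cont psi K -> 0 < p ->
  is_lim (fun x => psi x * kernel n p x) p_infty 0.
Proof.
  intros [_ Hb] Hp.
  assert (H : is_lim (fun x => K * kernel n p x) p_infty 0).
  { replace (Finite 0) with (Rbar_mult K 0) by (simpl; f_equal; ring).
    apply is_lim_scal_l, kernel_lim_0, Hp. }
  assert (H' : is_lim (fun x => - (K * kernel n p x)) p_infty 0).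
  { replace (Finite 0) with (Rbar_opp 0) by (simpl; f_equal; ring). apply is_lim_opp, H. }
  apply (is_lim_le_le_loc (fun x => - (K * kernel n p x)) (fun x => K * kernel n p x));
    [|exact H'|exact H].
  exists 0. intros x Hx.
  assert (A : Rabs (psi x * kernel n p x) <= K * kernel n p x).
  { rewrite Rabs_mult, (Rabs_pos_eq (kernel n p x)) by (apply kernel_ge_0; lra).
    apply Rmult_le_compat_r; [apply kernel_ge_0; lra|apply Hb; lra]. }
  apply Rabs_le_between in A. exact A.
Qed.

(** Bessel's equation integrated against [x^n exp(-p x)]. By that equation [dPhi]
    is the derivative of [Phi], which vanishes at both ends of the half-line. For
    [n = 0] the last coefficient vanishes, whatever [pred 0] is. *)
Lemma bessel_moment_rec q p n : 0 < q -> 0 < p ->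
  (p ^ 2 + q ^ 2) * moment (J0q q) (S n) p
  = (2 * INR n + 1) * p * moment (J0q q) n p - INR n ^ 2 * moment (J0q q) (pred n) p.
Proof.
  intros Hq Hp.
  pose proof (bounded_cont_J0q q Hq) as HJ. pose proof (bounded_cont_dJ0q q Hq) as HdJ.
  set (m := INR n).
  assert (Hcm : forall c k x, continuous (fun x => c * (J0q q x * kernel k p x)) x).
  { intros c k x. apply continuous_Rmult; [apply continuous_const|].
    apply continuous_Rmult; [apply HJ|apply continuous_kernel]. }
  assert (Him : forall c k, improper (fun x => c * (J0q q x * kernel k p x)) (c * moment (J0q q) k p)).
  { intros c k. apply improper_scal.
    - intros x; apply continuous_Rmult; [apply HJ|apply continuous_kernel].
    - apply (moment_correct _ 1); assumption. }
  set (dPhi := fun x => - (p ^ 2 + q ^ 2) * (J0q q x * kernel (S n) p x) +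
     ((2 * m + 1) * p * (J0q q x * kernel n p x) + - m ^ 2 * (J0q q x * kernel (pred n) p x))).
  assert (H1 : improper dPhi (- (p ^ 2 + q ^ 2) * moment (J0q q) (S n) p +
       ((2 * m + 1) * p * moment (J0q q) n p + - m ^ 2 * moment (J0q q) (pred n) p))).
  { apply improper_plus; auto.
    - intros x; apply (continuous_plus (V := R_NormedModule)); apply Hcm.
    - apply improper_plus; auto. }
  set (Phi := fun x => dJ0q q x * kernel (S n) p x +
     (p * (J0q q x * kernel (S n) p x) + - m * (J0q q x * kernel n p x))).
  assert (H2 : improper dPhi (- Phi 0)).
  { apply improper_primitive.
    - intros x. unfold Phi, dPhi, kernel.
      pose proof (is_derive_J0q q x) as D1. pose proof (is_derive_dJ0q q x) as D2.
      apply is_derive_unique in D1 as E1. apply is_derive_unique in D2 as E2.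
      pose proof (J0q_ode q x) as Ho.
      auto_derive.
      + repeat split; eexists; eassumption.
      + change (Derive (fun x => J0q q x) x) with (Derive (J0q q) x).
        change (Derive (fun x => dJ0q q x) x) with (Derive (dJ0q q) x). rewrite E1, E2.
        change (match n with 0%nat => 1 | S _ => INR n + 1 end) with (INR (S n)).
        rewrite S_INR. fold m.
        set (e := exp (- (p * x))). set (y := x ^ n). set (z := x ^ pred n).
        transitivity (y * e * (x * d2J0q q x + dJ0q q x) +
          ((2 * m + 1) * p * y - m ^ 2 * z - p ^ 2 * (x * y)) * e * J0q q x).
        * cbn [pow]. fold y. ring.
        * rewrite Ho. cbn [pow]. fold y. ring.
    - intros x; apply (continuous_plus (V := R_NormedModule)); [apply Hcm|].
      apply (continuous_plus (V := R_NormedModule)); apply Hcm.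
    - unfold Phi.
      replace (Finite 0) with (Finite (0 + (p * 0 + - m * 0))) by (f_equal; ring).
      apply is_lim_plus'; [apply (is_lim_bounded_kernel _ q); assumption|].
      apply is_lim_plus'.
      + apply (is_lim_scal_l _ p p_infty 0), (is_lim_bounded_kernel _ 1); assumption.
      + apply (is_lim_scal_l _ (- m) p_infty 0), (is_lim_bounded_kernel _ 1); assumption. }
  pose proof (improper_unique _ _ _ H1 H2) as E.
  assert (E0 : Phi 0 = 0) by (unfold Phi, kernel, m; destruct n; simpl; ring).
  rewrite E0 in E. lra.
Qed.

Lemma bessel_moment_1 q p : 0 < q -> 0 < p ->
  (p ^ 2 + q ^ 2) * moment (J0q q) 1 p = p * moment (J0q q) 0 p.
Proof.
  intros Hq Hp. rewrite bessel_moment_rec by assumption. simpl. ring.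
Qed.

(** Integration by parts, with [|J0'| <= 1]. *)
Lemma bessel_moment_0_large q p : 0 < q -> 0 < p ->
  Rabs (p * moment (J0q q) 0 p - 1) <= q / p.
Proof.
  intros Hq Hp.
  pose proof (bounded_cont_J0q q Hq) as HJ. pose proof (bounded_cont_dJ0q q Hq) as HdJ.
  assert (HcJ : forall x, continuous (fun x => J0q q x * kernel 0 p x) x).
  { intros x. apply continuous_Rmult; [apply HJ|apply continuous_kernel]. }
  assert (HcD : forall x, continuous (fun x => dJ0q q x * kernel 0 p x) x).
  { intros x. apply continuous_Rmult; [apply HdJ|apply continuous_kernel]. }
  assert (H1 : improper (fun x => dJ0q q x * kernel 0 p x + (- p) * (J0q q x * kernel 0 p x))
     (moment (dJ0q q) 0 p + (- p) * moment (J0q q) 0 p)).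
  { apply improper_plus; auto.
    - intros x; apply continuous_Rmult; [apply continuous_const|apply HcJ].
    - apply (moment_correct _ q); assumption.
    - apply improper_scal; [exact HcJ|apply (moment_correct _ 1); assumption]. }
  assert (H2 : improper (fun x => dJ0q q x * kernel 0 p x + (- p) * (J0q q x * kernel 0 p x))
     (- (J0q q 0 * kernel 0 p 0))).
  { apply (improper_primitive (fun x => J0q q x * kernel 0 p x)).
    - intros x. unfold kernel.
      pose proof (is_derive_J0q q x) as D1. apply is_derive_unique in D1 as E1.
      auto_derive.
      + repeat split; eexists; eassumption.
      + change (Derive (fun x => J0q q x) x) with (Derive (J0q q) x). rewrite E1. ring.
    - intros x. apply (continuous_plus (V := R_NormedModule)); [apply HcD|].
      apply (continuous_Rmult (fun _ => - p)); [apply continuous_const|apply HcJ].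
    - apply (is_lim_bounded_kernel _ 1); assumption. }
  pose proof (improper_unique _ _ _ H1 H2) as E.
  assert (E0 : J0q q 0 * kernel 0 p 0 = 1).
  { unfold J0q, kernel. rewrite !Rmult_0_r, BesselJ_0_0, Ropp_0, exp_0. simpl; ring. }
  rewrite E0 in E.
  replace (p * moment (J0q q) 0 p - 1) with (moment (dJ0q q) 0 p) by lra.
  pose proof (moment_bound (dJ0q q) q 0 p HdJ Hp) as H. simpl in H.
  replace (q / p) with (q * (1 / (p * 1))) by (field; lra). exact H.
Qed.

(** Read off the linear term of [is_series_moment_shift]. *)
Lemma is_derive_moment_0 psi K p : bounded_cont psi K -> 0 < p ->
  is_derive (moment psi 0) p (- moment psi 1 p).
Proof.
  intros Hpsi Hp.
  set (a := fun k => moment psi k p / INR (fact k)).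
  assert (Hs : forall h, Rabs h < p -> is_series (fun k => a k * h ^ k) (moment psi 0 (p - h))).
  { intros h Hh. eapply is_series_ext; [|apply (is_series_moment_shift psi K h 0 p Hpsi Hh)].
    intros k. unfold a. simpl Nat.add. at_type_R.
    unfold Rdiv; ring. }
  assert (HCV : Rbar_lt (Rabs 0) (CV_radius a)).
  { rewrite Rabs_R0. apply Rbar_lt_le_trans with (p / 2); [simpl; lra|].
    apply Rbar_not_lt_le. intros Hlt.
    assert (Hp2 : Rabs (p / 2) = p / 2) by (apply Rabs_pos_eq; lra).
    apply (CV_disk_outside a (p / 2)); [rewrite Hp2; exact Hlt|].
    apply ex_series_lim_0. eexists. apply Hs. rewrite Hp2; lra. }
  assert (HD : is_derive (PSeries a) (p - p) (a 1%nat)).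
  { pose proof (is_derive_PSeries a 0 HCV) as H. rewrite PSeries_0 in H.
    unfold PS_derive in H. simpl INR in H. rewrite Rmult_1_l in H.
    replace (p - p) with 0 by ring. exact H. }
  apply (is_derive_ext_loc (fun z => PSeries a (p - z))).
  - exists (mkposreal p Hp). intros z Hz. change (Rabs (z - p) < p) in Hz.
    rewrite Rabs_minus_sym in Hz. unfold PSeries. rewrite (is_series_unique _ _ (Hs (p - z) Hz)).
    f_equal; ring.
  - replace (- moment psi 1 p) with (-1 * a 1%nat) by (unfold a; simpl; field).
    apply (is_derive_comp (PSeries a) (fun z => p - z) p (a 1%nat) (-1) HD).
    auto_derive; trivial; ring.
Qed.

(** By [bessel_moment_1] the transform [L] satisfies [(p^2 + q^2) L' = - p L], so
    [sqrt (p^2 + q^2) * L] is constant; it tends to [1] at infinity. *)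
Lemma bessel_moment_0 q p : 0 < q -> 0 < p -> moment (J0q q) 0 p = / sqrt (p ^ 2 + q ^ 2).
Proof.
  intros Hq Hp.
  assert (Hr : forall p, 0 < p -> 0 < p ^ 2 + q ^ 2) by (intros; nra).
  assert (Hs : forall p, 0 < p -> 0 < sqrt (p ^ 2 + q ^ 2)) by (intros; apply sqrt_lt_R0, Hr; assumption).
  set (W := fun p => sqrt (p ^ 2 + q ^ 2) * moment (J0q q) 0 p).
  assert (HW : forall p, 0 < p -> is_derive W p 0).
  { intros y Hy. unfold W.
    replace 0 with (y / sqrt (y ^ 2 + q ^ 2) * moment (J0q q) 0 y
                     + sqrt (y ^ 2 + q ^ 2) * - moment (J0q q) 1 y).
    - apply (is_derive_mult (fun p => sqrt (p ^ 2 + q ^ 2)) (moment (J0q q) 0)).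
      + auto_derive; [apply Hr in Hy; simpl in *; lra|]. 
        replace (y * (y * 1) + q * (q * 1)) with (y ^ 2 + q ^ 2) by ring.
        field. apply Rgt_not_eq, Hs, Hy.
      + apply (is_derive_moment_0 _ 1); [apply bounded_cont_J0q, Hq|exact Hy].
      + intros; apply Rmult_comm.
    - pose proof (bessel_moment_1 q y Hq Hy) as H1. pose proof (Hs y Hy) as H2.
      apply (Rmult_eq_reg_l (sqrt (y ^ 2 + q ^ 2))); [|lra].
      replace (sqrt (y ^ 2 + q ^ 2) * (y / sqrt (y ^ 2 + q ^ 2) * moment (J0q q) 0 y +
                 sqrt (y ^ 2 + q ^ 2) * - moment (J0q q) 1 y))
        with (y * moment (J0q q) 0 y
              - sqrt (y ^ 2 + q ^ 2) * sqrt (y ^ 2 + q ^ 2) * moment (J0q q) 1 y) by (field; lra).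
      rewrite sqrt_sqrt by (apply Rlt_le, Hr, Hy). lra. }
  assert (Hconst : forall y, p <= y -> W y = W p).
  { intros y Hy. destruct (MVT_gen W p y (fun _ => 0)) as [z [_ Ez]].
    - rewrite Rmin_left, Rmax_right by lra. intros; apply HW; lra.
    - rewrite Rmin_left, Rmax_right by lra. intros x Hx.
      apply (continuity_of_derive W (fun _ => 0)), HW; lra.
    - lra. }
  assert (Hclose : forall y, 0 < y -> Rabs (W y - 1) <= 2 * q / y).
  { intros y Hy.
    pose proof (bessel_moment_0_large q y Hq Hy) as H1.
    pose proof (moment_bound (J0q q) 1 0 y (bounded_cont_J0q q Hq) Hy) as H2.
    simpl in H2. 
    assert (H3 : y <= sqrt (y ^ 2 + q ^ 2) <= y + q).
    { split; [rewrite <- (sqrt_pow2 y) at 1 by lra; apply sqrt_le_1_alt; nra|].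
      rewrite <- (sqrt_pow2 (y + q)) by lra. apply sqrt_le_1_alt; nra. }
    replace (W y - 1) with ((sqrt (y ^ 2 + q ^ 2) - y) * moment (J0q q) 0 y
       + (y * moment (J0q q) 0 y - 1)) by (unfold W; ring).
    eapply Rle_trans; [apply Rabs_triang|].
    replace (2 * q / y) with (q * / y + q / y) by (field; lra).
    apply Rplus_le_compat; [|exact H1].
    rewrite Rabs_mult. apply Rmult_le_compat; [apply Rabs_pos|apply Rabs_pos| |].
    - rewrite Rabs_pos_eq; lra.
    - eapply Rle_trans; [exact H2|]. apply Req_le; field; lra. }
  assert (HW1 : W p = 1).
  { apply Rminus_diag_uniq, Rabs_eq_0, Rle_antisym; [|apply Rabs_pos].
    apply Rnot_lt_le; intros Hlt.
    set (d := Rabs (W p - 1)) in *.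
    set (y := p + 4 * q / d).
    assert (Hd : 0 < 4 * q / d) by (apply Rdiv_lt_0_compat; lra).
    pose proof (Hclose y ltac:(unfold y; lra)) as H. rewrite (Hconst y ltac:(unfold y; lra)) in H.
    fold d in H.
    assert (H2 : 2 * q / y <= d / 2).
    { apply div_le_of_le_mult; [unfold y; lra|].
      assert (4 * q / d <= y) by (unfold y; lra).
      replace (2 * q) with (d / 2 * (4 * q / d)) by (field; lra).
      apply Rmult_le_compat_l; lra. }
    lra. }
  unfold W in HW1. specialize (Hs p Hp).
  apply (Rmult_eq_reg_l (sqrt (p ^ 2 + q ^ 2))); [|lra]. rewrite HW1. field; lra.
Qed.

(** With [c_n] the [n]-th moment over [n!] and [r^2 = p^2 + q^2], the recurrence
    reads [r^2 c_{n+1} - p c_n = n/(n+1) (p c_n - c_{n-1})], and the quadratic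
    form [V] loses at least a factor [r^2] at each step. This is the inequality
    [|P_n| <= 1] for Legendre polynomials. *)
Lemma bessel_moment_bound q p n : 0 < q -> 0 < p ->
  Rabs (moment (J0q q) n p) <= INR (fact n) / q ^ S n.
Proof.
  intros Hq Hp.
  set (r2 := p ^ 2 + q ^ 2).
  assert (Hr2 : q ^ 2 <= r2 /\ 0 < r2) by (unfold r2; split; nra).
  set (cn := fun n => moment (J0q q) n p / INR (fact n)).
  set (V := fun n => (r2 * cn (S n) - p * cn n) ^ 2 + q ^ 2 * cn n ^ 2).
  assert (Hf : forall k, INR (fact k) <> 0) by apply INR_fact_neq_0.
  assert (Hrec : forall k, r2 * cn (S (S k)) - p * cn (S k)
             = INR (S k) / INR (S (S k)) * (p * cn (S k) - cn k)).
  { intros k. pose proof (bessel_moment_rec q p (S k) Hq Hp) as H. fold r2 in H. cbn [pred] in H.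
    unfold cn. rewrite (fact_simpl (S k)), (fact_simpl k), !mult_INR.
    assert (H1 : INR (S k) <> 0) by (apply not_0_INR; lia).
    assert (H2 : INR (S (S k)) <> 0) by (apply not_0_INR; lia).
    apply (Rmult_eq_reg_l (INR (S (S k)) * INR (S k) * INR (fact k))).
    2: { apply Rmult_integral_contrapositive_currified; [|apply Hf].
         apply Rmult_integral_contrapositive_currified; assumption. }
    transitivity (r2 * moment (J0q q) (S (S k)) p - p * INR (S (S k)) * moment (J0q q) (S k) p).
    - field. repeat split; auto.
    - rewrite H. rewrite (S_INR (S k)). field. rewrite <- (S_INR (S k)). repeat split; auto. }
  assert (HV0 : V 0%nat = q ^ 2 / r2).
  { assert (E : r2 * cn 1%nat - p * cn 0%nat = 0).
    { unfold cn. simpl fact. simpl INR. unfold r2.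
      replace ((p ^ 2 + q ^ 2) * (moment (J0q q) 1 p / 1))
        with ((p ^ 2 + q ^ 2) * moment (J0q q) 1 p) by field.
      rewrite bessel_moment_1 by assumption. field. }
    unfold V. rewrite E. unfold cn. simpl fact. simpl INR.
    rewrite bessel_moment_0 by assumption. fold r2.
    replace ((/ sqrt r2 / 1) ^ 2) with (/ (sqrt r2 * sqrt r2)).
    - rewrite sqrt_sqrt by lra. field; lra.
    - field. apply Rgt_not_eq, sqrt_lt_R0, Hr2. }
  assert (HVS : forall k, V (S k) <= V k / r2).
  { intros k.
    replace (V k / r2) with ((p * cn (S k) - cn k) ^ 2 + q ^ 2 * cn (S k) ^ 2).
    - unfold V. rewrite Hrec. apply Rplus_le_compat_r.
      rewrite Rpow_mult_distr. rewrite <- (Rmult_1_l ((p * cn (S k) - cn k) ^ 2)) at 2.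
      apply Rmult_le_compat_r; [apply pow2_ge_0|].
      rewrite <- (pow1 2). apply pow_incr. split.
      + apply Rmult_le_pos; [apply pos_INR|].
        apply Rlt_le, Rinv_0_lt_compat. apply lt_0_INR; lia.
      + apply div_le_of_le_mult; [apply lt_0_INR; lia|]. rewrite Rmult_1_l. apply le_INR; lia.
    - unfold V. apply (Rmult_eq_reg_l r2); [|lra].
      replace (r2 * (((r2 * cn (S k) - p * cn k) ^ 2 + q ^ 2 * cn k ^ 2) / r2))
        with ((r2 * cn (S k) - p * cn k) ^ 2 + q ^ 2 * cn k ^ 2) by (field; lra).
      unfold r2. ring. }
  assert (HV : forall k, V k <= q ^ 2 / (q ^ 2) ^ S k).
  { induction k as [|k IH].
    - rewrite HV0, pow_1. unfold Rdiv. apply Rmult_le_compat_l; [apply pow2_ge_0|].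
      apply Rinv_le_contravar; [nra|apply Hr2].
    - eapply Rle_trans; [apply HVS|]. apply div_le_of_le_mult; [apply Hr2|].
      eapply Rle_trans; [exact IH|].
      assert (Hqk : 0 < (q ^ 2) ^ S k) by (apply pow_lt; nra).
      replace (q ^ 2 / (q ^ 2) ^ S (S k) * r2) with (q ^ 2 / (q ^ 2) ^ S k * (r2 / q ^ 2)).
      2: { rewrite <- (tech_pow_Rmult (q ^ 2) (S k)). field. split; [lra|nra]. }
      rewrite <- (Rmult_1_r (q ^ 2 / (q ^ 2) ^ S k)) at 1.
      apply Rmult_le_compat_l; [apply Rlt_le, Rdiv_lt_0_compat; [nra|exact Hqk]|].
      apply le_div_of_mult_le; [nra|lra]. }
  assert (Hc : Rabs (cn n) <= / q ^ S n).
  { assert (Hqn : 0 < q ^ S n) by (apply pow_lt, Hq).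
    apply Rsqr_incr_0; [|apply Rabs_pos|apply Rlt_le, Rinv_0_lt_compat, Hqn].
    rewrite <- Rsqr_abs. unfold Rsqr.
    specialize (HV n). unfold V in HV.
    assert (H1 : q ^ 2 * cn n ^ 2 <= q ^ 2 / (q ^ 2) ^ S n).
    { eapply Rle_trans; [|exact HV]. pose proof (pow2_ge_0 (r2 * cn (S n) - p * cn n)). lra. }
    apply (Rmult_le_reg_l (q ^ 2)); [nra|].
    replace (q ^ 2 * (cn n * cn n)) with (q ^ 2 * cn n ^ 2) by ring.
    eapply Rle_trans; [exact H1|]. apply Req_le.
    replace ((q ^ 2) ^ S n) with (q ^ S n * q ^ S n).
    - field. lra.
    - rewrite <- pow_mult, Nat.mul_comm, pow_mult. ring. }
  replace (moment (J0q q) n p) with (cn n * INR (fact n)) by (unfold cn; field; apply Hf).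
  rewrite Rabs_mult, (Rabs_pos_eq (INR (fact n))) by apply pos_INR.
  replace (INR (fact n) / q ^ S n) with (/ q ^ S n * INR (fact n)) by (unfold Rdiv; ring).
  apply Rmult_le_compat_r; [apply pos_INR|exact Hc].
Qed.

(** The Abel sum of the integral of [x^n J0(q x)], divergent for [n > 0], given
    by the recurrence [bessel_moment_rec] at [p = 0]. *)
Fixpoint abel_moment (q : R) (n : nat) : R :=
  match n with
  | 0%nat => / q
  | S m => match m with
           | 0%nat => 0
           | S k => - (INR m ^ 2 / q ^ 2) * abel_moment q k
           end
  end.

Lemma continuous_at_right (f : R -> R) x : continuous f x ->
  filterlim f (at_right x) (locally (f x)).
Proof.
  intros H P HP. destruct (H P HP) as [d Hd]. exists d. intros y Hy _. apply Hd, Hy.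
Qed.

Lemma filterlim_Rmult {T : Type} (F : (T -> Prop) -> Prop) {FF : Filter F} (f g : T -> R) (lf lg : R) :
  filterlim f F (locally lf) -> filterlim g F (locally lg) ->
  filterlim (fun t => f t * g t) F (locally (lf * lg)).
Proof.
  intros Hf Hg. apply (filterlim_comp_2 f g Rmult Hf Hg).
  apply (filterlim_mult (K := R_AbsRing)).
Qed.

Lemma moment_at_right_ext (f g : R -> R) (l : R) :
  (forall p, 0 < p -> f p = g p) ->
  filterlim f (at_right 0) (locally l) -> filterlim g (at_right 0) (locally l).
Proof.
  intros H. apply filterlim_ext_loc.
  exists (mkposreal 1 Rlt_0_1). intros p _ Hp. apply H, Hp.
Qed.

Lemma bessel_moment_lim q n : 0 < q ->
  filterlim (moment (J0q q) n) (at_right 0) (locally (abel_moment q n)).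
Proof.
  intros Hq.
  assert (Hsq : forall p, p ^ 2 + q ^ 2 <> 0) by (intros p; nra).
  assert (H0 : filterlim (moment (J0q q) 0) (at_right 0) (locally (abel_moment q 0))).
  { apply (moment_at_right_ext (fun p => / sqrt (p ^ 2 + q ^ 2))).
    - intros p Hp. symmetry. apply bessel_moment_0; assumption.
    - replace (abel_moment q 0) with (/ sqrt (0 ^ 2 + q ^ 2)).
      + apply (continuous_at_right (fun p => / sqrt (p ^ 2 + q ^ 2)) 0).
        apply (ex_derive_continuous (V := R_NormedModule)). auto_derive.
        repeat split; [nra|]. apply Rgt_not_eq, sqrt_lt_R0; nra.
      + replace (0 ^ 2 + q ^ 2) with (q ^ 2) by ring. rewrite sqrt_pow2 by lra. reflexivity. }
  assert (H1 : filterlim (moment (J0q q) 1) (at_right 0) (locally (abel_moment q 1))).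
  { apply (moment_at_right_ext (fun p => (p / (p ^ 2 + q ^ 2)) * moment (J0q q) 0 p)).
    - intros p Hp. specialize (Hsq p).
      apply (Rmult_eq_reg_l (p ^ 2 + q ^ 2)); [|exact Hsq].
      rewrite bessel_moment_1 by assumption. field. exact Hsq.
    - replace (abel_moment q 1) with (0 / (0 ^ 2 + q ^ 2) * abel_moment q 0).
      + apply filterlim_Rmult; [apply at_right_proper_filter| |exact H0].
        apply (continuous_at_right (fun p => p / (p ^ 2 + q ^ 2)) 0).
        apply (ex_derive_continuous (V := R_NormedModule)). auto_derive. nra.
      + simpl. unfold Rdiv. ring. }
  assert (H : forall m, filterlim (moment (J0q q) m) (at_right 0) (locally (abel_moment q m)) /\
                filterlim (moment (J0q q) (S m)) (at_right 0) (locally (abel_moment q (S m)))).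
  { induction m as [|m [IH0 IH1]]; [split; assumption|]. split; [exact IH1|].
    set (k := INR (S m)).
    apply (moment_at_right_ext (fun p => ((2 * k + 1) * p / (p ^ 2 + q ^ 2)) * moment (J0q q) (S m) p
        + (- k ^ 2 / (p ^ 2 + q ^ 2)) * moment (J0q q) m p)).
    - intros p Hp. specialize (Hsq p).
      apply (Rmult_eq_reg_l (p ^ 2 + q ^ 2)); [|exact Hsq].
      rewrite bessel_moment_rec by assumption. cbn [pred]. fold k. field. exact Hsq.
    - replace (abel_moment q (S (S m)))
        with ((2 * k + 1) * 0 / (0 ^ 2 + q ^ 2) * abel_moment q (S m)
              + - k ^ 2 / (0 ^ 2 + q ^ 2) * abel_moment q m).
      + refine (filterlim_comp_2 _ _ Rplus (filterlim_Rmult (at_right 0) _ _ _ _ _ IH1)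
          (filterlim_Rmult (at_right 0) _ _ _ _ _ IH0)
          (filterlim_plus (K := R_AbsRing) (V := R_NormedModule) _ _)).
        * apply (continuous_at_right (fun p => (2 * k + 1) * p / (p ^ 2 + q ^ 2)) 0).
          apply (ex_derive_continuous (V := R_NormedModule)). auto_derive. nra.
        * apply (continuous_at_right (fun p => - k ^ 2 / (p ^ 2 + q ^ 2)) 0).
          apply (ex_derive_continuous (V := R_NormedModule)). auto_derive. nra.
      + change (abel_moment q (S (S m))) with (- (k ^ 2 / q ^ 2) * abel_moment q m).
        field. lra. }
  exact (proj1 (H n)).
Qed.

Lemma abel_moment_bound q n : 0 < q -> Rabs (abel_moment q n) <= INR (fact n) / q ^ S n.
Proof.
  intros Hq. apply (filterlim_abs_le (at_right 0) (moment (J0q q) n)).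
  - apply bessel_moment_lim, Hq.
  - exists (mkposreal 1 Rlt_0_1). intros p _ Hp. apply bessel_moment_bound; assumption.
Qed.

Lemma is_lim_abs_le_0 (f h : R -> R) (X : R) : (forall x, X < x -> Rabs (f x) <= h x) ->
  is_lim h p_infty 0 -> is_lim f p_infty 0.
Proof.
  intros H Hh.
  assert (Hh' : is_lim (fun x => - h x) p_infty 0).
  { replace (Finite 0) with (Rbar_opp 0) by (simpl; f_equal; ring). apply is_lim_opp, Hh. }
  apply (is_lim_le_le_loc (fun x => - h x) h); [|exact Hh'|exact Hh].
  exists X. intros x Hx. specialize (H x Hx). apply Rabs_le_between in H. exact H.
Qed.

Lemma is_lim_Rabs_0 (f : R -> R) : is_lim f p_infty 0 -> is_lim (fun x => Rabs (f x)) p_infty 0.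
Proof.
  intros H. apply is_lim_spec in H. apply is_lim_spec. intros eps.
  destruct (H eps) as [M HM]. exists M. intros x Hx. specialize (HM x Hx).
  rewrite Rminus_0_r in *. rewrite Rabs_Rabsolu. exact HM.
Qed.

(** Relation (E) of the introduction at [p = 0]. The factor [x] of the integrand
    shifts the index of the moments by one. *)
Lemma hankel_transform_exp_type (g : nat -> R) (c a : R) (u : R -> R) (q : R) :
  exp_type g c a u -> is_lim (fun x => sqrt x * u x) p_infty 0 -> a < q ->
  ex_series (fun k => Rabs (g k / INR (fact k) * abel_moment q (S k))) /\
  improper (fun x => x * J0q q x * u x) (Series (fun k => g k / INR (fact k) * abel_moment q (S k))).
Proof.
  intros Hu Hdec Haq.
  assert (Ha : 0 <= a) by apply Hu. assert (Hq : 0 < q) by lra.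
  pose proof (bounded_cont_J0q q Hq) as HJ.
  assert (Huc : forall x, continuous u x) by (intros; apply (exp_type_continuous g c a), Hu).
  pose proof (is_lim_Rabs_0 _ Hdec) as Hadec.
  assert (HJuc : forall x, continuous (fun x => J0q q x * u x) x).
  { intros x; apply continuous_Rmult; [apply HJ|apply Huc]. }
  assert (Hbd : exists K, bounded_cont (fun x => J0q q x * u x) K).
  { apply (bounded_cont_of_lim _ 0 HJuc).
    apply (is_lim_abs_le_0 _ (fun x => Rabs (sqrt x * u x)) 1); [|exact Hadec].
    intros x Hx. rewrite !Rabs_mult.
    apply Rmult_le_compat_r; [apply Rabs_pos|].
    eapply Rle_trans; [apply HJ; lra|].
    rewrite Rabs_pos_eq by apply sqrt_pos. rewrite <- sqrt_1. apply sqrt_le_1_alt; lra. }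
  destruct Hbd as [K HK].
  assert (Hmom : forall p n, 0 < p -> is_series (fun k => g k / INR (fact k) * moment (J0q q) (n + k) p)
                   (moment (fun x => J0q q x * u x) n p)).
  { apply (moment_series_continued (J0q q) 1 K g c a u 1 0 q HJ HK Hu Haq).
    intros p j Hp. rewrite Nat.add_0_r, Rmult_1_l. apply bessel_moment_bound; assumption. }
  set (M := fun n k => c * (a ^ k / INR (fact k) * (INR (fact (n + k)) / q ^ S (n + k)))).
  assert (HM : forall n, is_series (M n) (c * (INR (fact n) / (q - a) ^ S n))).
  { intros n. apply is_series_Rscal, is_series_negative_binomial; lra. }
  assert (Hterm : forall n k m, Rabs m <= INR (fact (n + k)) / q ^ S (n + k) ->
            Rabs (g k / INR (fact k) * m) <= M n k).
  { intros n k m Hm. unfold M.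
    replace (c * (a ^ k / INR (fact k) * (INR (fact (n + k)) / q ^ S (n + k))))
      with (c * a ^ k * / INR (fact k) * (INR (fact (n + k)) / q ^ S (n + k))) by (unfold Rdiv; ring).
    rewrite Rabs_mult. apply Rmult_le_compat; [apply Rabs_pos|apply Rabs_pos| |exact Hm].
    unfold Rdiv; rewrite Rabs_mult, (Rabs_pos_eq (/ _))
      by apply inv_fact_ge_0.
    apply Rmult_le_compat_r; [apply inv_fact_ge_0|apply Hu]. }
  split.
  { apply (ex_series_dominated _ (M 1%nat)); [|eexists; apply HM].
    intros k. rewrite Rabs_Rabsolu. apply Hterm. apply abel_moment_bound, Hq. }
  set (phi := fun x => x * J0q q x * u x).
  assert (Hphi : forall n p, moment phi n p = moment (fun x => J0q q x * u x) (S n) p).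
  { intros n p. unfold moment. f_equal. apply Lim_ext; intros X. apply RInt_ext; intros x _.
    unfold phi, kernel. at_type_R. simpl pow. ring. }
  apply (improper_of_moments phi c 1 (q - a)
           (fun n => Series (fun k => g k / INR (fact k) * abel_moment q (S n + k)))).
  - intros x. unfold phi. apply (continuous_Rmult (fun x => x * J0q q x) u); [|apply Huc].
    apply (continuous_Rmult (fun x => x) (J0q q)); [apply continuous_id|apply HJ].
  - destruct bessel_decay as [B [HB HBx]].
    apply (is_lim_abs_le_0 _ (fun x => sqrt (B / q) * Rabs (sqrt x * u x)) (/ q)).
    + intros x Hx. assert (Hx0 : 0 < x) by (eapply Rlt_trans; [apply Rinv_0_lt_compat, Hq|exact Hx]).
      unfold phi.
      replace (x * J0q q x * u x) with ((sqrt x * J0q q x) * (sqrt x * u x)).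
      2: { rewrite <- (sqrt_sqrt x) at 5 by lra. ring. }
      rewrite Rabs_mult. apply Rmult_le_compat_r; [apply Rabs_pos|].
      rewrite <- (sqrt_pow2 (Rabs (sqrt x * J0q q x))) by apply Rabs_pos.
      apply sqrt_le_1_alt. rewrite RPow_abs, Rabs_pos_eq by apply pow2_ge_0.
      rewrite Rpow_mult_distr, pow2_sqrt by lra.
      apply le_div_of_mult_le; [exact Hq|].
      assert (Hqx : 1 <= q * x).
      { apply (Rmult_lt_compat_l q) in Hx; [|exact Hq]. rewrite Rinv_r in Hx; lra. }
      specialize (HBx _ Hqx). unfold J0q. lra.
    + replace (Finite 0) with (Rbar_mult (sqrt (B / q)) 0) by (simpl; f_equal; ring).
      apply is_lim_scal_l, Hadec.
  - lra.
  - intros n p Hp. rewrite Hphi, Nat.add_1_r.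
    rewrite <- (is_series_unique _ _ (Hmom p (S n) Hp)), <- (is_series_unique _ _ (HM (S n))).
    apply Series_abs_le; [|eexists; apply HM].
    intros k. apply Hterm. apply bessel_moment_bound; assumption.
  - intros n.
    apply (moment_at_right_ext (fun p => Series (fun k => g k / INR (fact k) * moment (J0q q) (S n + k) p))).
    + intros p Hp. rewrite Hphi. apply is_series_unique, Hmom, Hp.
    + apply (tannery (at_right 0) (fun p k => g k / INR (fact k) * moment (J0q q) (S n + k) p)
               (fun k => g k / INR (fact k) * abel_moment q (S n + k)) (M (S n))).
      * intros k.
        apply (filterlim_comp _ _ _ (moment (J0q q) (S n + k)) (fun m => g k / INR (fact k) * m)
                 _ (locally (abel_moment q (S n + k)))); [apply bessel_moment_lim, Hq|].
        apply (filterlim_scal_r (K := R_AbsRing) (V := R_NormedModule)).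
      * exists (mkposreal 1 Rlt_0_1). intros p _ Hp k. apply Hterm, bessel_moment_bound; assumption.
      * intros k. apply Hterm, abel_moment_bound, Hq.
      * eexists; apply HM.
Qed.

(** * Values of the Gamma function *)

(** Wallis' integrals, which provide the value of [Gamma (1/2)]. *)
Definition wallis (n : nat) : R := RInt (fun x => sin x ^ n) 0 (PI / 2).

Lemma continuous_sin_pow n x : continuous (fun x => sin x ^ n) x.
Proof. apply (ex_derive_continuous (V := R_NormedModule)). auto_derive; trivial. Qed.

Lemma wallis_rec n : INR (S (S n)) * wallis (S (S n)) = INR (S n) * wallis n.
Proof.
  set (F := fun x => - (cos x * sin x ^ S n)).
  assert (H : is_RInt (fun x => INR (S (S n)) * sin x ^ S (S n) - INR (S n) * sin x ^ n) 0 (PI / 2)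
                (minus (F (PI / 2)) (F 0))).
  { apply (is_RInt_derive F).
    - intros x _. unfold F. auto_derive; trivial.
      change (match n with 0%nat => 1 | S _ => INR n + 1 end) with (INR (S n)).
      rewrite (S_INR (S n)). simpl pow.
      pose proof (sin2_cos2 x) as E. unfold Rsqr in E.
      set (y := sin x ^ n). set (k := INR (S n)).
      transitivity (sin x * (sin x * y) - k * y * (cos x * cos x)); [ring|].
      replace (cos x * cos x) with (1 - sin x * sin x) by lra. ring.
    - intros x _. apply (ex_derive_continuous (V := R_NormedModule)). auto_derive; trivial. }
  apply (is_RInt_unique (V := R_CompleteNormedModule)) in H.
  assert (E0 : minus (F (PI / 2)) (F 0) = 0).
  { unfold F. change minus with Rminus. rewrite cos_PI2, sin_0. simpl. ring. }
  rewrite E0 in H.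
  rewrite (RInt_minus (V := R_CompleteNormedModule) (fun x => INR (S (S n)) * sin x ^ S (S n))
            (fun x => INR (S n) * sin x ^ n)) in H.
  - assert (E : forall c k, RInt (fun x => c * sin x ^ k) 0 (PI / 2) = c * wallis k).
    { intros c k. apply (RInt_scal (V := R_CompleteNormedModule)), ex_RInt_cont.
      intros; apply continuous_sin_pow. }
    rewrite !E in H. change minus with Rminus in H. lra.
  - apply ex_RInt_cont; intros x. apply (continuous_Rmult (fun _ => INR (S (S n))));
      [apply continuous_const|apply continuous_sin_pow].
  - apply ex_RInt_cont; intros x. apply (continuous_Rmult (fun _ => INR (S n)));
      [apply continuous_const|apply continuous_sin_pow].
Qed.

Lemma wallis_decr n : wallis (S n) <= wallis n.
Proof.
  pose proof PI_RGT_0.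
  apply RInt_le; [lra| | |].
  - apply ex_RInt_cont; intros; apply continuous_sin_pow.
  - apply ex_RInt_cont; intros; apply continuous_sin_pow.
  - intros x Hx. simpl.
    assert (0 <= sin x) by (apply sin_ge_0; lra). pose proof (SIN_bound x).
    pose proof (pow_le (sin x) n ltac:(lra)). nra.
Qed.

Lemma wallis_0 : wallis 0 = PI / 2.
Proof.
  unfold wallis. rewrite (RInt_ext _ (fun _ => 1)) by (intros; simpl; reflexivity).
  rewrite (RInt_const (V := R_CompleteNormedModule)).
  change scal with Rmult. simpl. ring.
Qed.

Lemma wallis_1 : wallis 1 = 1.
Proof.
  unfold wallis. apply (is_RInt_unique (V := R_CompleteNormedModule)).
  assert (E : - cos (PI / 2) - - cos 0 = 1) by (rewrite cos_PI2, cos_0; ring).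
  rewrite <- E. apply (is_RInt_derive (fun x => - cos x)).
  - intros x _. auto_derive; trivial. simpl. ring.
  - intros; apply continuous_sin_pow.
Qed.

Definition half_prod (n : nat) : R := prod_f_R0 (fun j => 1 / 2 + INR j) n.

Lemma half_prod_pos n : 0 < half_prod n.
Proof.
  induction n as [|n IH]; [unfold half_prod; simpl; lra|].
  change (0 < half_prod n * (1 / 2 + INR (S n))).
  apply Rmult_lt_0_compat; [exact IH|]. pose proof (pos_INR (S n)); lra.
Qed.

Lemma half_prod_S n : half_prod (S n) = half_prod n * (1 / 2 + INR (S n)).
Proof. reflexivity. Qed.

Lemma wallis_even_odd n :
  wallis (2 * n) = PI / 2 * half_prod n / (INR (fact n) * (INR n + 1 / 2)) /\
  wallis (2 * n + 1) = INR (fact n) / (2 * half_prod n).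
Proof.
  induction n as [|n [IH1 IH2]].
  - simpl Nat.mul. simpl Nat.add. rewrite wallis_0, wallis_1.
    unfold half_prod; simpl. split; field.
  - pose proof (half_prod_pos n) as Hh. pose proof (INR_fact_lt_0 n) as Hf. pose proof (pos_INR n) as Hn.
    replace (2 * S n)%nat with (S (S (2 * n))) by lia.
    replace (S (S (2 * n)) + 1)%nat with (S (S (2 * n + 1))) by lia.
    pose proof (wallis_rec (2 * n)) as H1. pose proof (wallis_rec (2 * n + 1)) as H2.
    rewrite IH1 in H1. rewrite IH2 in H2.
    assert (N1 : INR (S (2 * n)) = 2 * INR n + 1) by (rewrite S_INR, mult_INR; reflexivity).
    assert (N2 : INR (S (S (2 * n))) = 2 * INR n + 2) by (rewrite S_INR, N1; ring).
    assert (N2' : INR (S (2 * n + 1)) = 2 * INR n + 2) by (rewrite <- N2; f_equal; lia).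
    assert (N3 : INR (S (S (2 * n + 1))) = 2 * INR n + 3) by (rewrite S_INR, N2'; ring).
    rewrite N1, N2 in H1. rewrite N2', N3 in H2.
    rewrite half_prod_S, fact_simpl, mult_INR, S_INR.
    split.
    + apply (Rmult_eq_reg_l (2 * INR n + 2)); [|lra]. rewrite H1. field. lra.
    + apply (Rmult_eq_reg_l (2 * INR n + 3)); [|lra]. rewrite H2. field. lra.
Qed.

(** Euler's limit together with its convergence, which is what the functional
    equation transports. *)
Definition is_rGamma (x l : R) : Prop :=
  is_lim_seq (fun n : nat =>
    prod_f_R0 (fun j : nat => x + INR j) n / (INR (fact n) * Rpower (INR n) x)) l.

Lemma is_rGamma_unique x l : is_rGamma x l -> rGamma x = l.
Proof. intros H. unfold rGamma. rewrite (is_lim_seq_unique _ _ H). reflexivity. Qed.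

Lemma prod_shift x n :
  prod_f_R0 (fun j => x + INR j) n * (x + INR n + 1) = x * prod_f_R0 (fun j => x + 1 + INR j) n.
Proof.
  induction n as [|n IH]; [simpl; ring|].
  cbn [prod_f_R0]. rewrite S_INR.
  transitivity (prod_f_R0 (fun j => x + INR j) n * (x + INR n + 1) * (x + INR n + 1 + 1));
    [ring|rewrite IH; ring].
Qed.

Lemma is_lim_seq_shift_ratio x : is_lim_seq (fun n => (x + INR n + 1) / INR n) 1.
Proof.
  apply (is_lim_seq_ext_loc (fun n => 1 + (x + 1) * / INR n)).
  - exists 1%nat. intros n Hn. field. apply not_0_INR; lia.
  - replace (Finite 1) with (Finite (1 + (x + 1) * 0)) by (f_equal; ring).
    apply is_lim_seq_plus'; [apply is_lim_seq_const|].
    apply (is_lim_seq_scal_l _ (x + 1) 0).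
    replace (Finite 0) with (Rbar_inv p_infty) by reflexivity.
    apply is_lim_seq_inv; [apply is_lim_seq_INR|discriminate].
Qed.

Lemma Rpower_S x n : (0 < n)%nat -> Rpower (INR n) (x + 1) = Rpower (INR n) x * INR n.
Proof. intros Hn. rewrite Rpower_plus, Rpower_1; [reflexivity|apply lt_0_INR, Hn]. Qed.

Lemma is_rGamma_down x l : is_rGamma (x + 1) l -> is_rGamma x (x * l).
Proof.
  intros H. unfold is_rGamma in *.
  destruct (INR_unbounded (Rabs x)) as [N HN].
  apply (is_lim_seq_ext_loc (fun n => x * (prod_f_R0 (fun j => x + 1 + INR j) n /
      (INR (fact n) * Rpower (INR n) (x + 1))) * / ((x + INR n + 1) / INR n))).
  - exists (S N). intros n Hn.
    assert (Hn0 : INR n <> 0) by (apply not_0_INR; lia).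
    assert (HNn : INR N <= INR n) by (apply le_INR; lia).
    assert (Hx : x + INR n + 1 <> 0).
    { pose proof (Rabs_def2 x (INR N) ltac:(lra)). lra. }
    pose proof (prod_shift x n) as E. rewrite Rpower_S by lia.
    assert (HP : Rpower (INR n) x <> 0) by (apply Rgt_not_eq, exp_pos).
    transitivity ((x * prod_f_R0 (fun j => x + 1 + INR j) n) /
                    (INR (fact n) * Rpower (INR n) x) / (x + INR n + 1)).
    + field. repeat split; auto. apply INR_fact_neq_0.
    + rewrite <- E. field. repeat split; auto. apply INR_fact_neq_0.
  - replace (Finite (x * l)) with (Finite (x * l * / 1)) by (f_equal; field).
    apply is_lim_seq_mult'.
    + apply (is_lim_seq_scal_l _ x l), H.
    + replace (Finite (/ 1)) with (Rbar_inv 1) by reflexivity.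
      apply is_lim_seq_inv; [apply is_lim_seq_shift_ratio|].
      intros E; injection E; lra.
Qed.

Lemma is_rGamma_up x l : x <> 0 -> is_rGamma x l -> is_rGamma (x + 1) (l / x).
Proof.
  intros Hx0 H. unfold is_rGamma in *.
  apply (is_lim_seq_ext_loc (fun n => / x * (prod_f_R0 (fun j => x + INR j) n /
      (INR (fact n) * Rpower (INR n) x)) * ((x + INR n + 1) / INR n))).
  - exists 1%nat. intros n Hn.
    assert (Hn0 : INR n <> 0) by (apply not_0_INR; lia).
    pose proof (prod_shift x n) as E. rewrite Rpower_S by lia.
    assert (HP : Rpower (INR n) x <> 0) by (apply Rgt_not_eq, exp_pos).
    transitivity ((prod_f_R0 (fun j => x + INR j) n * (x + INR n + 1)) / x /
                    (INR (fact n) * (Rpower (INR n) x * INR n))).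
    + field. repeat split; auto. apply INR_fact_neq_0.
    + rewrite E. field. repeat split; auto. apply INR_fact_neq_0.
  - replace (Finite (l / x)) with (Finite (/ x * l * 1)) by (f_equal; field; exact Hx0).
    apply is_lim_seq_mult'; [apply (is_lim_seq_scal_l _ (/ x) l), H|apply is_lim_seq_shift_ratio].
Qed.

Lemma is_rGamma_1 : is_rGamma 1 1.
Proof.
  apply (is_lim_seq_ext_loc (fun n => (0 + INR n + 1) / INR n)); [|apply is_lim_seq_shift_ratio].
  exists 1%nat. intros n Hn.
  assert (Hn0 : 0 < INR n) by (apply lt_0_INR; lia).
  rewrite Rpower_1 by exact Hn0.
  assert (E : prod_f_R0 (fun j => 1 + INR j) n = INR (fact (S n))).
  { clear. induction n as [|n IH]; [simpl; ring|].
    cbn [prod_f_R0]. rewrite IH, (fact_simpl (S n)), mult_INR, (S_INR (S n)). ring. }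
  rewrite E, fact_simpl, mult_INR, S_INR. field. split; [lra|apply INR_fact_neq_0].
Qed.

Lemma is_rGamma_nat n : is_rGamma (INR n + 1) (/ INR (fact n)).
Proof.
  induction n as [|n IH].
  - simpl. rewrite Rplus_0_l, Rinv_1. apply is_rGamma_1.
  - rewrite S_INR. replace (/ INR (fact (S n))) with (/ INR (fact n) / (INR n + 1)).
    + apply is_rGamma_up; [pose proof (pos_INR n); lra|exact IH].
    + rewrite fact_simpl, mult_INR, S_INR. field. split; [apply INR_fact_neq_0|pose proof (pos_INR n); lra].
Qed.

Lemma Gamma_nat n : Gamma (INR n + 1) = INR (fact n).
Proof.
  unfold Gamma. rewrite (is_rGamma_unique _ _ (is_rGamma_nat n)). apply Rinv_inv.
Qed.

Lemma rGamma_neg_nat m : rGamma (- INR m) = 0.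
Proof.
  apply is_rGamma_unique. induction m as [|m IH].
  - simpl. replace 0 with (- 0 * 1) at 2 by ring. apply is_rGamma_down.
    replace (- 0 + 1) with 1 by ring. apply is_rGamma_1.
  - rewrite S_INR. replace 0 with (- (INR m + 1) * 0) by ring. apply is_rGamma_down.
    replace (- (INR m + 1) + 1) with (- INR m) by ring. exact IH.
Qed.

(** The square of the [n]-th Euler quotient at [1/2] is pinched by
    [W_{2n+1} <= W_{2n} <= W_{2n-1}]. *)
Lemma is_rGamma_half : is_rGamma (1 / 2) (/ sqrt PI).
Proof.
  pose proof PI_RGT_0 as HPI.
  set (b := fun n => half_prod n / INR (fact n)).
  assert (Hb : forall n, (1 <= n)%nat ->
            / PI * ((- (1 / 2) + INR n + 1) / INR n) <= b n ^ 2 / INR n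
              <= / PI * (((- (1 / 2) + INR n + 1) / INR n) * ((- (1 / 2) + INR n + 1) / INR n))).
  { intros n Hn.
    assert (Hn0 : 0 < INR n) by (apply lt_0_INR; lia).
    pose proof (half_prod_pos n) as Hh. pose proof (INR_fact_lt_0 n) as Hf.
    destruct (wallis_even_odd n) as [E1 E2].
    pose proof (wallis_decr (2 * n)) as D1. replace (S (2 * n)) with (2 * n + 1)%nat in D1 by lia.
    pose proof (wallis_decr (2 * n - 1)) as D2. replace (S (2 * n - 1)) with (2 * n)%nat in D2 by lia.
    pose proof (wallis_rec (2 * n - 1)) as R1.
    replace (S (S (2 * n - 1))) with (2 * n + 1)%nat in R1 by lia.
    replace (S (2 * n - 1)) with (2 * n)%nat in R1 by lia.
    rewrite plus_INR, mult_INR in R1. simpl (INR 2) in R1. simpl (INR 1) in R1.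
    assert (E3 : wallis (2 * n - 1) = wallis (2 * n + 1) * ((INR n + 1 / 2) / INR n)).
    { apply (Rmult_eq_reg_l ((1 + 1) * INR n)); [|lra]. rewrite <- R1. field. lra. }
    rewrite E3 in D2. rewrite E1, E2 in D1. rewrite E1, E2 in D2.
    assert (B1 : 1 <= PI * b n ^ 2 / (INR n + 1 / 2)).
    { unfold b. apply (Rmult_le_compat_l (2 * half_prod n / INR (fact n))) in D1.
      2: { apply Rlt_le, Rdiv_lt_0_compat; lra. }
      replace (2 * half_prod n / INR (fact n) * (INR (fact n) / (2 * half_prod n))) with 1 in D1
        by (field; lra).
      eapply Rle_trans; [exact D1|]. apply Req_le. field. lra. }
    assert (B2 : PI * b n ^ 2 / (INR n + 1 / 2) <= (INR n + 1 / 2) / INR n).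
    { unfold b. apply (Rmult_le_compat_l (2 * half_prod n / INR (fact n))) in D2.
      2: { apply Rlt_le, Rdiv_lt_0_compat; lra. }
      replace (2 * half_prod n / INR (fact n) * (INR (fact n) / (2 * half_prod n) * ((INR n + 1 / 2) / INR n)))
        with ((INR n + 1 / 2) / INR n) in D2 by (field; lra).
      eapply Rle_trans; [|exact D2]. apply Req_le. field. lra. }
    replace (- (1 / 2) + INR n + 1) with (INR n + 1 / 2) by field.
    assert (Hc : 0 < (INR n + 1 / 2) / INR n / PI).
    { apply Rdiv_lt_0_compat; [apply Rdiv_lt_0_compat|]; lra. }
    replace (b n ^ 2 / INR n) with ((INR n + 1 / 2) / INR n / PI * (PI * b n ^ 2 / (INR n + 1 / 2)))
      by (field; lra).
    split.
    - replace (/ PI * ((INR n + 1 / 2) / INR n)) with ((INR n + 1 / 2) / INR n / PI * 1) by (field; lra).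
      apply Rmult_le_compat_l; lra.
    - replace (/ PI * ((INR n + 1 / 2) / INR n * ((INR n + 1 / 2) / INR n)))
        with ((INR n + 1 / 2) / INR n / PI * ((INR n + 1 / 2) / INR n)) by (field; lra).
      apply Rmult_le_compat_l; lra. }
  assert (Hr := is_lim_seq_shift_ratio (- (1 / 2))).
  assert (Hlim : is_lim_seq (fun n => b n ^ 2 / INR n) (/ PI)).
  { eapply (is_lim_seq_le_le_loc _ _ _ (/ PI)).
    - exists 1%nat. exact Hb.
    - replace (Finite (/ PI)) with (Finite (/ PI * 1)) by (f_equal; ring).
      apply (is_lim_seq_scal_l _ (/ PI) 1), Hr.
    - replace (Finite (/ PI)) with (Finite (/ PI * (1 * 1))) by (f_equal; ring).
      apply (is_lim_seq_scal_l _ (/ PI) (1 * 1)), is_lim_seq_mult'; exact Hr. }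
  rewrite <- sqrt_inv.
  apply (is_lim_seq_ext_loc (fun n => sqrt (b n ^ 2 / INR n))).
  - exists 1%nat. intros n Hn.
    assert (Hn0 : 0 < INR n) by (apply lt_0_INR; lia).
    pose proof (half_prod_pos n) as Hh. pose proof (INR_fact_lt_0 n) as Hf.
    assert (Hbn : 0 < b n) by (apply Rdiv_lt_0_compat; assumption).
    replace (Rpower (INR n) (1 / 2)) with (sqrt (INR n))
      by (rewrite <- Rpower_sqrt by exact Hn0; f_equal; field).
    rewrite sqrt_div, sqrt_pow2 by (try apply pow2_ge_0; lra).
    unfold b, half_prod. pose proof (sqrt_lt_R0 _ Hn0). field. lra.
  - apply (is_lim_seq_continuous sqrt (fun n => b n ^ 2 / INR n) (/ PI)); [|exact Hlim].
    apply continuity_pt_sqrt. apply Rlt_le, Rinv_0_lt_compat, HPI.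
Qed.

Lemma is_rGamma_half_pos m : is_rGamma (INR m + 3 / 2) (/ (sqrt PI * half_prod m)).
Proof.
  assert (HP : sqrt PI <> 0) by (apply Rgt_not_eq, sqrt_lt_R0, PI_RGT_0).
  induction m as [|m IH].
  - replace (INR 0 + 3 / 2) with (1 / 2 + 1) by (simpl; field).
    replace (/ (sqrt PI * half_prod 0)) with (/ sqrt PI / (1 / 2)).
    + apply is_rGamma_up; [lra|apply is_rGamma_half].
    + unfold half_prod. simpl. field. exact HP.
  - replace (INR (S m) + 3 / 2) with (INR m + 3 / 2 + 1) by (rewrite S_INR; field).
    pose proof (pos_INR m) as Hm. pose proof (half_prod_pos m).
    replace (/ (sqrt PI * half_prod (S m))) with (/ (sqrt PI * half_prod m) / (INR m + 3 / 2)).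
    + apply is_rGamma_up; [lra|exact IH].
    + rewrite half_prod_S, S_INR. field. lra.
Qed.

Lemma Gamma_half m : Gamma (INR m + 3 / 2) = sqrt PI * half_prod m.
Proof.
  unfold Gamma. rewrite (is_rGamma_unique _ _ (is_rGamma_half_pos m)). apply Rinv_inv.
Qed.

Lemma rGamma_neg_half m : rGamma (- (INR m + 1 / 2)) = (-1) ^ S m * half_prod m / sqrt PI.
Proof.
  assert (HP : sqrt PI <> 0) by (apply Rgt_not_eq, sqrt_lt_R0, PI_RGT_0).
  apply is_rGamma_unique. induction m as [|m IH].
  - replace ((-1) ^ 1 * half_prod 0 / sqrt PI) with (- (INR 0 + 1 / 2) * / sqrt PI)
      by (unfold half_prod; simpl; field; exact HP).
    apply is_rGamma_down. replace (- (INR 0 + 1 / 2) + 1) with (1 / 2) by (simpl; field).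
    apply is_rGamma_half.
  - replace ((-1) ^ S (S m) * half_prod (S m) / sqrt PI)
      with (- (INR (S m) + 1 / 2) * ((-1) ^ S m * half_prod m / sqrt PI))
      by (rewrite half_prod_S; simpl pow; field; exact HP).
    apply is_rGamma_down. replace (- (INR (S m) + 1 / 2) + 1) with (- (INR m + 1 / 2))
      by (rewrite S_INR; field). exact IH.
Qed.

Lemma half_prod_fact m : half_prod m = INR (fact (2 * m + 1)) / (2 * 4 ^ m * INR (fact m)).
Proof.
  induction m as [|m IH]; [unfold half_prod; simpl; field|].
  rewrite half_prod_S, IH. replace (2 * S m + 1)%nat with (S (S (2 * m + 1))) by lia.
  rewrite (fact_simpl (S (2 * m + 1))), (fact_simpl (2 * m + 1)), (fact_simpl m), !mult_INR.
  rewrite !S_INR, plus_INR, mult_INR. simpl (INR 2). simpl (INR 1). simpl pow.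
  field. repeat split; try apply INR_fact_neq_0; try (apply pow_nonzero; lra).
  pose proof (pos_INR m); lra.
Qed.

(** * The three series and the theorem *)

Lemma abel_moment_SS q n :
  abel_moment q (S (S n)) = - (INR (S n) ^ 2 / q ^ 2) * abel_moment q n.
Proof. reflexivity. Qed.

Lemma abel_moment_odd q m : abel_moment q (2 * m + 1) = 0.
Proof.
  induction m as [|m IH]; [reflexivity|].
  replace (2 * S m + 1)%nat with (S (S (2 * m + 1))) by lia.
  rewrite abel_moment_SS, IH. ring.
Qed.

Lemma abel_moment_even q m : q <> 0 ->
  abel_moment q (2 * m + 2) = (-1) ^ S m * 4 ^ S m * half_prod m ^ 2 / q ^ (2 * m + 3).
Proof.
  intros Hq. induction m as [|m IH].
  - unfold half_prod. simpl. field. exact Hq.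
  - replace (2 * S m + 2)%nat with (S (S (2 * m + 2))) by lia.
    replace (2 * S m + 3)%nat with (S (S (2 * m + 3))) by lia.
    rewrite abel_moment_SS, IH, half_prod_S.
    replace (INR (S (2 * m + 2))) with (2 * (1 / 2 + INR (S m))).
    2: { rewrite !S_INR, plus_INR, mult_INR. simpl. field. }
    cbn [pow]. field. split; [apply pow_nonzero|]; exact Hq.
Qed.

Lemma Gamma_2m2 m : Gamma (2 * INR m + 2) = INR (fact (2 * m + 1)).
Proof.
  rewrite <- Gamma_nat. f_equal. rewrite plus_INR, mult_INR. simpl. ring.
Qed.

(** The coefficient of [f^(k)(0)] in the transform; each of the three series is
    this one, up to a power of [q] and a constant. *)
Definition bessel_weight (k : nat) (q : R) : R := abel_moment q (S k) / INR (fact k).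

Lemma weight_term1 m q : 0 < q ->
  (-1) ^ (m + 1) * (Gamma (2 * INR m + 2) / Gamma (INR m + 1) ^ 2) * / (2 * q) ^ (2 * m)
  = q ^ 3 * bessel_weight (2 * m + 1) q.
Proof.
  intros Hq. unfold bessel_weight. replace (S (2 * m + 1)) with (2 * m + 2)%nat by lia.
  rewrite abel_moment_even, half_prod_fact, Gamma_2m2, Gamma_nat by lra.
  rewrite Nat.add_1_r, Rpow_mult_distr, (pow_add q), (pow_mult 2).
  replace (2 ^ 2) with 4 by ring. cbn [pow].
  field. repeat split; try apply INR_fact_neq_0; try (apply pow_nonzero); lra.
Qed.

Lemma weight_term2 m q : 0 < q ->
  (-1) ^ (m + 1) * (Gamma (INR m + 3 / 2) ^ 2 / Gamma (2 * INR m + 2)) * / (q / 2) ^ (2 * m)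
  = (PI * q ^ 3 / 4) * bessel_weight (2 * m + 1) q.
Proof.
  intros Hq. unfold bessel_weight. replace (S (2 * m + 1)) with (2 * m + 2)%nat by lia.
  rewrite abel_moment_even, Gamma_2m2, Gamma_half by lra.
  rewrite Rpow_mult_distr, pow2_sqrt by (apply Rlt_le, PI_RGT_0).
  unfold Rdiv at 2. rewrite Nat.add_1_r, Rpow_mult_distr, (pow_add q), pow_inv, (pow_mult 2).
  replace (2 ^ 2) with 4 by ring. cbn [pow].
  field. repeat split; try apply INR_fact_neq_0; try (apply pow_nonzero); lra.
Qed.

Lemma weight_term3 k q : 0 < q ->
  Gamma (INR k / 2 + 1) * rGamma (- (INR k / 2)) / Gamma (INR k + 1) * / (q / 2) ^ k
  = (q ^ 2 / 2) * bessel_weight k q.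
Proof.
  intros Hq. unfold bessel_weight. rewrite Gamma_nat.
  destruct (Nat.Even_or_Odd k) as [[m ->]|[m ->]].
  - replace (S (2 * m)) with (2 * m + 1)%nat by lia. rewrite abel_moment_odd.
    replace (- (INR (2 * m) / 2)) with (- INR m) by (rewrite mult_INR; simpl; field).
    rewrite rGamma_neg_nat. unfold Rdiv; ring.
  - replace (S (2 * m + 1)) with (2 * m + 2)%nat by lia.
    replace (INR (2 * m + 1) / 2 + 1) with (INR m + 3 / 2)
      by (rewrite plus_INR, mult_INR; simpl; field).
    replace (INR (2 * m + 1) / 2) with (INR m + 1 / 2)
      by (rewrite plus_INR, mult_INR; simpl; field).
    rewrite abel_moment_even, Gamma_half, rGamma_neg_half by lra.
    pose proof (sqrt_lt_R0 _ PI_RGT_0) as HP.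
    replace ((q / 2) ^ (2 * m + 1)) with (q ^ (2 * m) * q / (4 ^ m * 2)).
    + rewrite (pow_add q). cbn [pow].
      field. repeat split; try apply INR_fact_neq_0; try (apply pow_nonzero); lra.
    + unfold Rdiv. rewrite Rpow_mult_distr, pow_inv, !pow_add, (pow_mult 2), !pow_1.
      replace (2 ^ 2) with 4 by ring. reflexivity.
Qed.

Lemma Cmult_R_l (r : R) (z : C) : (RtoC r * z)%C = (r * fst z, r * snd z).
Proof. destruct z as [x y]. unfold RtoC, Cmult; simpl. f_equal; ring. Qed.

Lemma Cterm_assoc (r s : R) (z : C) : (RtoC r * z * RtoC s)%C = (RtoC (r * s) * z)%C.
Proof. rewrite RtoC_mult. ring. Qed.

Lemma Cterm_scal (s w : R) (z : C) : (RtoC (s * w) * z)%C = (RtoC s * (RtoC w * z))%C.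
Proof. rewrite RtoC_mult. ring. Qed.

Lemma sum_n_pair (x : nat -> C) n :
  sum_n (G := C_R_NormedModule) x n = (sum_n (fun k => fst (x k)) n, sum_n (fun k => snd (x k)) n).
Proof.
  induction n as [|n IH].
  - rewrite !sum_O. destruct (x 0%nat); reflexivity.
  - rewrite !sum_Sn, IH. destruct (x (S n)); reflexivity.
Qed.

Lemma is_series_C (x : nat -> C) (l : C) :
  is_series (V := C_R_NormedModule) x l <->
  is_series (fun k => fst (x k)) (fst l) /\ is_series (fun k => snd (x k)) (snd l).
Proof.
  split.
  - intros H.
    assert (H' := proj1 (filterlim_locally (U := C_R_NormedModule) _ _) H).
    split; apply (filterlim_locally (U := R_UniformSpace)); intros eps; generalize (H' eps);
      apply filter_imp; intros n Hn; rewrite sum_n_pair in Hn; apply Hn.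
  - intros [H1 H2]. apply (filterlim_locally (U := C_R_NormedModule)). intros eps.
    assert (A1 := proj1 (filterlim_locally (U := R_UniformSpace) _ _) H1 eps).
    assert (A2 := proj1 (filterlim_locally (U := R_UniformSpace) _ _) H2 eps).
    generalize (filter_and _ _ A1 A2). apply filter_imp.
    intros n Hn. rewrite sum_n_pair. exact Hn.
Qed.

Lemma Cmod_le_sum (z : C) : Cmod z <= Rabs (fst z) + Rabs (snd z).
Proof.
  replace z with (RtoC (fst z) + Ci * RtoC (snd z))%C at 1.
  - eapply Rle_trans; [apply Cmod_triangle|].
    rewrite Cmod_mult, !Cmod_R.
    assert (E : Cmod Ci = 1) by (unfold Cmod, Ci; cbn [fst snd]; replace (0 ^ 2 + 1 ^ 2) with 1 by ring; apply sqrt_1).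
    rewrite E. lra.
  - destruct z as [x y]. unfold RtoC, Ci, Cplus, Cmult; simpl. f_equal; ring.
Qed.

Lemma fst_le_Cmod (z : C) : Rabs (fst z) <= Cmod z.
Proof. eapply Rle_trans; [apply Rmax_l|apply Rmax_Cmod]. Qed.

Lemma snd_le_Cmod (z : C) : Rabs (snd z) <= Cmod z.
Proof. eapply Rle_trans; [apply Rmax_r|apply Rmax_Cmod]. Qed.

Lemma ex_series_tail_small (M : nat -> R) (eps : R) : ex_series M -> 0 < eps ->
  exists N, forall n, (N <= n)%nat -> Rabs (Series (fun k => M (S n + k)%nat)) < eps.
Proof.
  intros HM Heps. pose proof (Series_correct _ HM) as H.
  assert (Hl : is_lim_seq (sum_n M) (Series M)) by exact H.
  apply is_lim_seq_spec in Hl. destruct (Hl (mkposreal eps Heps)) as [N HN]; simpl in HN.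
  exists N. intros n Hn. specialize (HN n Hn).
  rewrite (Series_incr_n M (S n)) in HN by (trivial; lia).
  rewrite sum_n_Reals in HN. simpl pred in HN.
  rewrite Rabs_minus_sym in HN. eapply Rle_lt_trans; [|exact HN].
  apply Req_le. f_equal. simpl. ring.
Qed.

Lemma Series_remainder_le (x M : nat -> R) n :
  (forall k, Rabs (x k) <= M k) -> ex_series M ->
  Rabs (sum_n x n - Series x) <= Series (fun k => M (S n + k)%nat).
Proof.
  intros H HM.
  assert (Hx : ex_series x) by (apply (ex_series_dominated _ M); assumption).
  rewrite (Series_incr_n x (S n)), sum_n_Reals by (trivial; lia). simpl pred.
  replace (_ - (_ + _)) with (- Series (fun k => x (S n + k)%nat)) by ring.
  rewrite Rabs_Ropp. apply Series_abs_le; [intros; apply H|].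
  apply (ex_series_incr_n M (S n)), HM.
Qed.

(** The moduli of the terms decrease in [q], so the series at [q0] majorizes
    the series on [[q0, +oo)]. *)
Lemma abs_unif_sum_intro (a : R) (u x : nat -> R -> C) (s : R -> R) (h : R -> C) :
  (forall m q, a < q -> u m q = (RtoC (s q) * x m q)%C) ->
  (forall q, a < q -> ex_series (fun m => Rabs (fst (x m q))) /\ ex_series (fun m => Rabs (snd (x m q)))) ->
  (forall q, a < q -> Series (fun m => fst (x m q)) = fst (h q) /\
                      Series (fun m => snd (x m q)) = snd (h q)) ->
  (forall m q0 q, a < q0 -> q0 <= q -> Cmod (u m q) <= Cmod (u m q0)) ->
  abs_unif_sum a u (fun q => (RtoC (s q) * h q)%C).
Proof.
  intros Hu Hex Hsum Hmono.
  assert (Habs : forall q, a < q -> ex_series (fun m => Cmod (u m q))).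
  { intros q Hq. destruct (Hex q Hq) as [H1 H2].
    apply (ex_series_dominated _ (fun m => Rabs (s q) * (Rabs (fst (x m q)) + Rabs (snd (x m q))))).
    - intros m. rewrite Rabs_pos_eq by apply Cmod_ge_0.
      rewrite (Hu m q Hq), Cmod_mult, Cmod_R.
      apply Rmult_le_compat_l; [apply Rabs_pos|apply Cmod_le_sum].
    - apply ex_series_Rscal. apply (ex_series_plus (V := R_NormedModule)); assumption. }
  assert (Hcomp : forall q, a < q ->
     Series (fun m => fst (u m q)) = fst (RtoC (s q) * h q)%C /\
     Series (fun m => snd (u m q)) = snd (RtoC (s q) * h q)%C).
  { intros q Hq. destruct (Hsum q Hq) as [H1 H2]. rewrite Cmult_R_l; simpl.
    rewrite <- H1, <- H2, <- !Series_scal_l.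
    split; apply Series_ext; intros m; rewrite (Hu m q Hq), Cmult_R_l; reflexivity. }
  split; [exact Habs|split].
  - intros q Hq. destruct (Hcomp q Hq) as [H1 H2]. apply is_series_C. rewrite <- H1, <- H2.
    split; apply Series_correct.
    + apply (ex_series_dominated _ (fun m => Cmod (u m q))); [|apply Habs, Hq].
      intros m; apply fst_le_Cmod.
    + apply (ex_series_dominated _ (fun m => Cmod (u m q))); [|apply Habs, Hq].
      intros m; apply snd_le_Cmod.
  - intros q0 Hq0 eps Heps.
    destruct (ex_series_tail_small _ (eps / 2) (Habs q0 Hq0) ltac:(lra)) as [N HN].
    exists N. intros n Hn q Hq. specialize (HN n Hn).
    assert (Haq : a < q) by lra.
    destruct (Hcomp q Haq) as [H1 H2].
    eapply Rle_lt_trans; [apply Cmod_le_sum|].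
    rewrite sum_n_pair. unfold Cminus, Cplus, Copp. cbn [fst snd].
    rewrite <- H1, <- H2.
    pose proof (Rle_abs (Series (fun k => Cmod (u (S n + k)%nat q0)))) as H3.
    assert (T1 : Rabs (sum_n (fun m => fst (u m q)) n - Series (fun m => fst (u m q)))
                  <= Series (fun k => Cmod (u (S n + k)%nat q0))).
    { apply (Series_remainder_le _ (fun m => Cmod (u m q0))); [|apply Habs, Hq0].
      intros m. eapply Rle_trans; [apply fst_le_Cmod|apply Hmono; assumption]. }
    assert (T2 : Rabs (sum_n (fun m => snd (u m q)) n - Series (fun m => snd (u m q)))
                  <= Series (fun k => Cmod (u (S n + k)%nat q0))).
    { apply (Series_remainder_le _ (fun m => Cmod (u m q0))); [|apply Habs, Hq0].
      intros m. eapply Rle_trans; [apply snd_le_Cmod|apply Hmono; assumption]. }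
    unfold Rminus in T1, T2. lra.
Qed.

Lemma is_series_odd_terms (b : nat -> R) (l : R) : (forall m, b (2 * m)%nat = 0) ->
  is_series b l -> is_series (fun m => b (2 * m + 1)%nat) l.
Proof.
  intros H0 Hl.
  assert (Hs : forall n, sum_n b (2 * n + 1) = sum_n (fun m => b (2 * m + 1)%nat) n).
  { induction n as [|n IH].
    - pose proof (H0 0%nat) as E. change (2 * 0)%nat with 0%nat in *.
      change (0 + 1)%nat with 1%nat. rewrite sum_Sn, !sum_O, E. exact (Rplus_0_l (b 1%nat)).
    - replace (2 * S n + 1)%nat with (S (S (2 * n + 1))) by lia.
      rewrite !sum_Sn, IH. replace (S (2 * n + 1)) with (2 * S n)%nat by lia. rewrite H0.
      replace (2 * S n + 1)%nat with (S (2 * S n)) by lia.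
      exact (f_equal (fun z => z + b (S (2 * S n))) (Rplus_0_r _)). }
  assert (Hlim : is_lim_seq (sum_n b) l) by exact Hl.
  assert (Hsub : is_lim_seq (sum_n (fun m => b (2 * m + 1)%nat)) l); [|exact Hsub].
  apply (is_lim_seq_ext _ _ _ Hs).
  apply (is_lim_seq_subseq (sum_n b) l (fun n => (2 * n + 1)%nat)); [|exact Hlim].
  apply eventually_subseq. intros n; lia.
Qed.

Lemma ex_series_odd_terms (b : nat -> R) : (forall m, b (2 * m)%nat = 0) ->
  ex_series b -> ex_series (fun m => b (2 * m + 1)%nat).
Proof. intros H [l Hl]. exists l. apply is_series_odd_terms; assumption. Qed.

Lemma Cmod_power_antitone (r : R) (z : C) (c : R) k q0 q : 0 < c -> 0 < q0 -> q0 <= q ->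
  Cmod (RtoC r * z * RtoC (/ (c * q) ^ k)) <= Cmod (RtoC r * z * RtoC (/ (c * q0) ^ k)).
Proof.
  intros Hc H0 Hq. rewrite !(Cmod_mult (RtoC r * z)), !Cmod_R.
  apply Rmult_le_compat_l; [apply Cmod_ge_0|].
  assert (H1 : 0 < (c * q0) ^ k) by (apply pow_lt, Rmult_lt_0_compat; lra).
  assert (H2 : (c * q0) ^ k <= (c * q) ^ k) by (apply pow_incr; nra).
  rewrite !Rabs_pos_eq by (apply Rlt_le, Rinv_0_lt_compat; lra).
  apply Rinv_le_contravar; assumption.
Qed.

Lemma is_Hankel_intro (f : R -> C) (q : R) (l : C) : (forall x, continuous (fun x => fst (f x)) x) ->
  (forall x, continuous (fun x => snd (f x)) x) -> 0 < q ->
  improper (fun x => x * J0q q x * fst (f x)) (fst l) ->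
  improper (fun x => x * J0q q x * snd (f x)) (snd l) -> is_Hankel 0 f q l.
Proof.
  intros Hc1 Hc2 Hq H1 H2. unfold is_Hankel, is_RInt_gen.
  assert (Hint : forall g, (forall x, continuous g x) ->
            forall X, is_RInt (fun x => x * J0q q x * g x) 0 X (RInt (fun x => x * J0q q x * g x) 0 X)).
  { intros g Hg X. apply (RInt_correct (V := R_CompleteNormedModule)), ex_RInt_cont.
    intros x. apply (continuous_Rmult (fun x => x * J0q q x) g); [|apply Hg].
    apply (continuous_Rmult (fun x => x) (J0q q)); [apply continuous_id|].
    apply bounded_cont_J0q, Hq. }
  intros P [eps HP].
  assert (A1 := proj1 (filterlim_locally _ _) H1 eps).
  assert (A2 := proj1 (filterlim_locally _ _) H2 eps).
  refine (Filter_prod _ _ _ (fun x => x = 0) _ (eq_refl _ : at_point 0 (fun x => x = 0))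
            (filter_and _ _ A1 A2 : Rbar_locally p_infty _) _).
  intros x X -> [B1 B2]. simpl.
  exists (RInt (fun x => x * J0q q x * fst (f x)) 0 X, RInt (fun x => x * J0q q x * snd (f x)) 0 X).
  split; [|apply HP; split; assumption].
  apply (is_RInt_fct_extend_pair (U := R_NormedModule) (V := R_NormedModule)).
  - eapply is_RInt_ext; [|apply Hint, Hc1]. intros x _. rewrite Cmult_R_l. reflexivity.
  - eapply is_RInt_ext; [|apply Hint, Hc2]. intros x _. rewrite Cmult_R_l. reflexivity.
Qed.

Theorem theorem1
  (f : R -> C) (G : C -> C) (delta c a : R)
  (f_not_even : ~ (forall x : R, f (- x) = f x))
  (f_regular : regular_at_R f 0)
  (G_interp : forall k : nat, G (RtoC (INR k)) = (RtoC ((-1) ^ k) * Cderiv_n f k 0)%C)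
  (f_taylor : forall x : R,
     is_series (V := C_R_NormedModule)
       (fun k : nat => (G (RtoC (INR k)) / RtoC (INR (fact k)) * RtoC ((- x) ^ k))%C) (f x))
  (f_decay : filterlim (fun x : R => (RtoC (sqrt x) * f x)%C)
     (Rbar_locally p_infty) (locally (T := C_UniformSpace) (RtoC 0)))
  (delta_range : 3 / 4 < delta < 1)
  (G_regular : forall s : C, half_plane delta s -> regular_at_C G s)
  (a_pos : 0 < a)
  (G_growth : forall s : C, half_plane delta s -> Cmod (G s) < c * Rpower a (Re s)) :
  exists H S1 S2 S3 : R -> C,
    (forall q : R, a < q -> is_Hankel 0 f q (H q)) /\
    abs_unif_sum a (term1 f) S1 /\
    abs_unif_sum a (term2 f) S2 /\
    abs_unif_sum a (term3 f) S3 /\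
    (forall q : R, a < q ->
       H q = (RtoC (1 / q ^ 3) * S1 q)%C /\
       H q = (RtoC (4 / (PI * q ^ 3)) * S2 q)%C /\
       H q = (RtoC (2 / q ^ 2) * S3 q)%C).
Proof.
  set (D := fun k => Cderiv_n f k 0).
  assert (HDb : forall k, Cmod (D k) <= c * a ^ k).
  { intros k. apply Rlt_le.
    assert (Hk : half_plane delta (RtoC (INR k))).
    { unfold half_plane, RtoC, Re; simpl. pose proof (pos_INR k). lra. }
    specialize (G_growth _ Hk). rewrite G_interp, Cmod_mult, Cmod_R, pow_1_abs, Rmult_1_l in G_growth.
    unfold RtoC, Re in G_growth; cbn [fst] in G_growth. rewrite Rpower_pow in G_growth by exact a_pos.
    exact G_growth. }
  assert (Htay : forall x k, (G (RtoC (INR k)) / RtoC (INR (fact k)) * RtoC ((- x) ^ k))%C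
             = (fst (D k) / INR (fact k) * x ^ k, snd (D k) / INR (fact k) * x ^ k)).
  { intros x k. rewrite G_interp. fold (D k). unfold Cdiv.
    rewrite <- RtoC_inv by apply INR_fact_neq_0.
    replace (- x) with (-1 * x) by ring. rewrite Rpow_mult_distr.
    rewrite Cterm_assoc, Cterm_assoc, Cmult_R_l.
    assert (E : (-1) ^ k * (-1) ^ k = 1)
      by (rewrite <- Rpow_mult_distr; replace (-1 * -1) with 1 by ring; apply pow1).
    replace ((-1) ^ k * / INR (fact k) * ((-1) ^ k * x ^ k)) with (/ INR (fact k) * x ^ k)
      by (transitivity (((-1) ^ k * (-1) ^ k) * (/ INR (fact k) * x ^ k)); [rewrite E|]; ring).
    f_equal; unfold Rdiv; ring. }
  assert (Hf1 : exp_type (fun k => fst (D k)) c a (fun x => fst (f x))).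
  { split; [lra|split].
    - intros k. eapply Rle_trans; [apply fst_le_Cmod|apply HDb].
    - intros x. destruct (proj1 (is_series_C _ _) (f_taylor x)) as [H1 _].
      eapply is_series_ext; [|exact H1]. intros k; cbv beta. rewrite Htay. reflexivity. }
  assert (Hf2 : exp_type (fun k => snd (D k)) c a (fun x => snd (f x))).
  { split; [lra|split].
    - intros k. eapply Rle_trans; [apply snd_le_Cmod|apply HDb].
    - intros x. destruct (proj1 (is_series_C _ _) (f_taylor x)) as [_ H1].
      eapply is_series_ext; [|exact H1]. intros k; cbv beta. rewrite Htay. reflexivity. }
  assert (Hd1 : is_lim (fun x => sqrt x * fst (f x)) p_infty 0).
  { apply is_lim_spec. intros eps.
    generalize (proj1 (filterlim_locally _ _) f_decay eps). apply filter_imp.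
    intros x Hx. rewrite Cmult_R_l in Hx. apply Hx. }
  assert (Hd2 : is_lim (fun x => sqrt x * snd (f x)) p_infty 0).
  { apply is_lim_spec. intros eps.
    generalize (proj1 (filterlim_locally _ _) f_decay eps). apply filter_imp.
    intros x Hx. rewrite Cmult_R_l in Hx. apply Hx. }
  pose proof (fun q => hankel_transform_exp_type _ c a _ q Hf1 Hd1) as R1.
  pose proof (fun q => hankel_transform_exp_type _ c a _ q Hf2 Hd2) as R2.
  set (x := fun k q => (RtoC (bessel_weight k q) * D k)%C).
  assert (Hx1 : forall k q, fst (D k) / INR (fact k) * abel_moment q (S k) = fst (x k q)).
  { intros k q. unfold x, bessel_weight. rewrite Cmult_R_l. cbn [fst]. unfold Rdiv; ring. }
  assert (Hx2 : forall k q, snd (D k) / INR (fact k) * abel_moment q (S k) = snd (x k q)).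
  { intros k q. unfold x, bessel_weight. rewrite Cmult_R_l. cbn [snd]. unfold Rdiv; ring. }
  set (H := fun q => (Series (fun k => fst (x k q)), Series (fun k => snd (x k q))) : C).
  assert (Hex : forall q, a < q -> ex_series (fun k => Rabs (fst (x k q))) /\
                                   ex_series (fun k => Rabs (snd (x k q)))).
  { intros q Hq. split.
    - eapply ex_series_ext; [|apply (R1 q Hq)]. intros k; cbv beta; rewrite Hx1; reflexivity.
    - eapply ex_series_ext; [|apply (R2 q Hq)]. intros k; cbv beta; rewrite Hx2; reflexivity. }
  assert (Heven : forall m q, x (2 * m)%nat q = RtoC 0).
  { intros m q. unfold x, bessel_weight. replace (S (2 * m)) with (2 * m + 1)%nat by lia.
    rewrite abel_moment_odd. unfold Rdiv. rewrite Rmult_0_l. ring. }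
  assert (Hexo : forall q, a < q -> ex_series (fun m => Rabs (fst (x (2 * m + 1)%nat q))) /\
                                    ex_series (fun m => Rabs (snd (x (2 * m + 1)%nat q)))).
  { intros q Hq. destruct (Hex q Hq) as [E1 E2]. split.
    - apply (ex_series_odd_terms (fun k => Rabs (fst (x k q)))); [|exact E1].
      intros m. rewrite Heven. simpl. apply Rabs_R0.
    - apply (ex_series_odd_terms (fun k => Rabs (snd (x k q)))); [|exact E2].
      intros m. rewrite Heven. simpl. apply Rabs_R0. }
  assert (Hso : forall q, a < q ->
     Series (fun m => fst (x (2 * m + 1)%nat q)) = fst (H q) /\
     Series (fun m => snd (x (2 * m + 1)%nat q)) = snd (H q)).
  { intros q Hq. destruct (Hex q Hq) as [E1 E2]. split; apply is_series_unique.
    - apply (is_series_odd_terms (fun k => fst (x k q))); [intros m; rewrite Heven; reflexivity|].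
      apply Series_correct, ex_series_Rabs, E1.
    - apply (is_series_odd_terms (fun k => snd (x k q))); [intros m; rewrite Heven; reflexivity|].
      apply Series_correct, ex_series_Rabs, E2. }
  (* each sum is a multiple of the transform, by the factor that turns
     [bessel_weight] into the coefficients of that series *)
  exists H, (fun q => (RtoC (q ^ 3) * H q)%C), (fun q => (RtoC (PI * q ^ 3 / 4) * H q)%C),
    (fun q => (RtoC (q ^ 2 / 2) * H q)%C).
  split; [|split; [|split; [|split]]].
  - intros q Hq. apply is_Hankel_intro; [| |lra| |].
    + intros y. apply (exp_type_continuous (fun k => fst (D k)) c a), Hf1.
    + intros y. apply (exp_type_continuous (fun k => snd (D k)) c a), Hf2.
    + destruct (R1 q Hq) as [_ E]. unfold H; cbn [fst].
      rewrite (Series_ext _ _ (fun k => Hx1 k q)) in E. exact E.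
    + destruct (R2 q Hq) as [_ E]. unfold H; cbn [snd].
      rewrite (Series_ext _ _ (fun k => Hx2 k q)) in E. exact E.
  - apply (abs_unif_sum_intro a _ (fun m q => x (2 * m + 1)%nat q)); [|exact Hexo|exact Hso|].
    + intros m q Hq. unfold term1, x. rewrite Cterm_assoc, weight_term1, Cterm_scal by lra. reflexivity.
    + intros m q0 q H0 Hq. unfold term1. apply Cmod_power_antitone; lra.
  - apply (abs_unif_sum_intro a _ (fun m q => x (2 * m + 1)%nat q)); [|exact Hexo|exact Hso|].
    + intros m q Hq. unfold term2, x. rewrite Cterm_assoc, weight_term2, Cterm_scal by lra. reflexivity.
    + intros m q0 q H0 Hq. unfold term2.
      replace (q / 2) with (/ 2 * q) by field. replace (q0 / 2) with (/ 2 * q0) by field.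
      apply Cmod_power_antitone; lra.
  - apply (abs_unif_sum_intro a _ x); [|exact Hex|intros; split; reflexivity|].
    + intros k q Hq. unfold term3, x. rewrite Cterm_assoc, weight_term3, Cterm_scal by lra. reflexivity.
    + intros k q0 q H0 Hq. unfold term3.
      replace (q / 2) with (/ 2 * q) by field. replace (q0 / 2) with (/ 2 * q0) by field.
      apply Cmod_power_antitone; lra.
  - intros q Hq. pose proof PI_RGT_0.
    assert (E : forall r s, r * s = 1 -> H q = (RtoC r * (RtoC s * H q))%C).
    { intros r s Hrs. rewrite <- Cterm_scal, Hrs. ring. }
    repeat split; apply E; field; lra.
Qed.
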